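(* Consider the sequence of controlled multiclass $G/G/1$ queueing systems, the cost $J^n$, the value functions $V^n(\tilde X^n(0))=\inf_{B^n\in\mathfrak{B}^n}J^n(\tilde X^n(0),B^n)$ and the differential game value $V(x)$ described in the context. Suppose that (1) (moderate deviation principle) $(\tilde A^n,\tilde S^n)$ satisfies the following on $\mathcal{D}([0,T],\mathbb{R}^{2I})$: for every closed $F$, $\limsup_{n\to\infty} b_n^{-2}\log\mathbb{P}((\tilde A^n,\tilde S^n)\in F)\le-\inf_{\psi\in F}\mathbb{I}(\psi)$, and for every open $G$, $\liminf_{n\to\infty} b_n^{-2}\log\mathbb{P}((\tilde A^n,\tilde S^n)\in G)\ge-\inf_{\psi\in G}\mathbb{I}(\psi)$; (2) (continuous minimizing curve) there exists a continuous map $f:\mathbb{R}_+\to\mathbb{R}_+^I$ such that for all $w\in\mathbb{R}_+$, $\theta\cdot f(w)=w$, $h(f(w))=\inf\{h(q):q\in\mathbb{R}_+^I,\theta\cdot q=w\}$ and $g(f(w))=\inf\{g(q):q\in\mathbb{R}_+^I,\theta\cdot q=w\}$; (3) if either $g$ or $h$ is unbounded, then in addition, for any constant $K$, $\limsup_{n\to\infty}\frac{1}{b_n^2}\log\mathbb{E}\big[e^{b_n^2K(\|\tilde A^n\|_T^*+\|\tilde S^n\|_T^* )}\big]<\infty$. Then $\lim_{n\to\infty}V^n(\tilde X^n(0))=V(x)$.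
   Context: Notation. $\mathbb{R}_+=[0,\infty)$; $\|\cdot\|$ is the Euclidean norm; $\|\phi\|_t^*=\sup_{s\in[0,t]}\|\phi(s)\|$. $T>0$ is fixed, $I\in\mathbb{N}$, $\mathcal{I}=\{1,\dots,I\}$. $\mathcal{C}([0,T],\mathbb{R}^k)$ and $\mathcal{D}([0,T],\mathbb{R}^k)$ are the continuous, resp. right-continuous with finite left limits (RCLL), functions; $\mathcal{D}$ carries the Skorohod $J_1$ topology. $\chi$ denotes an indicator. Queueing model. On a probability space $(\Omega,\mathcal{F},\mathbb{P})$ there are $2I$ mutually independent sequences $\{\mathit{IA}_i(l)\}_{l\in\mathbb{N}}$, $\{\mathit{ST}_i(l)\}_{l\in\mathbb{N}}$, $i\in\mathcal{I}$, each consisting of positive i.i.d. random variables with mean $1$ and variances $\sigma_{i,IA}^2,\sigma_{i,ST}^2\in(0,\infty)$. For $n\in\mathbb{N}$ let $\lambda_i^n,\mu_i^n>0$ and $A_i^n(t)=\sup\{l\ge0:\sum_{k=1}^l\mathit{IA}_i(k)/\lambda_i^n\le t\}$, $S_i^n(t)=\sup\{l\ge0:\sum_{k=1}^l\mathit{ST}_i(k)/\mu_i^n\le t\}$. The positive sequence $b_n$ satisfies $b_n\to\infty$, $b_n/\sqrt n\to0$. As $n\to\infty$: $\lambda_i^n/n\to\lambda_i\in(0,\infty)$, $\mu_i^n/n\to\mu_i\in(0,\infty)$, $\tilde\lambda_i^n:=(\lambda_i^n-n\lambda_i)/(b_n\sqrt n)\to\tilde\lambda_i\in\mathbb{R}$,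 $\tilde\mu_i^n:=(\mu_i^n-n\mu_i)/(b_n\sqrt n)\to\tilde\mu_i\in\mathbb{R}$. With $\rho_i=\lambda_i/\mu_i$, $\sum_{i=1}^I\rho_i=1$ (critical load). Let $\mathbb{S}=\{s\in[0,1]^I:\sum_is_i\le1\}$. Given an $\mathbb{S}$-valued process $B^n$, put $T_i^n(t)=\int_0^tB_i^n(s)\,ds$ and $X_i^n(t)=X_i^n(0)+A_i^n(t)-S_i^n(T_i^n(t))$, where $X_i^n(0)$ is deterministic ($X^n_i(t)$ is the number of class-$i$ customers in the system). $B^n$ is an admissible control, $B^n\in\mathfrak{B}^n$, if its paths lie in $\mathcal{D}([0,T],\mathbb{S})$, it is adapted to the filtration $\sigma\{A_i^n(s),S_i^n(T_i^n(s)):i\in\mathcal{I},s\le t\}$, and $X_i^n(t)=0$ implies $B_i^n(t)=0$ for all $i$ and $t$. Scaled processes: $\tilde A_i^n(t)=(A_i^n(t)-\lambda_i^nt)/(b_n\sqrt n)$, $\tilde S_i^n(t)=(S_i^n(t)-\mu_i^nt)/(b_n\sqrt n)$, $\tilde X_i^n(t)=X_i^n(t)/(b_n\sqrt n)$. It is assumed that $\tilde X^n(0)\to x\in\mathbb{R}_+^I$. Cost. $h,g:\mathbb{R}_+^I\to\mathbb{R}$ are nonnegative, continuous, nondecreasing for the componentwise partial order, and of at most linear growth: $g(q)+h(q)\le c_1\|q\|+c_2$ for some constants $c_1,c_2$. The cost is $J^n(\tilde X^n(0),B^n)=\frac{1}{b_n^2}\log\mathbb{E}\big[e^{b_n^2[\int_0^Th(\tilde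 X^n(s))ds+g(\tilde X^n(T))]}\big]$. Rate function. For $\psi=(\psi^1,\psi^2)\in\mathcal{D}([0,T],\mathbb{R}^{2I})$ with $\psi^1,\psi^2$ being $\mathbb{R}^I$-valued, $\mathbb{I}(\psi)=\mathbb{I}_1(\psi^1)+\mathbb{I}_2(\psi^2)$, where $\mathbb{I}_1(\phi)=\frac12\sum_{i=1}^I\frac{1}{\lambda_i\sigma_{i,IA}^2}\int_0^T\dot\phi_i(s)^2ds$ and $\mathbb{I}_2(\phi)=\frac12\sum_{i=1}^I\frac{1}{\mu_i\sigma_{i,ST}^2}\int_0^T\dot\phi_i(s)^2ds$ if all $\phi_i$ are absolutely continuous and $\phi(0)=0$, and both are $+\infty$ otherwise. Differential game. $\theta=(1/\mu_1,\dots,1/\mu_I)$, $y_i=\tilde\lambda_i-\rho_i\tilde\mu_i$, $y=(y_1,\dots,y_I)$. $\mathcal{P}$ is the set of $\psi\in\mathcal{C}([0,T],\mathbb{R}^{2I})$ with $\psi(0)=0$; $\mathcal{E}$ is the set of $\zeta\in\mathcal{C}([0,T],\mathbb{R}^I)$ such that $\theta\cdot\zeta$ starts from zero and is nondecreasing; both have the uniform topology. Let $\boldsymbol\rho[\phi]_i(t)=\phi_i(\rho_it)$. For $\psi=(\psi^1,\psi^2)\in\mathcal{P}$, $\zeta\in\mathcal{E}$ the dynamics are $\varphi_i(t)=x_i+y_it+\psi_i^1(t)-\boldsymbol\rho[\psi^2]_i(t)+\zeta_i(t)$. A strategy is a measurable map $\alpha:\mathcal{P}\to\mathcal{E}$ that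 is causal: for all $\psi,\tilde\psi\in\mathcal{P}$ and $t\in[0,T]$, if $(\psi^1,\boldsymbol\rho[\psi^2])(s)=(\tilde\psi^1,\boldsymbol\rho[\tilde\psi^2])(s)$ for all $s\in[0,t]$ then $\alpha[\psi](s)=\alpha[\tilde\psi](s)$ for all $s\in[0,t]$. It is admissible, $\alpha\in A_x$, if for every $\psi\in\mathcal{P}$ the dynamics $\varphi$ corresponding to $(\psi,\alpha[\psi])$ satisfy $\varphi_i(t)\ge0$ for all $i$ and $t$. With $c(\psi,\zeta)=\int_0^Th(\varphi(t))dt+g(\varphi(T))-\mathbb{I}(\psi)$, the value of the game is $V(x)=\inf_{\alpha\in A_x}\sup_{\psi\in\mathcal{P}}c(\psi,\alpha[\psi])$. *)

(* Defs.v *)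
From HB Require Import structures.
From mathcomp Require Import all_boot all_order all_algebra.
From mathcomp Require Import all_classical all_reals all_analysis.

Set Implicit Arguments.
Unset Strict Implicit.
Unset Printing Implicit Defensive.

Import Order.TTheory GRing.Theory Num.Theory.
Import numFieldNormedType.Exports.

Local Open Scope classical_set_scope.
Local Open Scope ring_scope.

Section paths.
Context {R : realType}.
Variable T : R.

Definition enorm (k : nat) (v : 'rV[R]_k) : R :=
  Num.sqrt (\sum_(i < k) v ord0 i ^+ 2).

Definition dotp (k : nat) (u v : 'rV[R]_k) : R :=
  \sum_(i < k) u ord0 i * v ord0 i.

Definition orthant (k : nat) : set 'rV[R]_k :=
  [set q | forall i, 0 <= q ord0 i].

(* Paths on [0, T] are total functions on R of which only the restriction to
   [0, T] matters: the sets of paths that are called open, closed or Borel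
   below do not distinguish two paths that agree on [0, T]. *)

Definition sup_norm (k : nat) (phi : R -> 'rV[R]_k) : \bar R :=
  ereal_sup [set (enorm (phi s))%:E | s in `[0, T]%classic].

Definition rcll (k : nat) : set (R -> 'rV[R]_k) :=
  [set phi : R -> 'rV[R]_k |
    (forall t : R, 0 <= t < T -> phi s @[s --> t^'+] --> phi t) /\
    (forall t : R, 0 < t <= T ->
       exists l : 'rV[R]_k, phi s @[s --> t^'-] --> l)].

Definition time_change : set (R -> R) :=
  [set l : R -> R | [/\ {within `[0, T], continuous l},
               {in `[0, T] &, {homo l : s t / s < t}},
               l 0 = 0 & l T = T]].

Definition j1_dist (k : nat) (phi psi : R -> 'rV[R]_k) : \bar R :=
  ereal_inf [set maxe (ereal_sup [set `|l t - t|%:E | t in `[0, T]%classic])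
                      (sup_norm (fun t => phi t - psi (l t)))
            | l in time_change].

Definition j1_open (k : nat) (G : set (R -> 'rV[R]_k)) : Prop :=
  G `<=` @rcll k /\
  forall phi, G phi -> exists2 e : R, 0 < e &
    forall psi, rcll psi -> (j1_dist phi psi < e%:E)%E -> G psi.

Definition j1_closed (k : nat) (F : set (R -> 'rV[R]_k)) : Prop :=
  F `<=` @rcll k /\ j1_open (@rcll k `\` F).

Definition abs_continuous (f : R -> R) : Prop :=
  forall e : R, 0 < e -> exists2 delta : R, 0 < delta &
    forall (m : nat) (a c : 'I_m -> R),
      (forall j, [/\ 0 <= a j, a j <= c j & c j <= T]) ->
      (forall j j', j != j' -> c j <= a j' \/ c j' <= a j) ->
      \sum_(j < m) (c j - a j) < delta ->
      \sum_(j < m) `|f (c j) - f (a j)| < e.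

(* The weighted action is (1/2) sum_i v_i^-1 int_0^T phi_i'(s)^2 ds.  The
   library derivative derive1 is total, and it is the actual derivative almost
   everywhere on [0, T] when phi is absolutely continuous. *)
Definition action (k : nat) (v : 'I_k -> R) (phi : R -> 'rV[R]_k) : \bar R :=
  if `[< (forall i, abs_continuous (fun s => phi s ord0 i)) /\ phi 0 = 0 >]
  then ((2^-1)%:E * \sum_(i < k) ((v i)^-1)%:E *
        \int[lebesgue_measure]_(s in `[0%R, T])
          (derive1 (fun u => phi u ord0 i) s ^+ 2)%:E)%E
  else +oo%E.

Definition cpath (k : nat) : set (R -> 'rV[R]_k) :=
  [set phi : R -> 'rV[R]_k | {within `[0, T], continuous phi}].

(* Borel sets of D, a set of paths with the topology of uniform convergence
   on [0, T]. *)
Definition uniform_borel (k : nat) (D : set (R -> 'rV[R]_k)) :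
    set (set (R -> 'rV[R]_k)) :=
  <<s D, [set D `&` U | U in
    (@open {uniform` `[0%R, T]%classic -> 'rV[R]_k}
       : set (set (R -> 'rV[R]_k)))] >>.

End paths.

Arguments rcll {R} T k.
Arguments cpath {R} T k.
Arguments orthant {R} k.

Section independence.
Context {R : realType} {d : measure_display} {Omega : measurableType d}.

Definition sigma_gen (Xs : set (Omega -> R)) : set (set Omega) :=
  <<s \bigcup_(X in Xs) preimage_set_system setT X measurable >>.

Definition mutually_independent (P : probability Omega R) (J : eqType)
    (F : J -> set (set Omega)) : Prop :=
  forall (s : seq J) (E : J -> set Omega), uniq s ->
    (forall j, j \in s -> F j (E j)) ->
    P (\big[setI/setT]_(j <- s) E j) = (\prod_(j <- s) P (E j))%E.

Definition iid (P : probability Omega R) (X : nat -> Omega -> R) : Prop :=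
  mutually_independent P (fun l => sigma_gen [set X l]) /\
  forall l U, measurable U -> P (X l @^-1` U) = P (X 0%N @^-1` U).

End independence.

(* The data of the sequence of queueing systems and of its limit.  ia i l and
   st i l stand for IA_i(l+1) and ST_i(l+1); dlam, dmu are the limits of
   (lamn - n lam) / (b_n sqrt n) and (mun - n mu) / (b_n sqrt n); X0 n i is
   the initial number of class-i customers and x0 the limit of X0 n after
   scaling. *)
Record queue_model (R : realType) (d : measure_display)
    (Omega : measurableType d) (P : probability Omega R) (I : nat) :=
  QueueModel {
    horizon : R;
    ia : 'I_I -> nat -> {RV P >-> R};
    st : 'I_I -> nat -> {RV P >-> R};
    sigma_ia : 'I_I -> R;
    sigma_st : 'I_I -> R;
    lamn : nat -> 'I_I -> R;
    mun : nat -> 'I_I -> R;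
    bn : nat -> R;
    lam : 'I_I -> R;
    mu : 'I_I -> R;
    dlam : 'I_I -> R;
    dmu : 'I_I -> R;
    X0 : nat -> 'I_I -> nat;
    x0 : 'rV[R]_I;
    cost_h : 'rV[R]_I -> R;
    cost_g : 'rV[R]_I -> R
  }.

Section model.
Context {R : realType} {d : measure_display} {Omega : measurableType d}
  {P : probability Omega R} {I : nat}.
Variable M : queue_model P I.
Implicit Types (n l : nat) (w : Omega) (i : 'I_I) (t s : R).

Notation T := (horizon M).
Notation leb := (@lebesgue_measure R).

Definition rho i : R := lam M i / mu M i.

Definition theta : 'rV[R]_I := \row_i (mu M i)^-1.

Definition drift : 'rV[R]_I := \row_i (dlam M i - rho i * dmu M i).

Definition scale n : R := bn M n * Num.sqrt n%:R.

Definition renewal_primitives : Prop :=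
  [/\ mutually_independent P (fun j : 'I_I + 'I_I =>
         match j with
         | inl i => sigma_gen (range (fun l => ia M i l : Omega -> R))
         | inr i => sigma_gen (range (fun l => st M i l : Omega -> R))
         end),
      forall i, iid P (fun l => ia M i l) /\ iid P (fun l => st M i l),
      forall i l w, 0 < ia M i l w /\ 0 < st M i l w,
      forall i l, ('E_P[ia M i l] = 1 /\ 'E_P[st M i l] = 1)%E &
      forall i l, [/\ 0 < sigma_ia M i, 0 < sigma_st M i,
        ('V_P[ia M i l] = (sigma_ia M i ^+ 2)%:E)%E &
        ('V_P[st M i l] = (sigma_st M i ^+ 2)%:E)%E]].

Definition moderate_heavy_traffic : Prop :=
  [/\ 0 < T,
      [/\ forall n, (0 < n)%N -> 0 < bn M n,
          bn M n @[n --> \oo] --> +oo &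
          bn M n / Num.sqrt n%:R @[n --> \oo] --> (0 : R)],
      forall i, [/\ forall n, (0 < n)%N -> 0 < lamn M n i, 0 < lam M i,
        lamn M n i / n%:R @[n --> \oo] --> lam M i &
        (lamn M n i - n%:R * lam M i) / scale n @[n --> \oo] --> dlam M i],
      forall i, [/\ forall n, (0 < n)%N -> 0 < mun M n i, 0 < mu M i,
        mun M n i / n%:R @[n --> \oo] --> mu M i &
        (mun M n i - n%:R * mu M i) / scale n @[n --> \oo] --> dmu M i] &
      \sum_i rho i = 1 /\
      forall i, 0 <= x0 M ord0 i /\
        (X0 M n i)%:R / scale n @[n --> \oo] --> x0 M ord0 i].

Definition cost_function (f : 'rV[R]_I -> R) : Prop :=
  [/\ forall q, orthant I q -> 0 <= f q,
      {within orthant I, continuous f} &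
      forall q r, orthant I q -> orthant I r ->
        (forall i, q ord0 i <= r ord0 i) -> f q <= f r].

Definition cost_functions : Prop :=
  [/\ cost_function (cost_h M), cost_function (cost_g M) &
      exists c1 c2 : R, forall q, orthant I q ->
        cost_g M q + cost_h M q <= c1 * enorm q + c2].

(* When the set is unbounded, which only happens on a null event for the
   sequences at hand, the value of sup is 0. *)
Definition renewal_count (r : R) (xi : nat -> R) t : R :=
  sup [set l%:R | l in [set l : nat | \sum_(k < l) xi k / r <= t]].

Definition An n i t w : R := renewal_count (lamn M n i) (fun l => ia M i l w) t.

Definition Sn n i t w : R := renewal_count (mun M n i) (fun l => st M i l w) t.

Definition AS_tilde n w t : 'rV[R]_(I + I) :=
  row_mx (\row_i ((An n i t w - lamn M n i * t) / scale n))
         (\row_i ((Sn n i t w - mun M n i * t) / scale n)).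

Definition control : Type := Omega -> R -> 'rV[R]_I.

Definition busy (B : control) i t w : R :=
  \int[leb]_(s in `[0, t]) B w s ord0 i.

Definition Xn n (B : control) i t w : R :=
  (X0 M n i)%:R + An n i t w - Sn n i (busy B i t w) w.

Definition X_tilde n (B : control) t w : 'rV[R]_I :=
  \row_i (Xn n B i t w / scale n).

Definition history n (B : control) t : set (set Omega) :=
  sigma_gen [set Y | exists i s, 0 <= s <= t /\
    (Y = An n i s \/ Y = fun w => Sn n i (busy B i s w) w)].

Definition admissible n (B : control) : Prop :=
  [/\ forall w, rcll T I (B w),
      forall w t, 0 <= t <= T ->
        (forall i, 0 <= B w t ord0 i <= 1) /\ \sum_i B w t ord0 i <= 1,
      forall t i U, 0 <= t <= T -> measurable U ->
        history n B t ((fun w => B w t ord0 i) @^-1` U) &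
      forall w t i, 0 <= t <= T -> Xn n B i t w = 0 -> B w t ord0 i = 0].

Definition Jn n (B : control) : \bar R :=
  (((bn M n ^+ 2)^-1)%:E *
   lne (\int[P]_w expeR ((bn M n ^+ 2)%:E *
     (\int[leb]_(s in `[0%R, T]) (cost_h M (X_tilde n B s w))%:E
      + (cost_g M (X_tilde n B T w))%:E))))%E.

Definition Vn n : \bar R := ereal_inf [set Jn n B | B in admissible n].

Definition rate (psi : R -> 'rV[R]_(I + I)) : \bar R :=
  (action T (fun i => lam M i * sigma_ia M i ^+ 2)%R (lsubmx \o psi) +
   action T (fun i => mu M i * sigma_st M i ^+ 2)%R (rsubmx \o psi))%E.

Definition moderate_deviation_principle : Prop :=
  (forall F : set (R -> 'rV[R]_(I + I)), j1_closed T F ->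
     limn_esup (fun n => ((bn M n ^+ 2)^-1)%:E *
                         lne (P [set w | F (AS_tilde n w)]))
     <= - ereal_inf [set rate psi | psi in F])%E /\
  (forall G : set (R -> 'rV[R]_(I + I)), j1_open T G ->
     - ereal_inf [set rate psi | psi in G] <=
     limn_einf (fun n => ((bn M n ^+ 2)^-1)%:E *
                         lne (P [set w | G (AS_tilde n w)])))%E.

Definition minimizing_curve : Prop :=
  exists2 f : R -> 'rV[R]_I, {within `[0, +oo[, continuous f} &
    forall w : R, 0 <= w ->
      let level := [set q | orthant I q /\ dotp theta q = w] in
      [/\ orthant I (f w), dotp theta (f w) = w,
          cost_h M (f w) = inf [set cost_h M q | q in level] &
          cost_g M (f w) = inf [set cost_g M q | q in level]].

Definition bounded_cost (f : 'rV[R]_I -> R) : Prop :=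
  [bounded f q | q in orthant I].

Definition exponential_moments : Prop :=
  forall K : R,
    (limn_esup (fun n => ((bn M n ^+ 2)^-1)%:E *
       lne (\int[P]_w expeR ((bn M n ^+ 2)%:E * (K%:E *
         (sup_norm T (lsubmx \o AS_tilde n w) +
          sup_norm T (rsubmx \o AS_tilde n w)))))) < +oo)%E.

Definition game_P : set (R -> 'rV[R]_(I + I)) :=
  [set psi | cpath T (I + I) psi /\ psi 0 = 0].

Definition game_E : set (R -> 'rV[R]_I) :=
  [set zeta | [/\ cpath T I zeta, dotp theta (zeta 0) = 0 &
    forall s t, 0 <= s -> s <= t -> t <= T ->
      dotp theta (zeta s) <= dotp theta (zeta t)]].

Definition time_scaled (phi : R -> 'rV[R]_I) t : 'rV[R]_I :=
  \row_i phi (rho i * t) ord0 i.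

Definition dynamics (psi : R -> 'rV[R]_(I + I)) (zeta : R -> 'rV[R]_I) t :
    'rV[R]_I :=
  x0 M + t *: drift + lsubmx (psi t) - time_scaled (rsubmx \o psi) t + zeta t.

Definition strategy (alpha : (R -> 'rV[R]_(I + I)) -> (R -> 'rV[R]_I)) : Prop :=
  [/\ forall psi, game_P psi -> game_E (alpha psi),
      forall U, uniform_borel T game_E U ->
        uniform_borel T game_P (game_P `&` alpha @^-1` U) &
      forall psi psi' t, game_P psi -> game_P psi' -> 0 <= t <= T ->
        (forall s, 0 <= s <= t ->
           lsubmx (psi s) = lsubmx (psi' s) /\
           time_scaled (rsubmx \o psi) s = time_scaled (rsubmx \o psi') s) ->
        forall s, 0 <= s <= t -> alpha psi s = alpha psi' s].

Definition admissible_strategy alpha : Prop :=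
  strategy alpha /\
  forall psi, game_P psi -> forall t, 0 <= t <= T ->
    orthant I (dynamics psi (alpha psi) t).

Definition game_cost psi zeta : \bar R :=
  (\int[leb]_(t in `[0%R, T]) (cost_h M (dynamics psi zeta t))%:E
   + (cost_g M (dynamics psi zeta T))%:E - rate psi)%E.

Definition game_value : \bar R :=
  ereal_inf [set ereal_sup [set game_cost psi (alpha psi) | psi in game_P]
            | alpha in admissible_strategy].

End model.

(* Main.v *)
(* The value V(x) equals sup over psi of C(psi) - I(psi), where C(psi) is the
   cost of following the minimizing curve f at the workload obtained by Skorohod
   reflection of w(t) = theta . (x + y t + psi^1 - rho[psi^2]): the strategy
   putting the queues at f(reflection) is admissible and optimal, since every
   admissible strategy keeps the workload above the reflection of w.

   Lower bound.  On the event that the noise lies in a small sup-norm ball around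
   psi, the workload under any admissible control is either large or close to
   w + (nondecreasing idleness), so it almost dominates the reflection and the
   cost is at least C(psi) - e; the ball is J1-open around a continuous path.

   Upper bound.  Serve any nonempty class whose queue is above the curve
   f(workload).  This policy is non-idling and its queues track
   f(reflection of w) on small balls, whence the cost is at most C(psi) + e
   there.  By absolute continuity, {I <= K} consists of 1/2-Hoelder paths, which
   are compact for pointwise convergence (Tychonoff), so finitely many such balls
   cover it.  Outside of them the probability is at most exp(-b_n^2 K), and the
   exponential moments control the cost. *)

From HB Require Import structures.
From mathcomp Require Import all_boot all_order all_algebra.
From mathcomp Require Import all_classical all_reals all_analysis.
From mathcomp Require Import measurable_realfun.
From mathcomp Require Import ring lra.
Require Import Defs.

Set Implicit Arguments.
Unset Strict Implicit.
Unset Printing Implicit Defensive.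

Import Order.TTheory GRing.Theory Num.Theory.
Import numFieldNormedType.Exports.

Local Open Scope classical_set_scope.
Local Open Scope ring_scope.

(** * Limits, integrals and clamping *)

(** Three obstacles shape the development. The cost of an arbitrary control is not known to be
    measurable, in time or in the outcome; comparisons of integrals therefore rest on the integral
    of a nonnegative function being a supremum over simple functions, and among running costs only
    the explicit one along the curve is shown measurable. Controls must be admissible on every
    outcome, including the null set where a renewal sequence explodes: hence a cap on the number of
    events in the policy, and estimates restricted to outcomes without explosion, which are exactly
    those with RCLL noise. Finally, the initial queues may lie off the curve: the game may rearrange
    them at time 0, while the policy needs a short initial layer, whose cost is a constant times its
    length. Tracking after that layer is first one-sided: no class is much below its target, because
    service stops below the curve. Since theta . (X - f(W)) = 0 for the workload W of X, lower
    bounds on all classes yield upper bounds. The logarithmic scaling then turns the finite sum over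
    balls into a maximum. *)

Section ereal_limits.
Context {R : realType}.
Local Open Scope ereal_scope.
Implicit Types (u : (\bar R)^nat) (x : \bar R).

Lemma limn_esup_lt u x : limn_esup u < x -> \forall n \near \oo, u n < x.
Proof.
move=> /ereal_inf_lt[_ [V /= Voo <-] ux]; near=> n.
apply: le_lt_trans ux; apply: ereal_sup_ubound; exists n => //.
by near: n.
Unshelve. all: by end_near. Qed.

Lemma limn_einf_gt u x : x < limn_einf u -> \forall n \near \oo, x < u n.
Proof.
rewrite /limn_einf lteNr => /limn_esup_lt; apply: filterS => n.
by rewrite /= lteN2.
Qed.

(** Real thresholds on both sides cover the limit [+oo] as well: the upper hypothesis is then
    vacuous, and [0 <= x] excludes the limit [-oo]. *)
Lemma cvge_sandwich u x : 0 <= x ->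
  (forall a : R, a%:E < x -> \forall n \near \oo, a%:E <= u n) ->
  (forall a : R, x < a%:E -> \forall n \near \oo, u n <= a%:E) ->
  u n @[n --> \oo] --> x.
Proof.
case: x => [r|_ lo _|//].
  move=> _ lo up.
  have bnd (e : R) : (0 < e)%R -> \forall n \near \oo,
      (r - e)%:E <= u n <= (r + e)%:E.
    move=> e0; near=> n; apply/andP; split.
      by near: n; apply: lo; rewrite lte_fin ltrBlDr ltrDl.
    by near: n; apply: up; rewrite lte_fin ltrDl.
  have fin : \forall n \near \oo, u n \is a fin_num.
    have := bnd 1%R ltr01; apply: filterS => n /andP[a b].
    by rewrite fin_numElt (lt_le_trans _ a) ?ltNyr// (le_lt_trans b) ?ltry.
  apply/fine_cvgP; split => //; apply/cvgrPdist_le => e e0; near=> n.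
  have fn : u n \is a fin_num by near: n.
  have : (r - e)%:E <= u n <= (r + e)%:E by near: n; exact: bnd.
  rewrite -(fineK fn) !lee_fin => /andP[a b] /=.
  by rewrite distrC ler_distl a b.
apply/cvgeyPge => a; apply: lo; exact: ltry.
Unshelve. all: by end_near. Qed.

Lemma lne_leP (x y : \bar R) : 0 <= x -> (lne x <= y) = (x <= expeR y).
Proof.
move=> x0; rewrite -[in LHS](expeRK y) lee_lne// in_itv /= leey andbT//.
exact: expeR_ge0.
Qed.

Lemma lne_geP (x y : \bar R) : 0 <= x -> (y <= lne x) = (expeR y <= x).
Proof.
move=> x0; rewrite -[in LHS](expeRK y) lee_lne// in_itv /= leey andbT//.
exact: expeR_ge0.
Qed.

End ereal_limits.

Section integral_monotone.
Context d (T : measurableType d) {R : realType}.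
Variable mu : {measure set T -> \bar R}.
Local Open Scope ereal_scope.
Implicit Types (D E N : set T) (f g : T -> \bar R).

(* No measurability is required: the integral of a nonnegative function is a
   supremum over the simple functions below it. *)
Lemma ge0_integral_le D E f g : (forall x, D x -> [/\ E x, 0 <= f x & f x <= g x]) ->
  (forall x, E x -> 0 <= g x) -> \int[mu]_(x in D) f x <= \int[mu]_(x in E) g x.
Proof.
move=> fg g0; rewrite ge0_integralE; last by move=> x /fg[].
rewrite ge0_integralE//; apply: ereal_sup_le => _ [h hf <-]; exists h => // x.
apply: (le_trans (hf x)); rewrite !patchE; case: ifPn => [|_].
  by rewrite inE => /fg[Ex _]; rewrite (mem_set Ex).
by case: ifPn => // /set_mem /g0.
Qed.

(** Measurability of [f] is what cuts the null set [N] out of [D]. The larger function stays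
    arbitrary, which suits the square of [derive1], a total function identified with a density only
    almost everywhere. *)
Lemma ge0_integral_le_ae D E N f g : measurable D ->
  measurable_fun D f ->
  measurable N -> mu N = 0 ->
  (forall x, D x -> 0 <= f x) ->
  (forall x, D x -> ~ N x -> E x /\ f x <= g x) ->
  (forall x, E x -> 0 <= g x) -> \int[mu]_(x in D) f x <= \int[mu]_(x in E) g x.
Proof.
move=> mD mf mN N0 f0 fg g0.
have DE : D = (D `\` N) `|` (D `&` N) by rewrite setUC setUIDK.
rewrite {1}DE ge0_integral_setU//; first last.
- by rewrite disj_set2E; apply/eqP/seteqP; split => // x [[_ ?] []].
- by rewrite -DE; exact: f0.
- by rewrite -DE.
- exact: measurableI.
- exact: measurableD.
rewrite [X in _ + X]null_set_integral//; last 3 first.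
- exact: measurableI.
- by apply: measurable_funS mf => // x [].
- by apply: (subset_measure0 _ mN _ N0); [exact: measurableI|move=> x []].
rewrite adde0; apply: ge0_integral_le => // x [Dx Nx].
by have [Ex fx] := fg _ Dx Nx; split => //; exact: f0.
Qed.

Lemma ge0_integral_ge_cst D A (c : R) f : measurable A -> A `<=` D -> (0 <= c)%R ->
  (forall x, D x -> 0 <= f x) -> (forall x, A x -> c%:E <= f x) ->
  c%:E * mu A <= \int[mu]_(x in D) f x.
Proof.
move=> mA AD c0 f0 fc; rewrite -integral_cst//.
by apply: ge0_integral_le => // x Ax; split; [exact: AD|rewrite lee_fin|exact: fc].
Qed.

End integral_monotone.

Section clamp.
Context {R : realType}.
Variable T : R.
Implicit Types s t : R.

(** The retraction of the line onto [0, T]: composing with it extends a path beyond the horizon by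
    its end values. *)
Definition clamp (t : R) : R := Num.min T (Num.max 0 t).

Lemma clamp_itv t : 0 <= T -> 0 <= clamp t <= T.
Proof. by move=> T0; rewrite /clamp le_min le_max lexx /= ge_min lexx T0. Qed.

Lemma clamp_id t : 0 <= t <= T -> clamp t = t.
Proof. by move=> /andP[t0 tT]; rewrite /clamp (max_r t0) (min_r tT). Qed.

Lemma clamp_le s t : s <= t -> clamp s <= clamp t.
Proof.
move=> st; rewrite /clamp le_min ge_min lexx /= ge_min; apply/orP; right.
by rewrite ge_max le_max lexx /= le_max st orbT.
Qed.

Lemma clampB s t : 0 <= T -> s <= t -> clamp t - clamp s <= t - s.
Proof.
move=> T0 st; rewrite /clamp /Num.min /Num.max.
case: (ltP 0 t) => t0; case: (ltP 0 s) => s0; case: (ltP T t) => tT;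
  case: (ltP T s) => sT; case: (ltP T 0) => ?; lra.
Qed.

Lemma clamp_ge t : 0 <= T -> T <= t -> clamp t = T.
Proof. by move=> T0 Tt; rewrite /clamp (max_r (le_trans T0 Tt)) (min_l Tt). Qed.

End clamp.

(** * Absolute continuity and the action *)

Section abs_continuity.
Context {R : realType}.
Variable T : R.
Implicit Types (f : R -> R) (s l : seq (R * R)).

(* An interval [a, c] is encoded by the pair (c, a), as in variation_zip. *)
Definition nonoverlap (p q : R * R) := (p.1 <= q.2) || (q.1 <= p.2).

Definition subintervals (a c : R) s :=
  all (fun p => [&& a <= p.2, p.2 <= p.1 & p.1 <= c]) s && pairwise nonoverlap s.

Lemma nonoverlap_sym p q : nonoverlap p q = nonoverlap q p.
Proof. by rewrite /nonoverlap orbC. Qed.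

(** Lists replace the ordinal-indexed families of the definition: they can be concatenated and
    permuted when an interval is subdivided. *)
Lemma abs_continuous_seq f (e : R) : abs_continuous T f -> 0 < e ->
  exists2 delta : R, 0 < delta & forall s, subintervals 0 T s ->
    \sum_(p <- s) (p.1 - p.2) < delta -> \sum_(p <- s) `|f p.1 - f p.2| < e.
Proof.
move=> acf /acf[delta d0 H]; exists delta => // s /andP[/allP sT sp] sd.
rewrite (big_nth (0, 0)) big_mkord.
apply: (H (size s) (fun j => (nth (0, 0) s j).2) (fun j => (nth (0, 0) s j).1)).
- by move=> j; have /and3P[] := sT _ (mem_nth (0, 0) (ltn_ord j)).
- move=> j j' jj'; have /(pairwiseP (0, 0)) {}sp := sp.
  have [jlt|jlt|] := ltngtP j j'; last by move/val_inj => jE; rewrite jE eqxx in jj'.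
    by have /orP[|] := sp _ _ (ltn_ord j) (ltn_ord j') jlt; [left|right].
  by have /orP[|] := sp _ _ (ltn_ord j') (ltn_ord j) jlt; [right|left].
- by move: sd; rewrite (big_nth (0, 0)) big_mkord.
Qed.

Lemma subintervals_partition (a c : R) (p : seq R) : itv_partition a c p ->
  subintervals a c (zip p (a :: p)) /\
  \sum_(x <- zip p (a :: p)) (x.1 - x.2) = c - a.
Proof.
elim: p a => [a /itv_partition_nil <-|h t ih a].
  by rewrite /subintervals /= big_nil subrr.
move=> abs; have [pth /eqP lst] := abs.
have /ih[/andP[/allP at_ pt] st] := itv_partition_cons abs.
have ah : a < h by move: pth => /= /andP[].
have hc : h <= c.
  have [/= /andP[_ ht] _] := abs.
  case: t ht lst {ih at_ pt st abs pth} => [_ /= <-//|k t ht <-].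
  apply: ltW; move: ht; rewrite lt_path_sortedE => /andP[/allP ht _] /=.
  by apply: ht; rewrite mem_last.
split; last by rewrite big_cons /= st; ring.
rewrite /subintervals /= lexx (ltW ah) hc /= pt andbT; apply/andP; split.
  apply/allP => x /at_ /and3P[x1 -> ->]; rewrite (le_trans _ x1)//; exact: ltW.
by apply/allP => x /at_ /and3P[x1 _ _]; rewrite /nonoverlap /= x1.
Qed.

Lemma subintervals_refine (a c : R) p s l : p.2 <= p.1 ->
  subintervals a c (p :: s) -> subintervals p.2 p.1 l -> subintervals a c (s ++ l).
Proof.
move=> p21 /andP[/= /andP[/and3P[pa _ pc] sT] /andP[ps pws]] /andP[lT pwl].
apply/andP; split.
  rewrite all_cat sT /=; apply/allP => x /(allP lT) /and3P[x1 -> x2].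
  by rewrite (le_trans pa)// (le_trans x2).
rewrite pairwise_cat pws pwl !andbT; apply/allrelP => x y xs yl.
have /and3P[y1 _ y2] := allP lT _ yl.
have /orP[px|px] := allP ps _ xs; rewrite /nonoverlap.
  by rewrite (le_trans y2) ?orbT.
by rewrite (le_trans px).
Qed.

Lemma subintervals_perm (a c : R) s l : perm_eq s l ->
  subintervals a c s -> subintervals a c l.
Proof.
move=> sl /andP[sT sp]; apply/andP; split; first by rewrite -(perm_all _ sl).
elim: s l sl sp {sT} => [l|x s ih l]; first by rewrite perm_sym => /perm_nilP ->.
move=> sl /= /andP[/allP xs ps].
have xl : x \in l by rewrite -(perm_mem sl) mem_head.
move: sl; case/splitPr: xl => l1 l2 sl.
have {}sl : perm_eq s (l1 ++ l2).
  by rewrite -(perm_cons x) (perm_trans sl)// -cat1s -[x :: l1 ++ l2]cat1s perm_catCA.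
have /= := ih _ sl ps; rewrite !pairwise_cat /= allrel_consr => /and3P[p12 -> ->].
rewrite p12 /= !andbT; apply/andP; split; apply/allP => y yl.
  by rewrite /= nonoverlap_sym xs// (perm_mem sl) mem_cat yl.
by rewrite xs// (perm_mem sl) mem_cat yl orbT.
Qed.

(* Each interval of s is in turn replaced by an arbitrary partition of it. *)
Lemma abs_continuous_tv_seq f (e delta : R) :
  (forall s, subintervals 0 T s -> \sum_(p <- s) (p.1 - p.2) < delta ->
     \sum_(p <- s) `|f p.1 - f p.2| <= e) ->
  forall s l, subintervals 0 T (s ++ l) ->
    \sum_(p <- s ++ l) (p.1 - p.2) < delta ->
  (\sum_(p <- s) total_variation p.2 p.1 f + (\sum_(p <- l) `|f p.1 - f p.2|)%:E
     <= e%:E)%E.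
Proof.
move=> H; elim => [l sl dl|p s ih l sl dl].
  by rewrite big_nil add0e lee_fin H.
have /andP[/= /andP[/and3P[p0 p21 pT] _] _] := sl.
have tp t : itv_partition p.2 p.1 t ->
    (\sum_(q <- s) total_variation q.2 q.1 f + (\sum_(q <- l) `|f q.1 - f q.2|)%:E
      <= e%:E - (variation p.2 p.1 f t)%:E)%E.
  move=> pt; have [tT tS] := subintervals_partition pt.
  rewrite (variation_zip _ pt) leeBrDr ?fin_numE//= -addeA -EFinD -big_cat /=.
  have pm : perm_eq ((s ++ l) ++ zip t (p.2 :: t)) (s ++ (l ++ zip t (p.2 :: t))).
    by rewrite catA.
  apply: ih; first exact/(subintervals_perm pm)/(subintervals_refine p21 sl tT).
  by rewrite -(perm_big _ pm) /= big_cat /= tS; move: dl; rewrite /= big_cons; lra.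
(* Finiteness, used to move terms across the inequality, comes from the trivial partition: empty
   when [p] is degenerate, its right endpoint otherwise. *)
have rest_fin : (\sum_(q <- s) total_variation q.2 q.1 f +
    (\sum_(q <- l) `|f q.1 - f q.2|)%:E)%E \is a fin_num.
  have r0 : (0 <= \sum_(q <- s) total_variation q.2 q.1 f +
      (\sum_(q <- l) `|f q.1 - f q.2|)%:E)%E.
    rewrite adde_ge0 ?lee_fin ?sumr_ge0// big_seq sume_ge0// => q qs.
    apply: total_variation_ge0; have /andP[/= /andP[_ /allP sT] _] := sl.
    by have := sT q; rewrite mem_cat qs => /(_ isT) /and3P[].
  rewrite ge0_fin_numE//; move: p21; rewrite le_eqVlt => /predU1P[pE|p21].
    apply: (@le_lt_trans _ _ _ _ _ (tp [::] _)); first by split; rewrite ?pE.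
    by rewrite -EFinB ltry.
  apply: (@le_lt_trans _ _ _ _ _ (tp [:: p.1] (itv_partition1 p21))).
  by rewrite -EFinB ltry.
rewrite big_cons -addeA -leeBrDr//; apply: ge_ereal_sup => _ [_ [t pt <-] <-].
by rewrite leeBrDr// [leLHS]addeC -[leLHS]/(_ + _)%E -leeBrDr ?fin_numE//=; exact: tp.
Qed.

Lemma abs_continuous_tv f (e : R) : abs_continuous T f -> 0 < e ->
  exists2 delta : R, 0 < delta & forall s, subintervals 0 T s ->
    \sum_(p <- s) (p.1 - p.2) < delta ->
    (\sum_(p <- s) total_variation p.2 p.1 f <= e%:E)%E.
Proof.
move=> acf e0; have [delta d0 H] := abs_continuous_seq acf e0.
exists delta => // s sT sd.
have /(_ s [::]) := abs_continuous_tv_seq (fun s sT sd => ltW (H s sT sd)).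
by rewrite cats0 big_nil adde0; exact.
Qed.

Lemma abs_continuous_bounded_variation f : 0 <= T -> abs_continuous T f ->
  forall t, 0 <= t <= T -> total_variation 0 t f \is a fin_num.
Proof.
move=> T0 acf t /andP[t0 tT]; have [delta d0 H] := abs_continuous_tv acf ltr01.
have [k] : exists k : nat, t < (k%:R + 1) * (delta / 2).
  exists (Num.bound (t / (delta / 2))).
  rewrite -ltr_pdivrMr ?divr_gt0//.
  have td0 : 0 <= t / (delta / 2) by rewrite !divr_ge0// ltW.
  by have := archi_boundP td0; lra.
elim: k t t0 tT => [|k ih] t t0 tT tk.
  have := H [:: (t, 0)]; rewrite !big_cons !big_nil /= subr0 adde0 addr0.
  rewrite ge0_fin_numE ?total_variation_ge0// => /(_ _ _)/le_lt_trans; apply => //.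
  - by rewrite /subintervals /= lexx t0 tT.
  - by move: tk; lra.
  - by rewrite ltry.
have [tk'|tk'] := ltP t ((k%:R + 1) * (delta / 2)); first exact: ih.
have k0 : 0 <= (k%:R + 1) * (delta / 2) :> R.
  by rewrite mulr_ge0 ?addr_ge0// divr_ge0// ltW.
(* Stepping back by 3/4 of [delta] leaves a last piece shorter than [delta], of variation at most 1,
   and gains more than [delta / 2], so the induction hypothesis reaches [u]. *)
pose u := Num.max 0 (t - delta * (3 / 4)).
have u0 : 0 <= u by rewrite le_max lexx.
have ut : u <= t by rewrite ge_max t0 /=; move: d0; lra.
rewrite (total_variationD _ u0 ut) fin_numD ih ?(le_trans ut)//=; last first.
  rewrite gt_max; apply/andP; split; first by rewrite mulr_gt0 ?divr_gt0// ltr_wpDl.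
  by move: tk; rewrite -natr1; move: d0; lra.
have := H [:: (t, u)]; rewrite !big_cons !big_nil /= adde0 addr0.
rewrite ge0_fin_numE ?total_variation_ge0// => /(_ _ _)/le_lt_trans; apply => //.
- by rewrite /subintervals /= u0 ut tT.
- have : t - delta * (3 / 4) <= u by rewrite le_max lexx orbT.
  by move: d0; lra.
- by rewrite ltry.
Qed.

Definition variation_path f (t : R) : R := fine (total_variation 0 t f).

Lemma variation_pathB f (a c : R) : 0 <= T -> abs_continuous T f ->
  0 <= a -> a <= c -> c <= T ->
  (variation_path f c - variation_path f a)%:E = total_variation a c f.
Proof.
move=> T0 acf a0 ac cT.
have BV := abs_continuous_bounded_variation T0 acf.
have c0 := le_trans a0 ac; have aT := le_trans ac cT.
have cfin := BV c; have afin := BV a; rewrite c0 cT in cfin; rewrite a0 aT in afin.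
rewrite EFinB /variation_path !fineK ?cfin ?afin// (total_variationD f a0 ac).
by rewrite addeAC subee ?add0e// afin.
Qed.

(** The variation over disjoint intervals of small total length is small by [abs_continuous_tv].
    With [f = (variation_path f + f) - variation_path f] this gives a Jordan decomposition into
    nondecreasing absolutely continuous functions, to which Stieltjes measures apply. *)
Lemma variation_path_abs_continuous f : 0 <= T -> abs_continuous T f ->
  abs_continuous T (variation_path f).
Proof.
move=> T0 acf e e0; have [|delta d0 H] := abs_continuous_tv acf (_ : 0 < e / 2).
  by rewrite divr_gt0.
exists delta => // m a c ac disj acd.
have := H [seq (c j, a j) | j <- index_enum 'I_m]; rewrite !big_map /= => Hs.
have /Hs{Hs} : subintervals 0 T [seq (c j, a j) | j <- index_enum 'I_m].
  apply/andP; split.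
    by apply/allP => _ /mapP[j _ ->] /=; have [-> -> ->] := ac j.
  rewrite pairwise_map; have := index_enum_uniq 'I_m.
  rewrite uniq_pairwise; apply: sub_pairwise => j j' /= jj'.
  by rewrite /nonoverlap /=; apply/orP; exact: disj.
move=> /(_ acd); rewrite (eq_bigr (fun j => (`|variation_path f (c j) -
    variation_path f (a j)|)%:E)); last first.
  move=> j _; have [a0 ajc cT] := ac j; rewrite -variation_pathB// ger0_norm//.
  by rewrite -lee_fin variation_pathB// total_variation_ge0.
by rewrite sumEFin lee_fin => /le_lt_trans; apply; move: e0; lra.
Qed.

Lemma abs_continuousD f g : abs_continuous T f -> abs_continuous T g ->
  abs_continuous T (fun t => f t + g t).
Proof.
move=> acf acg e e0; have e20 : 0 < e / 2 by rewrite divr_gt0.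
have [d1 d10 H1] := acf _ e20; have [d2 d20 H2] := acg _ e20.
exists (Num.min d1 d2); first by rewrite lt_min d10.
move=> m a c ac disj; rewrite lt_min => /andP[s1 s2].
have {}H1 := H1 m a c ac disj s1; have {}H2 := H2 m a c ac disj s2.
apply: (@le_lt_trans _ _ (\sum_(j < m) (`|f (c j) - f (a j)| + `|g (c j) - g (a j)|))).
  by apply: ler_sum => j _; rewrite opprD addrACA ler_normD.
by rewrite big_split /= (splitr e) ltrD.
Qed.

Lemma abs_continuous_le f (e : R) : abs_continuous T f -> 0 < e ->
  exists2 delta : R, 0 < delta & forall s t : R, 0 <= s -> s <= t -> t <= T ->
    t - s < delta -> `|f t - f s| < e.
Proof.
move=> acf e0; have [delta d0 H] := abs_continuous_seq acf e0.
exists delta => // s t s0 st tT std; have := H [:: (t, s)].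
rewrite !big_cons !big_nil /= !addr0; apply => //.
by rewrite /subintervals /= s0 st tT.
Qed.

End abs_continuity.

(** Finite measure rules out infinite endpoints, and openness keeps the left endpoint out of [J].
    The half-open hull is the form on which a Stieltjes measure is an increment. *)
Lemma open_interval_hull {R : realType} (J : set R) : open J -> is_interval J ->
  J !=set0 -> (lebesgue_measure J < +oo)%E ->
  exists a c, [/\ a < c, J `<=` `]a, c]%classic & `]a, c[%classic `<=` J].
Proof.
move=> oJ iJ [x Jx]; move/is_intervalP : (iJ) => JE.
have {}JE : J = [set` Rhull J] by [].
have /nbhs_ballP[e /= e0 eJ] := open_nbhs_nbhs (conj oJ Jx).
have Jxm : J (x - e / 2).
  apply: eJ; rewrite /ball /= opprB addrC subrK gtr0_norm ?divr_gt0//.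
  by rewrite ltr_pdivrMr// ltr_pMr// ltr1n.
have Jxp : J (x + e / 2).
  apply: eJ; rewrite /ball /= opprD addrA subrr sub0r normrN gtr0_norm ?divr_gt0//.
  by rewrite ltr_pdivrMr// ltr_pMr// ltr1n.
move: (Rhull J) JE => [i1 i2] JE; rewrite JE lebesgue_measure_itv /=.
rewrite JE /= !itv_boundlr in Jxm Jxp.
have i12 : (i1 < i2)%E.
  move: Jxm Jxp => /andP[+ _] /andP[_ +].
  case: i1 i2 {JE} => [b1 a|[]] [b2 c|[]] //=; rewrite ?ltry ?ltNyr// lte_fin.
  by case: b1; case: b2; rewrite ?bnd_simp; move: e0; lra.
rewrite i12; case: i1 i2 JE i12 {Jxm Jxp} => [b1 a|[]] [b2 c|[]] //= JE i12 _.
exists a, c; split; first by rewrite -lte_fin.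
  move=> y Jy; have : y \in Interval (BSide b1 a) (BSide b2 c) by [].
  rewrite itv_boundlr => /andP[ay yc]; rewrite /= in_itv /=; apply/andP; split.
    rewrite lt_neqAle; apply/andP; split; last first.
      by case: (b1) ay; rewrite /= ?bnd_simp //; exact: ltW.
    apply/eqP => ay'; have Jy' : J y by rewrite JE.
    have /nbhs_ballP[e' /= e'0 e'J] := open_nbhs_nbhs (conj oJ Jy').
    have : J (y - e' / 2).
      apply: e'J; rewrite /ball /= opprB addrC subrK gtr0_norm ?divr_gt0//.
      by rewrite ltr_pdivrMr// ltr_pMr// ltr1n.
    rewrite JE /= itv_boundlr => /andP[+ _]; rewrite -ay'.
    have : a - e' / 2 < a by rewrite ltrBlDr ltrDl divr_gt0.
    by case: (b1); rewrite /= ?bnd_simp; move=> ? ?; move: e'0; lra.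
  by case: (b2) yc; rewrite /= ?bnd_simp //; exact: ltW.
move=> y; rewrite /= in_itv /= => /andP[ay yc]; rewrite itv_boundlr.
by case: (b1); case: (b2); rewrite /= ?bnd_simp ?ay ?yc ?ltW.
Qed.

(** * Radon-Nikodym densities of absolutely continuous functions *)

Section density.
Context {R : realType}.
Variable T : R.
Hypothesis T0 : 0 < T.
Notation mu := (@lebesgue_measure R).

Local Notation clampT := (clamp T).
Let clampT_itv t : 0 <= clampT t <= T := clamp_itv t (ltW T0).

Variable G : R -> R.
Hypothesis acG : abs_continuous T G.
Hypothesis ndG : forall s t, 0 <= s -> s <= t -> t <= T -> G s <= G t.

(** Constant extension outside [0, T], so that [F] is a cumulative function on the whole line. *)
Let F t := G (clampT t).

Let F_nd : nondecreasing F.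
Proof.
move=> s t st; have /andP[a b] := clampT_itv s; have /andP[c e] := clampT_itv t.
by apply: ndG => //; exact: clamp_le.
Qed.

Let F_rc : right_continuous F.
Proof.
apply: right_continuousW => x; apply/cvgrPdist_lt => e e0.
have [delta d0 H] := abs_continuous_le acG e0; near=> t.
have xt : `|x - t| < delta by near: t; exact: cvgr_dist_lt.
have /andP[cx cx'] := clampT_itv x; have /andP[ct ct'] := clampT_itv t.
have [xlet|/ltW tlex] := leP x t.
  rewrite distrC; apply: H => //; first exact: clamp_le.
  by apply: le_lt_trans (clampB (ltW T0) xlet) _; move: xt; rewrite distrC ger0_norm// subr_ge0.
apply: H => //; first exact: clamp_le.
by apply: le_lt_trans (clampB (ltW T0) tlex) _; move: xt; rewrite ger0_norm// subr_ge0.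
Unshelve. all: by end_near. Qed.

Let Fc : cumulative R R := HB.pack F (isCumulative.Build R _ R F F_nd F_rc).

Let lsF : {measure set (measurableTypeR R) -> \bar R} :=
  lebesgue_stieltjes_measure Fc.

Let lsF_itv (a b : R) : a <= b -> lsF `]a, b]%classic = (F b - F a)%:E.
Proof.
move=> ab; rewrite /lsF /= /lebesgue_stieltjes_measure /measure_extension.
by rewrite measurable_mu_extE /= ?wlength_itv_bnd//; exact: is_ocitv.
Qed.

Let mu_le (A B : set R) : measurable A -> measurable B -> A `<=` B ->
  (mu A <= mu B)%E.
Proof. by move=> mA mB AB; apply: le_measure => //; exact: mem_set. Qed.

Let lsF_le (A B : set R) : measurable A -> measurable B -> A `<=` B ->
  (lsF A <= lsF B)%E.
Proof. by move=> mA mB AB; apply: le_measure => //; exact: mem_set. Qed.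

(** Outer regularity encloses [N] in an open set [U] of measure below the modulus [delta]. Its
    components are disjoint intervals, so absolute continuity bounds the total increment of [G] over
    any finitely many of them by [e], and countable additivity passes to [U]. *)
Let lsF_dominated (N : set R) : measurable N -> mu N = 0%E -> lsF N = 0%E.
Proof.
move=> mN N0; apply/eqP; rewrite eq_le measure_ge0 andbT.
apply/lee_addgt0Pr => e e0; rewrite add0e.
have [delta d0 H] := abs_continuous_seq acG e0.
have [|//|U [oU NU Ud]] := @lebesgue_regularity_outer _ N delta mN.
  by move: N0; rewrite /= => ->; rewrite ltry.
have {}Ud : (mu U < delta%:E)%E.
  apply: le_lt_trans Ud; have mU : measurable U by exact: open_measurable.
  rewrite (measureDI (mu : {measure set (measurableTypeR R) -> \bar R}) mU mN).
  by rewrite -[leRHS]adde0 -N0 leeD2l// measureIr.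
apply: (@le_trans _ _ (lsF U)).
  by apply: lsF_le => //; exact: open_measurable.
set J := open_disjoint_itv oU.
have UJ : U = \bigcup_k J k := open_disjoint_itv_bigcup oU.
have mJ k : measurable (J k) by apply: open_measurable; exact: open_disjoint_itv_open.
have tJ : trivIset setT J := @open_disjoint_itv_trivIset _ _ oU.
have muJ m : (\sum_(k < m) mu (J k) <= mu U)%E.
  rewrite -measure_bigsetU//.
  have mB : measurable (\big[setU/set0]_(i < m) J i) by apply: bigsetU_measurable.
  have mU : measurable U by exact: open_measurable.
  apply: le_measure; rewrite ?inE//.
  by rewrite UJ -bigcup_mkord => x [k _ Jx]; exists k.
(* Endpoints of the hull of each component; an empty component receives the degenerate interval at
   0. *)
have /choice[p pP] : forall k, exists p : R * R,
    [/\ p.2 <= p.1, J k `<=` `]p.2, p.1]%classic, ((p.1 - p.2)%:E <= mu (J k))%E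
    & p = (0, 0) \/ p.2 < p.1 /\ `]p.2, p.1[%classic `<=` J k].
  move=> k; have [Jk|Jk] := pselect (J k !=set0); last first.
    exists (0, 0); split=> //=; last by left.
      by move=> x Jx; case: Jk; exists x.
    by rewrite subrr.
  have Jfin : (mu (J k) < +oo)%E.
    apply: (@le_lt_trans _ _ (mu U)); last by rewrite (lt_trans Ud) ?ltry.
    by apply: mu_le; [exact: mJ|exact: open_measurable|rewrite UJ => x Jx; exists k].
  have [a [c [ac Jac acJ]]] := open_interval_hull
    (@open_disjoint_itv_open _ _ oU k) (@open_disjoint_itv_is_interval _ _ oU k)
    Jk Jfin.
  exists (c, a); split => //=; [exact: ltW| |by right; split].
  have -> : ((c - a)%:E = mu `]a, c[%classic)%E.
    by rewrite lebesgue_measure_itv /= lte_fin ac EFinB.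
  by apply: mu_le => //; exact: mJ.
have := @measure_sigma_additive _ _ _ lsF J mJ tJ; rewrite -UJ => cvgJ.
rewrite -(cvg_lim _ cvgJ)//; apply: lime_le; first by apply/cvg_ex; exists (lsF U).
near=> m; rewrite big_mkord.
pose s := [seq (clampT (p k).1, clampT (p k).2) | k : 'I_m <- index_enum 'I_m].
have sT : subintervals 0 T s.
  apply/andP; split.
    apply/allP => _ /mapP[k _ ->] /=; have [pk _ _ _] := pP k.
    have /andP[-> _] := clampT_itv (p k).2; have /andP[_ ->] := clampT_itv (p k).1.
    by rewrite clamp_le.
  rewrite pairwise_map; have := index_enum_uniq 'I_m.
  rewrite uniq_pairwise; apply: sub_pairwise => j k /= jk.
  rewrite /nonoverlap /=.
  have cl0 : clampT 0 = 0 by apply: clamp_id; rewrite lexx ltW.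
  have [pj21 _ _ pj] := pP j; have [pk21 _ _ pk] := pP k.
  have ge0 x : 0 <= clampT x by have /andP[] := clampT_itv x.
  case: pj => [->/=|[pjl pj]]; first by rewrite cl0 ge0.
  case: pk => [->/=|[pkl pk]]; first by rewrite cl0 ge0 orbT.
  have [kj|jk'] := leP (p j).1 (p k).2; first by rewrite clamp_le.
  have [kj'|jk''] := leP (p k).1 (p j).2; first by rewrite (clamp_le T kj') orbT.
  (* Overlapping hulls would share an open interval, and its midpoint would lie in two disjoint
     components. *)
  exfalso; pose x := (Num.max (p k).2 (p j).2 + Num.min (p k).1 (p j).1) / 2.
  have mx : Num.max (p k).2 (p j).2 < Num.min (p k).1 (p j).1.
    by rewrite gt_max !lt_min pkl pjl jk' jk''.
  have x1 : Num.max (p k).2 (p j).2 < x by rewrite /x; lra.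
  have x2 : x < Num.min (p k).1 (p j).1 by rewrite /x; lra.
  move: x1 x2; rewrite gt_max !lt_min => /andP[a b] /andP[c e'].
  move/trivIsetP : tJ => /(_ j k I I jk) /seteqP[+ _] => /(_ x); apply.
  by split; [apply: pj|apply: pk]; rewrite /= in_itv /= ?a ?b ?c ?e'.
apply: (@le_trans _ _ (\sum_(q <- s) `|G q.1 - G q.2|)%:E).
  rewrite /s big_map -sumEFin; apply: lee_sum => k _ /=.
  have [pk21 Jp _ _] := pP k.
  apply: (@le_trans _ _ (lsF `](p k).2, (p k).1]%classic)).
    by apply: lsF_le => //; exact: mJ.
  by rewrite lsF_itv// lee_fin /F ler_norm.
rewrite lee_fin; apply/ltW/H => //; rewrite -lte_fin; apply: le_lt_trans Ud.
apply: le_trans (muJ m); rewrite /s big_map -sumEFin; apply: lee_sum => k _ /=.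
have [pk21 _ muJp _] := pP k; apply: le_trans muJp.
by rewrite lee_fin clampB// ltW.
Unshelve. all: by end_near. Qed.

(** The density is the Radon-Nikodym derivative of the Stieltjes measure of [G], restricted to ]0,
    T] so as to be a finite measure. *)
Lemma abs_continuous_density : exists2 g : R -> R,
  mu.-integrable setT (EFin \o g) &
  forall t, 0 <= t <= T -> G t - G 0 = \int[mu]_(x in `]0, t]) g x.
Proof.
have mD : measurable (`]0, T]%classic : set (measurableTypeR R)) by exact: measurable_itv.
have Dfin : (lsF (`]0%R, T]%classic) < +oo)%E by rewrite lsF_itv ?ltry// ltW.
pose nu : {finite_measure set (measurableTypeR R) -> \bar R} := mfrestr mD Dfin.
have dom : nu `<< (mu : {measure set (measurableTypeR R) -> \bar R}).
  apply/null_content_dominatesP => N mN N0.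
  apply: (@subset_measure0 _ _ _ lsF _ N) => //; last exact: lsF_dominated.
  exact: measurableI.
have [g [g0 gfin gint gE]] := radon_nikodym_sigma_finite dom.
exists (fine \o g).
  by apply: eq_integrable gint => // x _ /=; rewrite fineK.
move=> t /andP[t0 tT]; have mt : measurable (`]0, t]%classic : set (measurableTypeR R)).
  exact: measurable_itv.
have := gE _ mt; rewrite /nu /= /mfrestr /mrestr setIidl; last first.
  by apply: subset_itvl; rewrite bnd_simp.
rewrite lsF_itv// /F !clamp_id ?lexx ?t0 ?tT ?ltW// => gt.
rewrite /Rintegral.
rewrite (_ : (fun x => _) = g); last by apply/funext => x /=; rewrite fineK.
by rewrite -gt.
Qed.

End density.

Section action_increment.
Context {R : realType}.
Variable T : R.
Hypothesis T0 : 0 < T.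
Notation mu := (@lebesgue_measure R).
Implicit Types f : R -> R.

Lemma variation_path_nd f : abs_continuous T f ->
  forall s t : R, 0 <= s -> s <= t -> t <= T -> variation_path f s <= variation_path f t.
Proof.
move=> acf s t s0 st tT; rewrite -subr_ge0 -lee_fin.
by rewrite (variation_pathB (ltW T0) acf)// total_variation_ge0.
Qed.

(** Both terms of the Jordan decomposition have densities; their difference [g2 - g1] represents
    [f], and the Lebesgue differentiation theorem identifies it with [derive1 f] off a null set. *)
Lemma abs_continuous_ftc f : abs_continuous T f -> exists2 g : R -> R,
  mu.-integrable setT (EFin \o g) &
  (forall t, 0 <= t <= T -> f t - f 0 = \int[mu]_(x in `]0, t]) g x) /\
  exists N, [/\ measurable N, mu N = 0%E &
    forall x, 0 < x < T -> ~ N x -> derive1 f x = g x].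
Proof.
move=> acf; have T0' := ltW T0; have acV := variation_path_abs_continuous T0' acf.
have [g1 g1i g1E] := abs_continuous_density T0 acV (variation_path_nd acf).
have nd2 (s t : R) : 0 <= s -> s <= t -> t <= T ->
    variation_path f s + f s <= variation_path f t + f t.
  move=> s0 st tT; rewrite -subr_ge0 opprD addrACA.
  have : `|f t - f s| <= variation_path f t - variation_path f s.
    by rewrite -lee_fin (variation_pathB T0' acf)// total_variation_ge.
  by rewrite ler_norml => /andP[+ _]; lra.
have [g2 g2i g2E] := abs_continuous_density T0 (abs_continuousD acV acf) nd2.
have gi : mu.-integrable setT (EFin \o (fun x => g2 x - g1 x)).
  rewrite (_ : _ \o _ = (EFin \o g2) \- (EFin \o g1))%E; first exact: integrableB.
  by apply/funext => x /=; rewrite EFinB.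
exists (fun x => g2 x - g1 x) => //.
have fE t : 0 <= t <= T -> f t - f 0 = \int[mu]_(x in `]0, t]) (g2 x - g1 x).
  move=> t0T; rewrite RintegralB//; first by rewrite -g1E// -g2E//; lra.
  - by apply: integrableS g2i.
  - by apply: integrableS g1i.
split => //.
have /lebesgue_differentiation := open_integrable_locally openT gi.
move=> [N [mN N0 NS]]; exists N; split => // x /andP[x0 xT] Nx.
have xL : lebesgue_pt (fun x => g2 x - g1 x) x.
  by apply: contrapT => h; apply: Nx; apply: NS.
pose F (t : R) := \int[mu]_(x in `]0, t]) (g2 x - g1 x).
have [dF FE] : derivable F x 1 /\ derive1 F x = g2 x - g1 x.
  apply: (@FTC1_lebesgue_pt _ _ (BRight 0) x T) => //.
  by apply: integrableS gi => //; exact: measurable_itv.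
rewrite -FE 2!derive1E; transitivity ('D_1 (F \+ cst (f 0)) x); last first.
  rewrite deriveD; [by rewrite derive_cst addr0|exact: dF|exact: derivable_cst].
apply: near_eq_derive.
have : \forall t \near x, t \in `]0, T[ by apply: near_in_itvoo; rewrite in_itv /= x0.
apply: filterS => t; rewrite in_itv /= => /andP[t0 tT].
by rewrite /F -fE ?subrK// !ltW.
Qed.

(** Integrates [|g| <= c / 2 + g ^ 2 / (2 * c)], the expansion of [0 <= (c - |g|) ^ 2], over ]s, t].
    The free parameter [c] takes the place of the Cauchy-Schwarz inequality. *)
Lemma abs_continuous_increment f (s t c : R) : abs_continuous T f ->
  0 <= s -> s <= t -> t <= T -> 0 < c ->
  (`|f t - f s|%:E <= (c / 2 * (t - s))%:E + ((2 * c)^-1)%:E *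
     \int[mu]_(x in `[0%R, T]) (derive1 f x ^+ 2)%:E)%E.
Proof.
move=> acf s0 st tT c0; have [g gi [gE [N [mN N0 dN]]]] := abs_continuous_ftc acf.
have t0 := le_trans s0 st; have sT := le_trans st tT.
have mst : measurable (`]s, t]%classic : set (measurableTypeR R)) by exact: measurable_itv.
have gst : mu.-integrable `]s, t] (EFin \o g) by apply: integrableS gi.
have mg : measurable_fun setT g by apply/measurable_EFinP; case/integrableP: gi.
have mg' D : measurable_fun D g by apply: measurable_funTS.
have -> : f t - f s = \int[mu]_(x in `]s, t]) g x.
  have := gE t; have := gE s; rewrite s0 sT t0 tT => /(_ isT) es /(_ isT) et.
  have -> : f t - f s = (f t - f 0) - (f s - f 0) by ring.
  rewrite es et (@itv_bndbnd_setU _ _ (BRight 0) (BRight s) (BRight t))// ?bnd_simp//.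
  rewrite Rintegral_setU//=.
  - by rewrite addrAC subrr add0r.
  - by apply: integrableS gi => //; apply: measurableU; exact: measurable_itv.
  - rewrite disj_set2E; apply/eqP/seteqP; split => // x [] /=.
    by rewrite !in_itv /= => /andP[_ xs] /andP[sx _]; move: xs sx; lra.
have mg2 D : measurable_fun D (fun x => g x ^+ 2).
  by under eq_fun do rewrite expr2; exact: measurable_funM.
have mcg D : measurable_fun D (fun x : R => (2 * c)^-1 * g x ^+ 2).
  by apply: measurable_funM.
have c20 : 0 <= c / 2 by rewrite divr_ge0// ltW.
have cV0 : 0 <= (2 * c)^-1 by rewrite invr_ge0 mulr_ge0// ltW.
have cg0 x : 0 <= (2 * c)^-1 * g x ^+ 2 by rewrite mulr_ge0// sqr_ge0.
apply: (@le_trans _ _ (\int[mu]_(x in `]s, t]) `|g x|%:E)%E).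
  have := le_normr_Rintegral mst gst; rewrite -lee_fin => /le_trans; apply.
  rewrite /Rintegral fineK//; apply: integrable_fin_num => //.
  by have := integrable_norm gst.
apply: (@le_trans _ _ (\int[mu]_(x in `]s, t]) ((c / 2)%:E +
    ((2 * c)^-1 * g x ^+ 2)%:E))%E).
  apply: ge0_integral_le => [x Dx|x _].
    split; [by []|by rewrite lee_fin|].
    rewrite -EFinD lee_fin; have : 0 <= (c - `|g x|) ^+ 2 := sqr_ge0 _.
    rewrite sqrrB real_normK ?num_real// => h.
    have -> : c / 2 + (2 * c)^-1 * g x ^+ 2 =
        `|g x| + (2 * c)^-1 * (c ^+ 2 - (c * `|g x|) *+ 2 + g x ^+ 2).
      by rewrite -mulr_natl; field; rewrite lt0r_neq0.
    by rewrite lerDl mulr_ge0// invr_ge0 mulr_ge0// ltW.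
  by rewrite adde_ge0// lee_fin.
rewrite ge0_integralD//; last by apply/measurable_EFinP; exact: mcg.
apply: leeD.
  have -> : (\int[mu]_(x in `]s, t]) (c / 2)%:E = (c / 2)%:E * mu `]s, t]%classic)%E.
    exact: integral_cst.
  rewrite lebesgue_measure_itv /= lte_fin.
  case: ifPn => _; rewrite -?EFinB -?EFinM ?mule0 lee_fin//.
  by rewrite ?mulr0 mulr_ge0// subr_ge0.
under eq_integral do rewrite EFinM.
rewrite ge0_integralZl//; first last.
- by move=> x _; rewrite lee_fin sqr_ge0.
- by apply/measurable_EFinP; exact: mg2.
apply: lee_wpmul2l; first by rewrite lee_fin invr_ge0 mulr_ge0// ltW.
(* The point [T] joins the exceptional set since the derivative is identified only inside ]0, T[. *)
apply: (@ge0_integral_le_ae _ _ _ _ _ _ (N `|` [set T])) => //.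
- by apply/measurable_EFinP; exact: mg2.
- exact: measurableU.
- apply/eqP; rewrite eq_le measure_ge0 andbT.
  have h : (mu (N `|` [set T]) <= mu N + mu [set T])%E by apply: measureU2.
  by rewrite N0 lebesgue_measure_set1 adde0 in h.
- by move=> x _; rewrite lee_fin sqr_ge0.
- move=> x /=; rewrite !in_itv /= => /andP[sx xt] /not_orP[Nx xT].
  have x0 := le_lt_trans s0 sx; have xT' := le_trans xt tT.
  rewrite (ltW x0) xT' dN//= x0 lt_neqAle xT' andbT; exact/eqP.
- by move=> x _; rewrite lee_fin sqr_ge0.
- by move=> x _; rewrite lee_fin.
Qed.

End action_increment.

(** * Renewal processes *)

Section renewal.
Context {R : realType}.
Variables (r : R) (xi : nat -> R).
Hypotheses (r0 : 0 < r) (xi0 : forall l, 0 < xi l).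
Implicit Types (l m : nat) (s t : R).

Definition epoch (l : nat) : R := \sum_(k < l) xi k / r.

Lemma epoch0 : epoch 0 = 0. Proof. by rewrite /epoch big_ord0. Qed.

Lemma epochS l : epoch l < epoch l.+1.
Proof. by rewrite /epoch big_ord_recr /= ltrDl divr_gt0. Qed.

Lemma epoch_lt l m : (l < m)%N -> epoch l < epoch m.
Proof.
elim: m => // m ih; rewrite ltnS leq_eqVlt => /predU1P[->|/ih lm]; first exact: epochS.
exact: lt_trans lm (epochS m).
Qed.

Lemma epoch_le l m : (l <= m)%N -> epoch l <= epoch m.
Proof. by rewrite leq_eqVlt => /predU1P[->//|/epoch_lt/ltW]. Qed.

Lemma epoch_le_lt l m t : epoch l <= t -> t < epoch m -> (l < m)%N.
Proof.
move=> lt tm; rewrite ltnNge; apply/negP => /epoch_le ml.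
by have := lt_le_trans tm (le_trans ml lt); rewrite ltxx.
Qed.

Lemma renewal_countE l t : epoch l <= t < epoch l.+1 -> renewal_count r xi t = l%:R.
Proof.
move=> /andP[lt tl]; rewrite /renewal_count.
apply/eqP; rewrite eq_le; apply/andP; split.
  apply: ge_sup; first by exists l%:R; exists l.
  by move=> _ [m /= mt <-]; rewrite ler_nat -ltnS (epoch_le_lt mt).
apply: ub_le_sup; last by exists l.
by exists l%:R => _ [m /= mt <-]; rewrite ler_nat -ltnS (epoch_le_lt mt).
Qed.

(** When every epoch is at most [t] the counted set is unbounded and [sup] returns its default 0, so
    the count remains a natural number on every outcome. *)
Lemma renewal_count_junk t : (forall l, epoch l <= t) -> renewal_count r xi t = 0.
Proof.
move=> H; apply: sup_out => -[_ [b bub]].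
have := bub (Num.bound b)%:R; case: (leP 0 b) => [b0|b0].
  have := archi_boundP b0 => /lt_le_trans h /(_ (ex_intro2 _ _ (Num.bound b) (H _) erefl)) /h.
  by rewrite ltxx.
move=> _; have b1 : 0%:R <= b by apply: bub; exists 0%N => //=; exact: (H 0%N).
by move: b0 b1; rewrite ltNge => /negP.
Qed.

Lemma renewal_count_lt0 t : t < 0 -> renewal_count r xi t = 0.
Proof.
move=> t0; rewrite /renewal_count (_ : [set _ | _ in _] = set0) ?sup0//.
apply/seteqP; split => // _ [l /= lt _].
have := le_lt_trans (epoch_le (leq0n l)) (le_lt_trans lt t0).
by rewrite epoch0 ltxx.
Qed.

Lemma epoch_bracket t m : 0 <= t -> t < epoch m ->
  exists2 l, (l < m)%N & epoch l <= t < epoch l.+1.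
Proof.
elim: m => [|m ih] t0; first by rewrite epoch0 => /(le_lt_trans t0); rewrite ltxx.
have [mt tm|/(ih t0)[l lm lE] _] := leP (epoch m) t; first by exists m; rewrite ?mt.
by exists l => //; exact: leq_trans lm _.
Qed.

Lemma renewal_count_cases t : [\/ t < 0,
  exists l, epoch l <= t < epoch l.+1 | 0 <= t /\ forall l, epoch l <= t].
Proof.
have [t0|t0] := ltP t 0; first by apply: Or31.
have [[m tm]|H] := pselect (exists m, t < epoch m).
  by apply: Or32; have [l _ lE] := epoch_bracket t0 tm; exists l.
by apply: Or33; split => // l; rewrite leNgt; apply/negP => h; apply: H; exists l.
Qed.

Lemma renewal_count_nat t : exists l : nat, renewal_count r xi t = l%:R.
Proof.
have [t0|[l lE]|[_ H]] := renewal_count_cases t.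
- by exists 0%N; rewrite renewal_count_lt0.
- by exists l; rewrite (renewal_countE lE).
- by exists 0%N; rewrite renewal_count_junk.
Qed.

Lemma renewal_count_ge0 t : 0 <= renewal_count r xi t.
Proof. by have [l ->] := renewal_count_nat t. Qed.

Lemma renewal_count_right t : exists2 e : R, 0 < e &
  forall s, t <= s -> s < t + e -> renewal_count r xi s = renewal_count r xi t.
Proof.
have [t0|[l lE]|[t0 H]] := renewal_count_cases t.
- exists (- t); first by rewrite oppr_gt0.
  by move=> s _; rewrite subrr => s0; rewrite !renewal_count_lt0.
- have /andP[lt tl] := lE; exists (epoch l.+1 - t); first by rewrite subr_gt0.
  move=> s ts; rewrite addrC subrK => sl.
  by rewrite (renewal_countE lE) (@renewal_countE l)// sl (le_trans lt).
- exists 1 => // s ts _.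
  by rewrite !renewal_count_junk// => l; exact: le_trans (H l) ts.
Qed.

Lemma renewal_count_left t m : 0 < t -> t <= epoch m -> exists2 e : R, 0 < e &
  exists l : nat, forall s, t - e < s -> s < t -> renewal_count r xi s = l%:R.
Proof.
elim: m => [|m ih] t0; first by rewrite epoch0 => /(lt_le_trans t0); rewrite ltxx.
have [/(ih t0)//|mt tm] := leP t (epoch m).
exists (t - epoch m); first by rewrite subr_gt0.
exists m => s; rewrite opprB addrC subrK => ms st.
by apply: renewal_countE; rewrite (ltW ms) (lt_le_trans st).
Qed.

Lemma renewal_count_le s t m : s <= t -> t < epoch m ->
  renewal_count r xi s <= renewal_count r xi t.
Proof.
move=> st tm; have [s0|s0] := ltP s 0.
  by rewrite renewal_count_lt0// renewal_count_ge0.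
have t0 := le_trans s0 st; have [l _ lE] := epoch_bracket t0 tm.
have [k _ kE] := epoch_bracket s0 (le_lt_trans st tm).
rewrite (renewal_countE lE) (renewal_countE kE) ler_nat -ltnS.
by move: lE kE => /andP[_ tl] /andP[ks _]; apply: epoch_le_lt tl; exact: le_trans st.
Qed.

End renewal.

Section countable_measurability.
Context {d : measure_display} {Omega : measurableType d} {R : realType}.

(** Level 0 is obtained as the complement of the positive ones: for a renewal count it mixes genuine
    zeros, negative times and the default value of [sup]. *)
Lemma nat_valued_measurable (f : Omega -> R) :
  (forall w, exists l : nat, f w = l%:R) ->
  (forall l, (0 < l)%N -> measurable (f @^-1` [set l%:R])) ->
  measurable_fun setT f.
Proof.
move=> fn mf _ U mU; rewrite setTI.
have mf0 l : measurable (f @^-1` [set l%:R]).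
  have [->|/mf//] := posnP l.
  rewrite (_ : _ @^-1` _ = ~` \bigcup_(k in [set k | (0 < k)%N]) (f @^-1` [set k%:R])).
    by apply: measurableC; apply: bigcup_measurable => k /mf.
  apply/seteqP; split => [w /= fw [k /= k0]|w /= H].
    by rewrite fw => /eqP; rewrite eqr_nat => /eqP kE; rewrite -kE in k0.
  have [[|k] fk] := fn w => //; exfalso; apply: H; exists k.+1 => //=.
rewrite (_ : _ @^-1` _ = \bigcup_(l in [set l : nat | U l%:R]) (f @^-1` [set l%:R])).
  by apply: bigcup_measurable.
apply/seteqP; split => [w /= Uw|w [l /= Ul ->]//].
by have [l fl] := fn w; exists l => //=; rewrite -fl.
Qed.

Lemma renewal_count_measurable (r : R) (xi : nat -> Omega -> R) (t : R) : 0 < r ->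
  (forall l w, 0 < xi l w) -> (forall l, measurable_fun setT (xi l)) ->
  measurable_fun setT (fun w => renewal_count r (xi ^~ w) t).
Proof.
move=> r0 xi0 mxi; apply: nat_valued_measurable => [w|l l0].
  exact: renewal_count_nat.
have mE k : measurable_fun setT (fun w => epoch r (xi ^~ w) k).
  apply: measurable_sum => j; apply: measurable_funM => //.
rewrite (_ : _ @^-1` _ = [set w | epoch r (xi ^~ w) l <= t] `&`
    [set w | t < epoch r (xi ^~ w) l.+1]).
  apply: measurableI.
    by rewrite -[X in measurable X]setTI; apply: measurable_fun_le.
  rewrite (_ : [set w | t < _] = ~` [set w | epoch r (xi ^~ w) l.+1 <= t]).
    by apply: measurableC; rewrite -[X in measurable X]setTI; apply: measurable_fun_le.
  by apply/seteqP; split => w /=; rewrite ltNge => /negP.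
apply/seteqP; split => [w /= wl|w [/= a b]]; last first.
  by apply: renewal_countE => //; rewrite a b.
have [t0|[k kE]|[t0 H]] := renewal_count_cases r (xi ^~ w) t.
- move: wl; rewrite renewal_count_lt0// => /eqP.
  by rewrite -[0]/(0%:R) eqr_nat => /eqP lE; rewrite -lE in l0.
- move: wl; rewrite (renewal_countE r0 (xi0 ^~ w) kE) => /eqP; rewrite eqr_nat.
  by move=> /eqP <-; move: kE => /andP[].
- move: wl; rewrite renewal_count_junk// => /eqP.
  by rewrite -[0]/(0%:R) eqr_nat => /eqP lE; rewrite -lE in l0.
Qed.

End countable_measurability.

(** * Balls of paths and the Skorohod topology *)

Section path_balls.
Context {R : realType}.
Variables (T : R) (k : nat).
Implicit Types (phi psi : R -> 'rV[R]_k) (e : R).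

Lemma enorm_coord (v : 'rV[R]_k) i : `|v ord0 i| <= enorm v.
Proof.
rewrite -sqrtr_sqr /enorm ler_wsqrtr// (bigD1 i)//= lerDl sumr_ge0// => j _.
exact: sqr_ge0.
Qed.

Lemma enorm_le_coord (v : 'rV[R]_k) (c : R) : 0 <= c ->
  (forall i, `|v ord0 i| <= c) -> enorm v <= k%:R * c.
Proof.
move=> c0 vc; rewrite -[leRHS]ger0_norm ?mulr_ge0// -sqrtr_sqr /enorm ler_wsqrtr//.
apply: (@le_trans _ _ (\sum_(i < k) c ^+ 2)).
  by apply: ler_sum => i _; rewrite -[leLHS]real_normK ?num_real// lerXn2r ?nnegrE.
rewrite sumr_const card_ord -[leLHS]mulr_natl exprMn; apply: ler_wpM2r; first exact: sqr_ge0.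
by rewrite -natrX ler_nat; case: (k) => // n; rewrite leq_pmulr.
Qed.

Definition cball psi e : set (R -> 'rV[R]_k) :=
  [set phi | forall t, 0 <= t <= T -> forall i, `|phi t ord0 i - psi t ord0 i| <= e].

(** The open ball for the supremum distance: a uniform margin below [e] is required, since an RCLL
    path may approach a distance without attaining it. *)
Definition oball psi e : set (R -> 'rV[R]_k) :=
  [set phi | exists2 eta, eta < e & cball psi eta phi].

Definition right_cont (f : R -> R) := forall t, 0 <= t < T -> forall e, 0 < e ->
  exists2 delta : R, 0 < delta & forall s, t <= s -> s < t + delta -> `|f s - f t| <= e.

Definition unif_cont (f : R -> R) := forall e, 0 < e -> exists2 delta : R, 0 < delta &
  forall s t, 0 <= s <= T -> 0 <= t <= T -> `|s - t| <= delta -> `|f s - f t| <= e.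

Lemma row_cvg (F : set_system R) (FF : Filter F) phi (l : 'rV[R]_k) :
  (forall i, phi s ord0 i @[s --> F] --> l ord0 i) -> phi s @[s --> F] --> l.
Proof.
move=> H; apply/cvg_ballP => e e0.
have : \forall s \near F, forall i, ball (l ord0 i) e (phi s ord0 i).
  by apply: filter_forall => i; move/cvg_ballP: (H i); exact.
by apply: filterS => s Hs; split => // i j; rewrite ord1; exact: Hs.
Qed.

Lemma row_cvg_coord (F : set_system R) {FF : Filter F} phi (l : 'rV[R]_k) i :
  phi s @[s --> F] --> l -> phi s ord0 i @[s --> F] --> l ord0 i.
Proof.
move=> /cvg_ballP H; apply/cvg_ballP => e /H; apply: filterS => s [_].
exact.
Qed.

(** Heine's theorem, by the near-covering form of compactness with the modulus [delta] tending to 0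
    from the right. *)
Lemma continuous_unif_cont (f : R -> R) :
  {within `[0, T], continuous f} -> unif_cont f.
Proof.
move=> /subspace_continuousP cf e e0.
have /compact_near_coveringP/near_covering_withinP cpt := @segment_compact R 0 T.
pose Q (delta x : R) := forall s, 0 <= s <= T -> `|s - x| <= delta -> `|f s - f x| <= e.
have e20 : 0 < e / 2 by rewrite divr_gt0.
have [|delta /= d0 Hd] := cpt R (0 : R)^'+ Q _.
  move=> x Kx; have /cvgrPdist_le/(_ _ e20) := cf x Kx.
  rewrite near_withinE => /nbhs_ballP[r /= r0 rP].
  exists (ball x (r / 2), [set delta | delta < r / 2]).
    split; [by apply: nbhsx_ballx; rewrite divr_gt0|].
    by apply: nbhs_right_lt; rewrite divr_gt0.
  move=> [x' delta] [/= xx' dr] Kx' s s0T sx'.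
  have h1 : `|f x - f x'| <= e / 2.
    apply: rP => //; apply: lt_le_trans xx' _; rewrite ler_pdivrMr// ler_pMr//.
    by rewrite ler1n.
  have h2 : `|f x - f s| <= e / 2.
    apply: rP; last by rewrite /= in_itv.
    rewrite /ball /=; have -> : x - s = (x - x') - (s - x') by ring.
    apply: le_lt_trans (ler_normB _ _) _; rewrite (splitr r) ltrD//.
    exact: le_lt_trans sx' dr.
  have -> : f s - f x' = (f x - f x') - (f x - f s) by ring.
  by apply: le_trans (ler_normB _ _) _; rewrite (splitr e) lerD.
exists (delta / 2); first by rewrite divr_gt0.
move=> s t s0T t0T st; apply: (Hd (delta / 2)) => //=.
- rewrite sub0r normrN gtr0_norm ?divr_gt0// ltr_pdivrMr// ltr_pMr// ltr1n//.
- by rewrite divr_gt0.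
Qed.

Lemma cpath_unif_cont psi i : cpath T k psi -> unif_cont (fun t => psi t ord0 i).
Proof.
move=> /subspace_continuousP cpsi; apply: continuous_unif_cont.
by apply/subspace_continuousP => x x0T; exact: row_cvg_coord (cpsi x x0T).
Qed.

Lemma unif_cont_cpath psi :
  (forall i, unif_cont (fun t => psi t ord0 i)) -> cpath T k psi.
Proof.
move=> H; apply/subspace_continuousP => x x0T; apply: row_cvg => i.
apply/cvgrPdist_le => e e0; have [delta d0 Hd] := H i e e0.
rewrite near_withinE; near=> t => t0T; rewrite distrC; apply: Hd.
- by move: t0T; rewrite /= in_itv.
- by move: x0T; rewrite /= in_itv.
- by rewrite distrC; near: t; exact: cvgr_dist_le.
Unshelve. all: by end_near. Qed.

Lemma unif_cont_within (f : R -> R) : unif_cont f -> {within `[0, T], continuous f}.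
Proof.
move=> H; apply/subspace_continuousP => x x0T.
apply/cvgrPdist_le => e e0; have [delta d0 Hd] := H e e0.
rewrite near_withinE; near=> t => t0T; rewrite distrC; apply: Hd.
- by move: t0T; rewrite /= in_itv.
- by move: x0T; rewrite /= in_itv.
- by rewrite distrC; near: t; exact: cvgr_dist_le.
Unshelve. all: by end_near. Qed.

Lemma unif_cont_measurable (f : R -> R) : unif_cont f -> measurable_fun `[0, T] f.
Proof.
by move=> /unif_cont_within; apply: subspace_continuous_measurable_fun.
Qed.

Lemma unif_cont_bounded (f : R -> R) : unif_cont f -> exists C, forall t,
  0 <= t <= T -> `|f t| <= C.
Proof.
move=> /unif_cont_within cf.
have /compact_bounded[C [_ HC]] := continuous_compact cf (@segment_compact R 0 T).
exists (C + 1) => t t0T; apply: (HC (C + 1)); first by rewrite ltrDl.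
by exists t => //=; rewrite in_itv.
Qed.

Lemma unif_contD (f g : R -> R) : unif_cont f -> unif_cont g ->
  unif_cont (fun t => f t + g t).
Proof.
move=> uf ug e e0; have e20 : 0 < e / 2 by rewrite divr_gt0.
have [d1 d10 H1] := uf _ e20; have [d2 d20 H2] := ug _ e20.
exists (Num.min d1 d2); first by rewrite lt_min d10.
move=> s t s0 t0; rewrite le_min => /andP[/(H1 s t s0 t0) a /(H2 s t s0 t0) b].
by rewrite opprD addrACA; apply: le_trans (ler_normD _ _) _; rewrite (splitr e) lerD.
Qed.

Lemma unif_contN (f : R -> R) : unif_cont f -> unif_cont (fun t => - f t).
Proof.
move=> uf e e0; have [d d0 H] := uf _ e0; exists d => // s t s0 t0 /(H s t s0 t0).
by rewrite -opprD normrN.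
Qed.

Lemma unif_cont_lin (c : R) : unif_cont (fun t => t * c).
Proof.
move=> e e0; exists (e / (`|c| + 1)); first by rewrite divr_gt0// ltr_wpDl.
move=> s t _ _; rewrite -mulrBl normrM ler_pdivlMr ?ltr_wpDl//; apply: le_trans.
by rewrite ler_wpM2l// lerDl.
Qed.

Lemma unif_cont_scaled (f : R -> R) (c : R) : 0 <= c <= 1 -> unif_cont f ->
  unif_cont (fun t => f (c * t)).
Proof.
move=> /andP[c0 c1] uf e e0; have [d d0 H] := uf _ e0; exists d => // s t.
move=> /andP[s0 sT] /andP[t0 tT] st; apply: H.
- by rewrite mulr_ge0//= (le_trans _ sT)// ler_piMl.
- by rewrite mulr_ge0//= (le_trans _ tT)// ler_piMl.
- by rewrite -mulrBr normrM (ger0_norm c0) (le_trans _ st)// ler_piMl.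
Qed.

Lemma unif_cont_right_cont (f : R -> R) : unif_cont f -> right_cont f.
Proof.
move=> H t /andP[t0 tT] e e0; have [delta d0 Hd] := H e e0.
exists (Num.min delta (T - t)); first by rewrite lt_min d0 subr_gt0.
move=> s ts; rewrite -ltrBlDl lt_min => /andP[sd sT]; apply: Hd.
- by rewrite (le_trans t0 ts); move: sT; lra.
- by rewrite t0 ltW.
- by rewrite ger0_norm ?subr_ge0// ltW.
Qed.

Lemma rcll_right_cont phi i : rcll T k phi -> right_cont (fun t => phi t ord0 i).
Proof.
move=> [rc _] t t0T e e0.
have : phi s ord0 i @[s --> t^'+] --> phi t ord0 i.
  exact: row_cvg_coord (rc t t0T).
move=> /cvgrPdist_le/(_ _ e0)[delta /= d0 Hd]; exists delta => // s.
rewrite le_eqVlt => /predU1P[<- _|ts sd]; first by rewrite subrr normr0 ltW.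
by rewrite distrC; apply: Hd => //=; rewrite distrC gtr0_norm ?subr_gt0// ltrBlDl.
Qed.

(** By right continuity each [t < T] is reached from rational times on its right; [T] itself is the
    clamp of any rational beyond it. Events over all times thus become countable intersections. *)
Lemma right_cont_closed (f g : R -> R) e : 0 <= T -> right_cont f -> right_cont g ->
  (forall q : rat, `|f (clamp T (ratr q)) - g (clamp T (ratr q))| <= e) ->
  forall t, 0 <= t <= T -> `|f t - g t| <= e.
Proof.
move=> T0 cf cg H t /andP[t0]; rewrite le_eqVlt => /predU1P[->|tT].
  have TT : T < T + 1 by rewrite ltrDl.
  have [q] := rat_in_itvoo TT; rewrite in_itv /= => /andP[/ltW Tq _].
  by have := H q; rewrite clamp_ge.
apply/ler_addgt0Pr => eta eta0; have eta20 : 0 < eta / 2 by rewrite divr_gt0.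
have t0T : 0 <= t < T by rewrite t0.
have [d1 d10 H1] := cf t t0T _ eta20; have [d2 d20 H2] := cg t t0T _ eta20.
have : t < t + Num.min (T - t) (Num.min d1 d2).
  by rewrite ltrDl !lt_min subr_gt0 tT d10.
move=> /rat_in_itvoo[q]; rewrite in_itv /= -ltrBlDl !lt_min => /and4P[tq qT q1 q2].
have qE : clamp T (ratr q) = ratr q.
  by apply: clamp_id; rewrite (le_trans t0 (ltW tq)) /=; move: qT; lra.
have := H q; rewrite qE => Hq.
have h1 := H1 _ (ltW tq); have h2 := H2 _ (ltW tq).
rewrite -!ltrBlDl in h1 h2; have {}h1 := h1 q1; have {}h2 := h2 q2.
have -> : f t - g t = - (f (ratr q) - f t) + (f (ratr q) - g (ratr q)) +
  (g (ratr q) - g t) by ring.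
have := ler_normD (- (f (ratr q) - f t) + (f (ratr q) - g (ratr q)))
  (g (ratr q) - g t).
have := ler_normD (- (f (ratr q) - f t)) (f (ratr q) - g (ratr q)).
by rewrite normrN; move: Hq h1 h2; lra.
Qed.

Lemma sup_norm_coord phi (c : \bar R) t i : (sup_norm T phi <= c)%E -> 0 <= t <= T ->
  (`|phi t ord0 i|%:E <= c)%E.
Proof.
move=> phic t0T; apply: le_trans phic; apply: (@le_trans _ _ (enorm (phi t))%:E).
  by rewrite lee_fin enorm_coord.
by apply: ereal_sup_ubound; exists t => //=; rewrite in_itv.
Qed.

Lemma j1_dist_lt phi psi e : 0 <= T -> (j1_dist T phi psi < e%:E)%E ->
  exists l : R -> R, [/\ forall t, 0 <= t <= T -> 0 <= l t <= T /\ `|l t - t| <= e,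
    forall t, 0 <= t <= T -> forall i, `|phi t ord0 i - psi (l t) ord0 i| <= e &
    forall s, 0 <= s <= T -> exists2 t, 0 <= t <= T & l t = s].
Proof.
move=> T0 /ereal_inf_lt[_ [l [cl incl l0 lT] <-]]; rewrite gt_max => /andP[H1 H2].
exists l; split.
- move=> t t0T; have tI : t \in `[0, T] by rewrite in_itv.
  have /andP[t0 tT] := t0T.
  have lnd s u : 0 <= s -> u <= T -> s <= u -> l s <= l u.
    move=> s0 uT; rewrite le_eqVlt => /predU1P[->//|su]; apply/ltW/incl => //;
    by rewrite in_itv /= ?s0 ?uT /= ?(le_trans s0 (ltW su)) ?(le_trans (ltW su) uT).
  split; first by rewrite -l0 -lT !lnd.
  rewrite -lee_fin; apply: le_trans (ltW H1); apply: ereal_sup_ubound.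
  by exists t => //=; rewrite in_itv.
- move=> t t0T i; rewrite -lee_fin.
  by have := sup_norm_coord i (ltW H2) t0T; rewrite !mxE.
- move=> s s0T; have [|t tI lt] := @IVT _ l 0 T s T0 cl _.
    by rewrite l0 lT min_l// max_r.
  by exists t => //; move: tI; rewrite in_itv.
Qed.

(** A small time change moves the continuous center by little, so a path J1-close to one in the ball
    is uniformly almost as close to [psi]. Of the margin [e - eta], one quarter pays for the J1
    distance and one for the modulus of [psi]. *)
Lemma j1_open_oball psi e : 0 <= T -> cpath T k psi -> j1_open T (rcll T k `&` oball psi e).
Proof.
move=> T0 cpsi; split; first by move=> phi [].
move=> phi [rphi [eta etae pball]].
have e40 : 0 < (e - eta) / 4 by rewrite divr_gt0// subr_gt0.
have /choice[delta Hd] : forall i : 'I_k, exists delta : R, 0 < delta /\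
    forall s t, 0 <= s <= T -> 0 <= t <= T -> `|s - t| <= delta ->
    `|psi s ord0 i - psi t ord0 i| <= (e - eta) / 4.
  by move=> i; have [delta d0 H] := cpath_unif_cont i cpsi e40; exists delta.
pose dd := \big[Num.min/((e - eta) / 4)]_i delta i.
exists dd; first by apply/bigmin_gtP; split => // i _; have [] := Hd i.
move=> phi' rphi' /(j1_dist_lt T0)[l [l1 l2 l3]]; split => //.
exists ((e + eta) / 2); first by move: etae; lra.
move=> s s0T i; have [t t0T lts] := l3 s s0T.
have [lt0T ltt] := l1 t t0T; have h2 := l2 t t0T i; rewrite lts in h2 ltt.
have di : dd <= delta i by apply: bigmin_le_cond.
have d4 : dd <= (e - eta) / 4 by exact: bigmin_le_id.
have [_ /(_ s t s0T t0T (le_trans ltt di)) h3] := Hd i.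
have h1 := pball t t0T i.
have {}h2 := le_trans h2 d4.
have -> : phi' s ord0 i - psi s ord0 i =
  - (phi t ord0 i - phi' s ord0 i) + (phi t ord0 i - psi t ord0 i) -
  (psi s ord0 i - psi t ord0 i) by ring.
apply: le_trans (ler_normB _ _) _; have := ler_normD (- (phi t ord0 i - phi' s ord0 i))
  (phi t ord0 i - psi t ord0 i); rewrite normrN => h4.
by move: h1 h2 h3 h4; lra.
Qed.

Lemma j1_closed_oballC (J : Type) (psi : J -> R -> 'rV[R]_k) (e : J -> R) (D : set J) :
  0 <= T -> (forall j, D j -> cpath T k (psi j)) ->
  j1_closed T (rcll T k `\` \bigcup_(j in D) oball (psi j) (e j)).
Proof.
move=> T0 cpsi; split; first by move=> phi [].
split; first by move=> phi [].
move=> phi [rphi /not_andP[//|/contrapT[j Dj ophi]]].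
have [_ /(_ phi (conj rphi ophi))[delta d0 H]] := j1_open_oball (e j) T0 (cpsi j Dj).
exists delta => // psi' rpsi' /(H _ rpsi')[_ ob]; split => // -[_]; apply.
by exists j.
Qed.

End path_balls.

(** * Regularity of the primitive processes *)

Section iid_divergence.
Context {R : realType} {d : measure_display} {Omega : measurableType d}.
Variable P : probability Omega R.
Variable X : nat -> Omega -> R.
Hypotheses (iidX : iid P X) (mX : forall l, measurable_fun setT (X l)).
Hypothesis X0 : forall l w, 0 < X l w.

Let lt_set e l := [set w | X l w < e].

Let lt_setE e l : lt_set e l = X l @^-1` `]-oo, e[%classic.
Proof. by apply/seteqP; split => w; rewrite /lt_set /= in_itv. Qed.

Let lt_set_measurable e l : measurable (lt_set e l).
Proof.
rewrite lt_setE -[X in measurable X]setTI; apply: mX => //; exact: measurable_itv.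
Qed.

(** Continuity from above along the events [X 0 < 1 / (k + 1)], whose intersection is empty by
    positivity. *)
Let small_prob : exists2 e : R, 0 < e & (P (lt_set e 0) <= (2^-1)%:E)%E.
Proof.
pose F k := lt_set (k.+1%:R^-1) 0.
have Fcvg : P (F k) @[k --> \oo] --> P (\bigcap_k F k).
  apply: nonincreasing_cvg_mu => //.
  - by apply: (le_lt_trans (probability_le1 P (lt_set_measurable _ _))); rewrite ltry.
- by move=> k; exact: lt_set_measurable.
  - by apply: bigcapT_measurable => k; exact: lt_set_measurable.
  - move=> k m km; apply/subsetPset => w /lt_le_trans; apply.
    by rewrite lef_pV2 ?posrE// ler_nat.
have F0 : \bigcap_k F k = set0.
  apply/seteqP; split => // w H.
  have /(_ (Num.bound (X 0 w)^-1) I) := H; rewrite /F /lt_set /=.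
  have Xp : 0 <= (X 0 w)^-1 by rewrite invr_ge0 ltW.
  have := archi_boundP Xp; set b := Num.bound _ => h1 h2.
  have h3 : 1 < b%:R * X 0 w by rewrite -ltr_pdivrMr// div1r.
  have h4 : X 0 w * b.+1%:R < 1 by rewrite -ltr_pdivlMr// div1r.
  by move: h4 (X0 0 w); rewrite -natr1 mulrDr mulr1 mulrC; lra.
rewrite F0 measure0 in Fcvg.
have : \forall k \near \oo, (P (F k) < (2^-1)%:E)%E.
  have /fine_cvgP[fin /cvgrPdist_lt/(_ 2^-1)] := Fcvg.
  have half0 : 0 < 2^-1 :> R by rewrite invr_gt0.
  move=> /(_ half0) H; near=> k.
  have Ff : P (F k) \is a fin_num by near: k.
  rewrite -(fineK Ff) lte_fin; have : `|0 - fine (P (F k))| < 2^-1 by near: k.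
  by rewrite sub0r normrN ger0_norm// fine_ge0.
move=> [k _ /(_ k (leqnn k)) Pk]; exists k.+1%:R^-1; first by rewrite invr_gt0.
exact: ltW.
Unshelve. all: by end_near. Qed.

Let block_prob e m q : (P (lt_set e 0) <= (2^-1)%:E)%E ->
  (P (\big[setI/setT]_(j <- iota m q) lt_set e j) <= (2^-1 ^+ q)%:E)%E.
Proof.
move=> P0; case: iidX => indep same.
rewrite (indep (iota m q) (lt_set e)) ?iota_uniq//; last first.
  move=> j _; rewrite lt_setE; apply: sub_sigma_algebra.
  exists (X j) => //; exists `]-oo, e[%classic; first exact: measurable_itv.
  by rewrite setTI.
have -> : (\prod_(j <- iota m q) P (lt_set e j) = \prod_(j <- iota m q) P (lt_set e 0))%E.
  apply: eq_bigr => j _; rewrite !lt_setE; apply: same; exact: measurable_itv.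
elim: q m => [|q ih] m /=; first by rewrite big_nil expr0.
rewrite big_cons exprS EFinM; apply: lee_pmul => //.
by apply: prode_ge0.
Qed.

(** If the partial sums stay below [c], only finitely many terms reach [e], so from some index on
    all terms are below [e]. By independence such a tail has probability at most [2 ^ -q] for every
    [q]. *)
Lemma iid_divergent (c : R) : measurable [set w | forall m, \sum_(k < m) X k w <= c] /\
  P [set w | forall m, \sum_(k < m) X k w <= c] = 0%E.
Proof.
set D := [set w | _].
have mD : measurable D.
  rewrite (_ : D = \bigcap_m [set w | \sum_(k < m) X k w <= c]).
    apply: bigcapT_measurable => m; rewrite -[X in measurable X]setTI.
    by apply: measurable_fun_le => //; apply: measurable_sum.
  by apply/seteqP; split => w H m => [_|]; [exact: (H m)|exact: (H m I)].
split => //; have [e e0 Pe] := small_prob.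
pose N m := \bigcap_(k in [set k | (m <= k)%N]) lt_set e k.
have mN m : measurable (N m).
  by apply: bigcap_measurable => [|k _]; [exists m => /=|exact: lt_set_measurable].
have N0 m : P (N m) = 0%E.
  apply/eqP; rewrite eq_le measure_ge0 andbT.
  apply/lee_addgt0Pr => eta eta0; rewrite add0e.
  have : \forall q \near \oo, (2^-1 ^+ q : R) < eta.
    have : (2^-1 ^+ q : R) @[q --> \oo] --> (0 : R).
      by apply: cvg_expr; rewrite ger0_norm ?invr_ge0// invf_lt1// ltr1n.
    move=> /cvgrPdist_lt/(_ _ eta0); apply: filterS => q.
    by rewrite sub0r normrN ger0_norm// exprn_ge0 ?invr_ge0.
  move=> [q _ /(_ q (leqnn q)) qeta].
  apply: (@le_trans _ _ (2^-1 ^+ q)%:E); last by rewrite lee_fin ltW.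
  apply: le_trans (block_prob m q Pe); apply: le_measure; rewrite ?inE//.
    by elim: (iota m q) => [|j s ih]; rewrite ?big_nil// big_cons; apply: measurableI.
  move=> w Nw; rewrite -bigcap_seq => j /=; rewrite mem_iota => /andP[mj _].
  exact: Nw.
have DN : D `<=` \bigcup_m N m.
  move=> w Dw; apply: contrapT => notN.
  have big m : exists2 k, (m <= k)%N & e <= X k w.
    apply: contrapT => H; apply: notN; exists m => // k /= mk.
    by rewrite /lt_set /= ltNge; apply/negP => h; apply: H; exists k.
  have sums j : exists m, j%:R * e <= \sum_(k < m) X k w.
    elim: j => [|j [m mE]]; first by exists 0%N; rewrite big_ord0 mul0r.
    have [k mk ke] := big m; exists k.+1; rewrite big_ord_recr /= -natr1 mulrDl mul1r.
    apply: lerD => //; apply: (le_trans mE); rewrite -(subnKC mk) big_split_ord /=.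
    by rewrite lerDl sumr_ge0// => i _; exact: ltW.
  have [m] := sums (Num.bound (`|c| / e)).
  apply/negP; rewrite -ltNge; apply: (le_lt_trans (Dw m)).
  rewrite -ltr_pdivrMr//; apply: le_lt_trans (archi_boundP _).
    by rewrite ler_pM2r ?invr_gt0// ler_norm.
  by rewrite divr_ge0// ltW.
apply: measure_negligible mD _; apply: negligibleS DN _.
by apply: negligible_bigcup => m; exists (N m); split; [exact: mN|exact: N0|by []].
Qed.

End iid_divergence.

Section primitive_paths.
Context {R : realType} {d : measure_display} {Omega : measurableType d}
  {P : probability Omega R} {I : nat}.
Variable M : queue_model P I.
Hypothesis prim : renewal_primitives M.
Hypothesis mht : moderate_heavy_traffic M.
Notation T := (horizon M).
Implicit Types (n l m : nat) (w : Omega) (i : 'I_I) (j : 'I_(I + I)).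

Lemma horizon_gt0 : 0 < T. Proof. by case: mht. Qed.

(** Arrivals and services are treated as one family of renewal processes, indexed like the columns
    of [AS_tilde]. *)
Definition prim_rate n j : R :=
  match fintype.split j with inl i => lamn M n i | inr i => mun M n i end.

Definition primitive j l w : R :=
  match fintype.split j with inl i => ia M i l w | inr i => st M i l w end.

Definition prim_epoch n j w l := epoch (prim_rate n j) (primitive j ^~ w) l.

Lemma prim_rate_gt0 n j : (0 < n)%N -> 0 < prim_rate n j.
Proof.
move=> n0; rewrite /prim_rate; case: mht => _ _ lamP muP _.
by case: (fintype.split j) => i; [case: (lamP i) => + _ _ _|case: (muP i) => + _ _ _]; exact.
Qed.

Lemma primitive_gt0 j l w : 0 < primitive j l w.
Proof.
by rewrite /primitive; case: prim => _ _ pos _ _; case: (fintype.split j) => i;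
  have [] := pos i l w.
Qed.

Lemma measurable_primitive j l : measurable_fun setT (primitive j l).
Proof. by rewrite /primitive; case: (fintype.split j) => i; exact: measurable_funPT. Qed.

Lemma scale_gt0 n : (0 < n)%N -> 0 < scale M n.
Proof.
move=> n0; rewrite /scale mulr_gt0//; last by rewrite sqrtr_gt0 ltr0n.
by case: mht => _ [+ _ _] _ _ _; exact.
Qed.

Lemma AS_tildeE n w t j : AS_tilde M n w t ord0 j =
  (renewal_count (prim_rate n j) (primitive j ^~ w) t - prim_rate n j * t) / scale M n.
Proof.
rewrite /AS_tilde mxE /prim_rate /primitive.
by case: (fintype.split j) => i; rewrite mxE.
Qed.

Definition no_explosion n w := forall j, exists m, T < prim_epoch n j w m.

Lemma prim_count_right n j w : (0 < n)%N ->
  right_cont T (fun t => AS_tilde M n w t ord0 j).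
Proof.
move=> n0 t /andP[t0 tT] e e0.
have [e1 e10 H] := renewal_count_right (prim_rate_gt0 j n0) (primitive_gt0 j ^~ w) t.
have s0 := scale_gt0 n0; have r0 := prim_rate_gt0 j n0.
exists (Num.min e1 (e * scale M n / prim_rate n j)).
  by rewrite lt_min e10 divr_gt0// mulr_gt0.
move=> s ts; rewrite -ltrBlDl lt_min ltrBlDl => /andP[/(H _ ts) sE se].
rewrite !AS_tildeE sE -mulrBl.
have -> : renewal_count (prim_rate n j) ((primitive j)^~ w) t - prim_rate n j * s -
  (renewal_count (prim_rate n j) ((primitive j)^~ w) t - prim_rate n j * t) =
  - (prim_rate n j * (s - t)) by ring.
rewrite mulNr normrN ger0_norm; last first.
  by rewrite mulr_ge0 ?invr_ge0 ?(ltW s0)// mulr_ge0 ?subr_ge0// ltW.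
rewrite ler_pdivrMr//; move: se; rewrite ltr_pdivlMr// mulrC; exact: ltW.
Qed.

(** If the epochs of some sequence accumulate at [t <= T], the count equals [m] at the [m]-th epoch
    and has no finite limit from the left at [t]. Hence every J1-open or J1-closed event already
    excludes explosion. *)
Lemma rcll_AS_tilde n w : (0 < n)%N -> rcll T (I + I) (AS_tilde M n w) <-> no_explosion n w.
Proof.
move=> n0; have T0 := horizon_gt0; have s0 := scale_gt0 n0; split.
  move=> [_ rl] j; apply: contrapT => H.
  have H' m : prim_epoch n j w m <= T.
    by rewrite leNgt; apply/negP => h; apply: H; exists m.
  have r0 := prim_rate_gt0 j n0; have p0 := primitive_gt0 j ^~ w.
  pose E := range (prim_epoch n j w); pose t := sup E.
  have supE : has_sup E.
    by split; [exists (prim_epoch n j w 0); exists 0%N|exists T => _ [m _ <-]].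
  have Et m : prim_epoch n j w m < t.
    apply: lt_le_trans (epochS r0 p0 m) _; apply: ub_le_sup; first by case: supE.
    by exists m.+1.
  have t0 : 0 < t by rewrite -(epoch0 (prim_rate n j) ((primitive j)^~ w)) Et.
  have tT : t <= T by apply: ge_sup; [by case: supE|move=> _ [m _ <-]].
  have [l /row_cvg_coord-/(_ j)] := rl t (introT andP (conj t0 tT)).
  move=> /cvgrPdist_le/(_ 1 ltr01)[delta /= d0 Hd].
  have [_ [m0 _ <-] m0t] := sup_adherent d0 supE; rewrite -/t in m0t.
  pose c := scale M n * (`|l ord0 j| + 1) + prim_rate n j * T.
  have c0 : 0 <= c.
    by rewrite /c addr_ge0// mulr_ge0 ?addr_ge0// ltW.
  (* Being within 1 of the left limit at the [m]-th epoch would bound [m] itself. *)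
  have bnd m : (m0 <= m)%N -> m%:R <= c.
    move=> m0m; have em := epoch_le r0 p0 m0m.
    have := Hd (prim_epoch n j w m); rewrite /= !AS_tildeE.
    rewrite (@renewal_countE _ _ _ r0 p0 m) ?lexx ?epochS//.
    have h1 : `|t - prim_epoch n j w m| < delta.
      rewrite gtr0_norm ?subr_gt0//; move: m0t em.
      by rewrite /prim_epoch; lra.
    move=> /(_ h1 (Et m)) h2.
    have h3 : (m%:R - prim_rate n j * prim_epoch n j w m) / scale M n <= `|l ord0 j| + 1.
      have := ler_norm (l ord0 j); move: h2; rewrite ler_norml => /andP[+ _].
      by rewrite /prim_epoch; lra.
    move: h3; rewrite ler_pdivrMr// [leRHS]mulrC lerBlDr => /le_trans; apply.
    by rewrite /c lerD2l ler_wpM2l ?(ltW r0)// (le_trans (ltW (Et m))).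
  have := bnd (maxn m0 (Num.bound c)) (leq_maxl _ _).
  apply/negP; rewrite -ltNge; apply: lt_le_trans (archi_boundP c0) _.
  by rewrite ler_nat leq_maxr.
move=> ne; split.
  move=> t t0T; apply: row_cvg => j; apply/cvgrPdist_le => e e0.
  have [delta d0 Hd] := prim_count_right j w n0 t0T e0.
  exists delta => //= s /= std ts; rewrite distrC; apply: Hd; first exact: ltW.
  by move: std; rewrite distrC gtr0_norm ?subr_gt0// ltrBlDl.
move=> t /andP[t0 tT].
have /choice[l Hl] : forall j, exists l : nat, exists2 e : R, 0 < e & forall s,
    t - e < s -> s < t -> renewal_count (prim_rate n j) (primitive j ^~ w) s = l%:R.
  move=> j; have [m Tm] := ne j.
  have [||e e0 [l Hl]] := @renewal_count_left _ _ _ (prim_rate_gt0 j n0)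
    (primitive_gt0 j ^~ w) t m => //; first exact: le_trans tT (ltW Tm).
  by exists l, e.
exists (\row_j (((l j)%:R - prim_rate n j * t) / scale M n)).
apply: row_cvg => j; rewrite mxE; have [e e0 He] := Hl j.
apply: (@cvg_trans _ ((((l j)%:R - prim_rate n j * s) / scale M n) @[s --> t^'-])).
  apply: near_eq_cvg; near=> s; rewrite AS_tildeE He//.
  near: s; apply: nbhs_left_gt; rewrite ltrBlDr ltrDl//.
apply: cvgM; last exact: cvg_cst.
apply: cvgB; first exact: cvg_cst.
apply: cvgM; first exact: cvg_cst.
by apply: cvg_at_left_filter; exact: cvg_id.
Unshelve. all: by end_near. Qed.

End primitive_paths.

Section path_events.
Context {R : realType} {d : measure_display} {Omega : measurableType d}
  {P : probability Omega R} {I : nat}.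
Variable M : queue_model P I.
Hypothesis prim : renewal_primitives M.
Hypothesis mht : moderate_heavy_traffic M.
Notation T := (horizon M).
Implicit Types (n l m : nat) (w : Omega) (i : 'I_I) (j : 'I_(I + I)).

Let T_ge0 : 0 <= T. Proof. exact: ltW (horizon_gt0 mht). Qed.

Lemma measurable_AS_tilde n t j : (0 < n)%N ->
  measurable_fun setT (fun w => AS_tilde M n w t ord0 j).
Proof.
move=> n0; under eq_fun do rewrite AS_tildeE.
apply: measurable_funM => //; apply: measurable_funB => //.
apply: (renewal_count_measurable t (prim_rate_gt0 mht j n0)) => [l w|l].
  exact: primitive_gt0.
exact: measurable_primitive.
Qed.

Lemma measurable_cball n psi (e : R) : (0 < n)%N -> cpath T (I + I) psi ->
  measurable [set w | cball T psi e (AS_tilde M n w)].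
Proof.
move=> n0 cpsi; pose tq (q : rat) := clamp T (ratr q).
pose F (q : rat) := \bigcap_(j in [set: 'I_(I + I)])
  [set w | `|AS_tilde M n w (tq q) ord0 j - psi (tq q) ord0 j| <= e].
rewrite (_ : [set w | _] = ~` \bigcup_q ~` F q).
  apply: measurableC; apply: bigcupT_measurable_rat => q; apply: measurableC.
  apply: fin_bigcap_measurable => // j _; rewrite -[X in measurable X]setTI.
  apply: measurable_fun_le => //; apply: measurableT_comp => //.
  by apply: measurable_funB => //; exact: measurable_AS_tilde.
apply/seteqP; split => [w /= H [q _ /= Fq]|w /= H t t0T j].
  by apply: Fq => j _; apply: H; exact: clamp_itv.
apply: (@right_cont_closed _ T (fun t => AS_tilde M n w t ord0 j)
  (fun t => psi t ord0 j)) => //.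
- exact: prim_count_right.
- exact: unif_cont_right_cont (cpath_unif_cont j cpsi).
- move=> q; apply: contrapT => Fq; apply: H; exists q => // /(_ j Logic.I).
  exact: Fq.
Qed.

Lemma oball_bigcup psi (e : R) phi : oball T psi e phi <->
  exists m : nat, @cball R T (I + I) psi (e - m.+1%:R^-1) phi.
Proof.
split=> [[eta etae H]|[m H]]; last first.
  by exists (e - m.+1%:R^-1) => //; rewrite ltrBlDr ltrDl invr_gt0.
have ee : 0 <= (e - eta)^-1 by rewrite invr_ge0 subr_ge0 ltW.
exists (Num.bound (e - eta)^-1) => t t0T j; apply: le_trans (H t t0T j) _.
rewrite lerBrDr -lerBrDl; have := archi_boundP ee; set b := Num.bound _ => eb.
rewrite -[leRHS]invrK lef_pV2 ?posrE ?invr_gt0 ?subr_gt0//.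
by rewrite (le_trans (ltW eb))// ler_nat.
Qed.

Lemma measurable_oball n psi (e : R) : (0 < n)%N -> cpath T (I + I) psi ->
  measurable [set w | oball T psi e (AS_tilde M n w)].
Proof.
move=> n0 cpsi; rewrite (_ : [set w | _] = \bigcup_m
    [set w | cball T psi (e - m.+1%:R^-1) (AS_tilde M n w)]).
  by apply: bigcupT_measurable => m; exact: measurable_cball.
apply/seteqP; split => w /=; first by move=> /oball_bigcup[m H]; exists m.
by move=> [m _ H]; apply/oball_bigcup; exists m.
Qed.

(** Explosion before [T] means that the unscaled partial sums never exceed [T] times the rate, a
    null event for each of the [I + I] sequences by [iid_divergent]. *)
Lemma no_explosion_ae n : (0 < n)%N ->
  measurable [set w | no_explosion M n w] /\ P (~` [set w | no_explosion M n w]) = 0%E.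
Proof.
move=> n0; pose E j := [set w | forall m,
  \sum_(k < m) primitive M j k w <= T * prim_rate M n j].
have EP j : measurable (E j) /\ P (E j) = 0%E.
  apply: iid_divergent.
  - rewrite /primitive; case: prim => _ ii _ _ _.
    by case: (fintype.split j) => i; have [] := ii i.
  - exact: measurable_primitive.
  - exact: primitive_gt0.
have noE : ~` [set w | no_explosion M n w] = \bigcup_(j in [set: 'I_(I + I)]) E j.
  apply/seteqP; split => [w /= /existsNP[j H]|w [j _ H] /(_ j)[m]].
    exists j => // m; rewrite -ler_pdivrMr ?(prim_rate_gt0 mht)// leNgt.
    apply/negP => h; apply: H; exists m; move: h.
    by rewrite /prim_epoch /epoch mulr_suml.
  rewrite /prim_epoch /epoch -mulr_suml ltr_pdivlMr ?(prim_rate_gt0 mht)//.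
  by rewrite ltNge (H m).
have mE : measurable (~` [set w | no_explosion M n w]).
  by rewrite noE; apply: fin_bigcup_measurable => // j _; have [] := EP j.
split; first by rewrite -[X in measurable X]setCK; exact: measurableC.
apply: measure_negligible mE _; rewrite noE.
pose F (k : nat) := if insub k is Some j then E j else set0.
apply: (@negligibleS _ _ _ _ (\bigcup_k F k)).
  by move=> w [j _ Ej]; exists j => //; rewrite /F valK.
apply: negligible_bigcup => k; rewrite /F; case: insubP => [j _ _|_].
  by have [mEj Ej0] := EP j; exists (E j); split.
exact: negligible_set0.
Qed.

(** An enumeration of the rationals clamped to [0, T]; an index that encodes no rational gives time
    0. *)
Definition sample_time k : R := clamp T (ratr (odflt 0 (unpickle k : option rat))).

(* The supremum over a countable dense set of times, which is a measurable
   function of the outcome. *)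
Definition path_norm n w : \bar R :=
  esups (fun k => (\sum_j `|AS_tilde M n w (sample_time k) ord0 j|)%:E) 0.

Lemma measurable_path_norm n : (0 < n)%N -> measurable_fun setT (path_norm n).
Proof.
move=> n0; apply: measurable_fun_esups => k.
apply/measurable_EFinP; apply: measurable_sum => j.
by apply: measurableT_comp => //; exact: measurable_AS_tilde.
Qed.

Lemma path_norm_ge n w k :
  ((\sum_j `|AS_tilde M n w (sample_time k) ord0 j|)%:E <= path_norm n w)%E.
Proof. by apply: ereal_sup_ubound; exists k. Qed.

Lemma path_norm_ge0 n w : (0 <= path_norm n w)%E.
Proof. by apply: le_trans (path_norm_ge n w 0); rewrite lee_fin sumr_ge0. Qed.

Lemma path_norm_bound n w (c t : R) j : (0 < n)%N -> (path_norm n w <= c%:E)%E ->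
  0 <= t <= T -> `|AS_tilde M n w t ord0 j| <= c.
Proof.
move=> n0 nc t0T; rewrite -[X in `|X|]subr0.
apply: (@right_cont_closed _ T (fun t => AS_tilde M n w t ord0 j) (cst 0)) => //.
- exact: prim_count_right.
- by move=> s _ e e0; exists 1 => // u _ _; rewrite subrr normr0 ltW.
- move=> q; have := le_trans (path_norm_ge n w (pickle q)) nc.
  rewrite /sample_time pickleK /= subr0 lee_fin; apply: le_trans.
  by rewrite (bigD1 j)//= lerDl sumr_ge0.
Qed.

(** Transfers the exponential moments of [sup_norm] to the measurable [path_norm]. The factor [I]
    comes from summing [I] coordinates, each below the norm. *)
Lemma path_norm_le n w : (path_norm n w <=
  I%:R%:E * (sup_norm T (lsubmx \o AS_tilde M n w) +
             sup_norm T (rsubmx \o AS_tilde M n w)))%E.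
Proof.
apply: ge_ereal_sup => _ [k _ <-]; set t := sample_time k.
have t0T : 0 <= t <= T by exact: clamp_itv.
have sp (phi : R -> 'rV[R]_I) i : (`|phi t ord0 i|%:E <= sup_norm T phi)%E.
  exact: sup_norm_coord (lexx _) t0T.
have s0 (phi : R -> 'rV[R]_I) : (0 <= sup_norm T phi)%E.
  apply: (@le_trans _ _ (enorm (phi t))%:E); first by rewrite lee_fin sqrtr_ge0.
  by apply: ereal_sup_ubound; exists t => //=; rewrite in_itv.
rewrite big_split_ord /= EFinD ge0_muleDr//; apply: leeD.
  rewrite -sumEFin; apply: (@le_trans _ _
    (\sum_(i < I) sup_norm T (lsubmx \o AS_tilde M n w))%E).
    by apply: lee_sum => i _; have := sp (lsubmx \o AS_tilde M n w) i; rewrite /= mxE.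
  by rewrite sumr_const card_ord mule_natl.
rewrite -sumEFin; apply: (@le_trans _ _
    (\sum_(i < I) sup_norm T (rsubmx \o AS_tilde M n w))%E).
  by apply: lee_sum => i _; have := sp (rsubmx \o AS_tilde M n w) i; rewrite /= mxE.
by rewrite sumr_const card_ord mule_natl.
Qed.

Lemma path_norm_moments (K : R) : exponential_moments M -> 0 <= K -> exists c : R,
  \forall n \near \oo, (\int[P]_w expeR ((bn M n ^+ 2)%:E * (K%:E * path_norm n w)) <=
    expeR ((bn M n ^+ 2 * c)%:E))%E.
Proof.
move=> em K0; have [_ [bpos _ _] _ _ _] := mht.
(* The exponent [K * I] makes up for the factor lost in [path_norm_le]. *)
have [c Hc] : exists c : R, (limn_esup (fun n => ((bn M n ^+ 2)^-1)%:E *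
       lne (\int[P]_w expeR ((bn M n ^+ 2)%:E * ((K * I%:R)%:E *
         (sup_norm T (lsubmx \o AS_tilde M n w) +
          sup_norm T (rsubmx \o AS_tilde M n w)))))) < c%:E)%E.
  have := em (K * I%:R); set x := limn_esup _; case: x => [r|//|] _.
    by exists (r + 1); rewrite lte_fin ltrDl.
  by exists 0; rewrite ltNyr.
exists c; have := limn_esup_lt Hc; apply: filterS2 (nbhs_infty_gt 0) => n n0 H.
have b0 : 0 < bn M n ^+ 2 by rewrite exprn_gt0// bpos.
apply: (@le_trans _ _ (\int[P]_w expeR ((bn M n ^+ 2)%:E * ((K * I%:R)%:E *
         (sup_norm T (lsubmx \o AS_tilde M n w) +
          sup_norm T (rsubmx \o AS_tilde M n w)))))%E).
  apply: ge0_integral_le => w _; last exact: expeR_ge0.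
  split => //; first exact: expeR_ge0.
  rewrite lee_expeR lee_pmul2l// EFinM -muleA lee_wpmul2l ?lee_fin//.
  exact: path_norm_le.
rewrite -lne_leP; last by apply: integral_ge0 => w _; exact: expeR_ge0.
have -> : ((bn M n ^+ 2 * c)%:E = (bn M n ^+ 2)%:E * c%:E)%E by rewrite EFinM.
by rewrite -lee_pdivrMl//; exact: ltW.
Qed.

End path_events.

(** * One-dimensional Skorohod reflection *)

Section regulator.
Context {R : realType}.
Variable T : R.
Implicit Types (xi : R -> R) (s t e : R).

Definition regulator xi t : R := sup [set Num.max 0 (- xi s) | s in `[0, t]].

(* The one-dimensional Skorohod reflection of xi at 0. *)
Definition reflection xi t : R := xi t + regulator xi t.

Definition bounded_on xi (C : R) := forall t, 0 <= t <= T -> `|xi t| <= C.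

Section fixed_path.
Variables (xi : R -> R) (C : R).
Hypothesis xiC : bounded_on xi C.

Let reg_has_sup t : 0 <= t <= T -> has_sup [set Num.max 0 (- xi s) | s in `[0, t]].
Proof.
move=> /andP[t0 tT]; split; first by exists (Num.max 0 (- xi 0)), 0; rewrite //= in_itv /= lexx.
exists (Num.max 0 C) => _ [s /= + <-]; rewrite in_itv /= => /andP[s0 st].
rewrite ge_max !le_max lexx /=; apply/orP; right; apply: le_trans (ler_norm _) _.
by rewrite normrN xiC// s0 (le_trans st).
Qed.

Lemma regulator_ub s t : 0 <= s -> s <= t -> t <= T -> - xi s <= regulator xi t.
Proof.
move=> s0 st tT; apply: (@le_trans _ _ (Num.max 0 (- xi s))).
  by rewrite le_max lexx orbT.
apply: ub_le_sup; first by case: (@reg_has_sup t) => //; rewrite (le_trans s0).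
by exists s => //=; rewrite in_itv /= s0.
Qed.

Lemma regulator_ge0 t : 0 <= t <= T -> 0 <= regulator xi t.
Proof.
move=> t0T; apply: (@le_trans _ _ (Num.max 0 (- xi 0))); first by rewrite le_max lexx.
apply: ub_le_sup; first by case: (reg_has_sup t0T).
by exists 0 => //=; rewrite in_itv /= lexx; case/andP: t0T.
Qed.

Lemma regulator_le t (c : R) : 0 <= t -> 0 <= c ->
  (forall s, 0 <= s -> s <= t -> - xi s <= c) -> regulator xi t <= c.
Proof.
move=> t0 c0 H; apply: ge_sup.
  by exists (Num.max 0 (- xi 0)), 0; rewrite //= in_itv /= lexx.
move=> _ [s /= + <-]; rewrite in_itv /= => /andP[s0 st].
by rewrite ge_max c0 H.
Qed.

Lemma regulator_nd s t : 0 <= s -> s <= t -> t <= T -> regulator xi s <= regulator xi t.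
Proof.
move=> s0 st tT; apply: regulator_le => //.
  by rewrite regulator_ge0// (le_trans s0).
by move=> u u0 us; apply: regulator_ub => //; exact: le_trans st.
Qed.

Lemma reflection_ge0 t : 0 <= t <= T -> 0 <= reflection xi t.
Proof.
move=> /andP[t0 tT]; have := regulator_ub t0 (lexx t) tT.
by rewrite /reflection; lra.
Qed.

Lemma reflection_le t : 0 <= C -> 0 <= t <= T -> reflection xi t <= 2 * C.
Proof.
move=> C0 /andP[t0 tT]; have h1 : regulator xi t <= C.
  apply: regulator_le => // s s0 st; apply: le_trans (ler_norm _) _.
  by rewrite normrN xiC// s0 (le_trans st).
have := ler_norm (xi t); have := xiC (introT andP (conj t0 tT)).
by rewrite /reflection; lra.
Qed.

Lemma regulator_unif_cont : unif_cont T xi -> unif_cont T (regulator xi).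
Proof.
move=> uxi e e0; have [delta d0 H] := uxi e e0; exists delta => //.
suff one s t : 0 <= s -> s <= t -> t <= T -> t - s <= delta ->
    `|regulator xi t - regulator xi s| <= e.
  move=> s t /andP[s0 sT] /andP[t0 tT] st; have [sle|/ltW tle] := leP s t.
    rewrite distrC; apply: one => //; apply: le_trans st.
    by rewrite distrC ger0_norm// subr_ge0.
  by apply: one => //; apply: le_trans st; rewrite ger0_norm// subr_ge0.
move=> s0 st tT std; rewrite ger0_norm ?subr_ge0 ?regulator_nd// lerBlDr.
have r0 : 0 <= regulator xi s by rewrite regulator_ge0// s0 (le_trans st).
apply: regulator_le; [exact: le_trans st|by rewrite addr_ge0// ltW|].
move=> u u0 ut; have [us|/ltW su] := leP u s.
  by have := regulator_ub u0 us (le_trans st tT); move: e0; lra.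
have := regulator_ub s0 (lexx s) (le_trans st tT).
have := H u s; rewrite u0 s0 (le_trans ut tT) (le_trans st tT) => /(_ isT isT).
rewrite ger0_norm ?subr_ge0// => /(_ (le_trans (lerB ut (lexx s)) std)).
by rewrite ler_norml => /andP[+ _]; lra.
Qed.

End fixed_path.

(** The path and its regulator each contribute one [e]. *)
Lemma reflection_lip xi xi' (C C' e : R) t : bounded_on xi C -> bounded_on xi' C' ->
  (forall s, 0 <= s <= T -> `|xi s - xi' s| <= e) -> 0 <= t <= T ->
  `|reflection xi t - reflection xi' t| <= 2 * e.
Proof.
move=> bx bx' H t0T; have /andP[t0 tT] := t0T.
have e0 : 0 <= e by apply: le_trans (H t t0T).
have one (f g : R -> R) (D : R) : bounded_on g D ->
    (forall s, 0 <= s <= T -> `|f s - g s| <= e) ->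
    regulator f t <= regulator g t + e.
  move=> bg fg; apply: regulator_le => //; first by rewrite addr_ge0// (regulator_ge0 bg).
  move=> s s0 st; have := regulator_ub bg s0 st tT.
  have := fg s; rewrite s0 (le_trans st tT) ler_norml => /(_ isT) /andP[+ _].
  by lra.
have h1 := one _ _ _ bx' H.
have h2 : regulator xi' t <= regulator xi t + e.
  by apply: (one _ _ _ bx) => s s0T; rewrite distrC H.
have := H t t0T; rewrite !ler_norml /reflection => /andP[a b].
by apply/andP; split; lra.
Qed.

End regulator.

(** * Pathwise estimates for the scaled workload *)

Section fluid.
Context {R : realType} {I : nat}.
Variables (T : R) (lam mu dlam dmu x0 : 'I_I -> R).
Hypothesis T0 : 0 < T.
Hypotheses (lam0 : forall i, 0 < lam i) (mu0 : forall i, 0 < mu i).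
Hypothesis critical : \sum_i lam i / mu i = 1.
Implicit Types (i : 'I_I) (t u v e r : R).

Definition weighted (v : 'I_I -> R) : R := \sum_i (mu i)^-1 * v i.

Lemma weightedD (v w : 'I_I -> R) :
  weighted (fun i => v i + w i) = weighted v + weighted w.
Proof. by rewrite /weighted -big_split; apply: eq_bigr => i _; rewrite mulrDr. Qed.

Lemma weightedB (v w : 'I_I -> R) :
  weighted (fun i => v i - w i) = weighted v - weighted w.
Proof. by rewrite /weighted -sumrB; apply: eq_bigr => i _; rewrite mulrBr. Qed.

Definition weight_sum : R := \sum_i (mu i)^-1.

Lemma muV_ge0 i : 0 <= (mu i)^-1. Proof. by rewrite invr_ge0 ltW. Qed.

Lemma weight_sum_ge0 : 0 <= weight_sum.
Proof. by apply: sumr_ge0 => i _; exact: muV_ge0. Qed.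

Lemma muV_le i : (mu i)^-1 <= weight_sum.
Proof. by rewrite /weight_sum (bigD1 i)//= lerDl sumr_ge0// => j _; exact: muV_ge0. Qed.

Lemma weighted_norm (v : 'I_I -> R) (c : R) : (forall i, `|v i| <= c) ->
  `|weighted v| <= weight_sum * c.
Proof.
move=> vc; apply: le_trans (ler_norm_sum _ _ _) _; rewrite /weight_sum mulr_suml.
apply: ler_sum => i _; rewrite normrM (ger0_norm (muV_ge0 i)).
exact: ler_wpM2l (muV_ge0 i) _ _ (vc i).
Qed.

Lemma weighted_ge (v : 'I_I -> R) j : (forall i, 0 <= v i) ->
  (mu j)^-1 * v j <= weighted v.
Proof.
move=> v0; rewrite /weighted (bigD1 j)//= lerDl sumr_ge0// => i _.
by rewrite mulr_ge0// muV_ge0.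
Qed.

Lemma ratio_ge0 i : 0 <= lam i / mu i. Proof. by rewrite divr_ge0// ltW. Qed.

Lemma ratio_le1 i : lam i / mu i <= 1.
Proof.
by rewrite -critical (bigD1 i)//= lerDl sumr_ge0// => j _; exact: ratio_ge0.
Qed.

Lemma ratio_itv i t : 0 <= t <= T -> 0 <= lam i / mu i * t <= T.
Proof.
move=> /andP[t0 tT]; rewrite mulr_ge0 ?ratio_ge0//=.
by apply: le_trans tT; rewrite ler_piMl// ratio_le1.
Qed.

Variables (p1 p2 : 'I_I -> R -> R) (C : R).
Hypotheses (u1 : forall i, unif_cont T (p1 i)) (u2 : forall i, unif_cont T (p2 i)).
Hypotheses (b1 : forall i, bounded_on T (p1 i) C) (b2 : forall i, bounded_on T (p2 i) C).

(** The limiting workload with zero idleness and service effort exactly [lam i / mu i * t]; its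
    reflection is the minimal workload. *)
Definition free_workload t : R := weighted (fun i =>
  x0 i + t * (dlam i - lam i / mu i * dmu i) + p1 i t - p2 i (lam i / mu i * t)).

(* The deterministic content of one sample path: r is the speed n / scale, a
   and s are the centered arrival and service noises, Tt the cumulated service
   effort and X the scaled queue lengths; delta is the distance to the limit data. *)
Definition prelimit (delta r : R) (xn dl dm : 'I_I -> R) (a s Tt X : 'I_I -> R -> R) :=
  [/\ forall i, [/\ `|xn i - x0 i| <= delta, `|dl i - dlam i| <= delta &
        `|dm i - dmu i| <= delta],
      forall i t, 0 <= t <= T -> `|a i t - p1 i t| <= delta /\ `|s i t - p2 i t| <= delta,
      [/\ forall i, Tt i 0 = 0,
        forall i t u, 0 <= t -> t <= u -> u <= T -> Tt i t <= Tt i u &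
        forall t u, 0 <= t -> t <= u -> u <= T -> \sum_i (Tt i u - Tt i t) <= u - t],
      forall i t, 0 <= t <= T -> X i t = xn i + a i t - s i (Tt i t) +
        r * (lam i * t - mu i * Tt i t) + dl i * t - dm i * Tt i t &
      forall i t, 0 <= t <= T -> 0 <= X i t].

Definition workload (X : 'I_I -> R -> R) t := weighted (X ^~ t).
Definition idleness r (Tt : 'I_I -> R -> R) t : R := r * (t - \sum_i Tt i t).

Definition data_sum : R := \sum_i (`|x0 i| + `|dlam i| + `|dmu i|).
(** Sums the bounds on the terms of [noise] when [delta <= 1]: [data_sum + 1] for the initial queue,
    [C + 1] for each centered process, and [(data_sum + 1) * T] for each of the two drift terms. *)
Definition noise_bound : R := data_sum + 1 + 2 * C + 2 + 2 * (data_sum + 1) * T.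

Lemma data_sum_ge i : `|x0 i| + `|dlam i| + `|dmu i| <= data_sum.
Proof. by rewrite /data_sum (bigD1 i)//= lerDl sumr_ge0// => j _; rewrite !addr_ge0. Qed.

Lemma data_sum_ge0 : 0 <= data_sum.
Proof. by apply: sumr_ge0 => i _; rewrite !addr_ge0. Qed.

Section prelimit_facts.
Variables (delta r : R) (xn dl dm : 'I_I -> R) (a s Tt X : 'I_I -> R -> R).
Hypothesis pre : prelimit delta r xn dl dm a s Tt X.
Hypothesis delta1 : delta <= 1.

Definition noise i t := xn i + a i t - s i (Tt i t) + dl i * t - dm i * Tt i t.

Lemma busy_itv i t : 0 <= t <= T -> 0 <= Tt i t <= t.
Proof.
move=> /andP[t0 tT]; case: pre => _ _ [Tt0 nd sm] _ _.
have h0 := nd i 0 t (lexx 0) t0 tT; rewrite Tt0 in h0; rewrite h0 /=.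
have := sm 0 t (lexx 0) t0 tT; rewrite subr0; apply: le_trans.
rewrite (bigD1 i)//= Tt0 subr0 lerDl sumr_ge0// => j _.
by rewrite subr_ge0 nd.
Qed.

Lemma idleness_nd t u : 0 <= r -> 0 <= t -> t <= u -> u <= T ->
  idleness r Tt t <= idleness r Tt u.
Proof.
move=> r0 t0 tu uT; case: pre => _ _ [_ _ sm] _ _.
by have := sm t u t0 tu uT; rewrite sumrB /idleness => ?; apply: ler_wpM2l => //; lra.
Qed.

Lemma idleness0 : idleness r Tt 0 = 0.
Proof.
case: pre => _ _ [Tt0 _ _] _ _; by rewrite /idleness big1 ?subr0 ?mulr0.
Qed.

Lemma queueE i t : 0 <= t <= T -> X i t = noise i t + r * (lam i * t - mu i * Tt i t).
Proof. by move=> t0T; case: pre => _ _ _ -> //= _; rewrite /noise; ring. Qed.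

(** The fast drift carries the factor [r]; weighting class [i] by [1 / mu i] and using the critical
    load collapses it to the single idleness term. *)
Lemma workloadE t : 0 <= t <= T ->
  workload X t = weighted (noise ^~ t) + idleness r Tt t.
Proof.
move=> t0T; rewrite /workload.
have -> : weighted (X ^~ t) =
    weighted (fun i => noise i t + r * (lam i * t - mu i * Tt i t)).
  by apply: eq_bigr => i _; rewrite queueE.
rewrite weightedD; congr (_ + _); rewrite /idleness /weighted.
rewrite -[X in X - \sum_i Tt i t]mul1r -critical mulr_suml -sumrB mulr_sumr.
by apply: eq_bigr => i _; have := mu0 i; move=> /lt0r_neq0 mi; field.
Qed.

Lemma noise_le i t : 0 <= t <= T -> `|noise i t| <= noise_bound.
Proof.
move=> t0T; have /andP[t0 tT] := t0T; have /andP[h0 ht] := busy_itv i t0T.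
have hT : 0 <= Tt i t <= T by rewrite h0 (le_trans ht).
case: pre => /(_ i)[c1 c2 c3] /(_ i) cl _ _ _.
have [ca _] := cl t t0T; have [_ cs] := cl (Tt i t) hT.
have B1 := b1 i t0T; have B2 := b2 i hT; have dg := data_sum_ge i.
have n1 := normr_ge0 (x0 i); have n2 := normr_ge0 (dlam i); have n3 := normr_ge0 (dmu i).
have hl : `|dl i * t| <= (data_sum + 1) * T.
  rewrite normrM (ger0_norm t0) ler_pM//.
  have := ler_normD (dl i - dlam i) (dlam i); rewrite subrK.
  by move: c2 delta1; lra.
have hm : `|dm i * Tt i t| <= (data_sum + 1) * T.
  rewrite normrM (ger0_norm h0) ler_pM//; last exact: le_trans ht tT.
  have := ler_normD (dm i - dmu i) (dmu i); rewrite subrK.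
  by move: c3 delta1; lra.
have hx : `|xn i| <= data_sum + 1.
  have := ler_normD (xn i - x0 i) (x0 i); rewrite subrK.
  by move: c1 delta1; lra.
have ha : `|a i t| <= C + 1.
  have := ler_normD (a i t - p1 i t) (p1 i t); rewrite subrK.
  by move: ca B1 delta1; lra.
have hs : `|s i (Tt i t)| <= C + 1.
  have := ler_normD (s i (Tt i t) - p2 i (Tt i t)) (p2 i (Tt i t)); rewrite subrK.
  by move: cs B2 delta1; lra.
move: hl hm hx ha hs; rewrite /noise /noise_bound !ler_norml.
move=> /andP[? ?] /andP[? ?] /andP[? ?] /andP[? ?] /andP[? ?].
by apply/andP; split; lra.
Qed.

(** [delta] is paid three times, for the initial queue and the two centered processes, and
    [delta * T] twice, for the drifts; [omega] and [data_sum * kappa] account for the effort being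
    [Tt i t] instead of [lam i / mu i * t]. *)
Lemma noise_error i t (kappa omega : R) : 0 <= t <= T ->
  `|Tt i t - lam i / mu i * t| <= kappa ->
  (forall u v, 0 <= u <= T -> 0 <= v <= T -> `|u - v| <= kappa ->
     `|p2 i u - p2 i v| <= omega) ->
  `|noise i t - (x0 i + t * (dlam i - lam i / mu i * dmu i) + p1 i t -
      p2 i (lam i / mu i * t))| <= 3 * delta + 2 * delta * T + omega + data_sum * kappa.
Proof.
move=> t0T hk ho; have /andP[t0 tT] := t0T; have /andP[h0 ht] := busy_itv i t0T.
have hT : 0 <= Tt i t <= T by rewrite h0 (le_trans ht).
case: pre => /(_ i)[c1 c2 c3] /(_ i) cl _ _ _.
have [ca _] := cl t t0T; have [_ cs] := cl (Tt i t) hT.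
have cp := ho _ _ hT (ratio_itv i t0T) hk.
have d0 : 0 <= delta by apply: le_trans c1.
have hl : `|(dl i - dlam i) * t| <= delta * T by rewrite normrM (ger0_norm t0) ler_pM.
have hm : `|(dm i - dmu i) * Tt i t| <= delta * T.
  by rewrite normrM (ger0_norm h0) ler_pM// (le_trans ht).
have hd : `|dmu i * (Tt i t - lam i / mu i * t)| <= data_sum * kappa.
  rewrite normrM ler_pM//; have := data_sum_ge i.
  by have := normr_ge0 (x0 i); have := normr_ge0 (dlam i); lra.
have -> : noise i t - (x0 i + t * (dlam i - lam i / mu i * dmu i) + p1 i t -
      p2 i (lam i / mu i * t)) = (xn i - x0 i) + (a i t - p1 i t) -
   (s i (Tt i t) - p2 i (Tt i t)) - (p2 i (Tt i t) - p2 i (lam i / mu i * t)) +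
   (dl i - dlam i) * t - (dm i - dmu i) * Tt i t - dmu i * (Tt i t - lam i / mu i * t).
  by rewrite /noise; ring.
move: c1 ca cs cp hl hm hd; rewrite !ler_norml.
move=> /andP[? ?] /andP[? ?] /andP[? ?] /andP[? ?] /andP[? ?] /andP[? ?] /andP[? ?].
by apply/andP; split; lra.
Qed.

(** The effort [Tt i] is 1-Lipschitz, so the modulus of [p2 i] over a lag [t - v] also controls the
    increment of the service noise. *)
Lemma noise_diff i v t (omega : R) : 0 <= v -> v <= t -> t <= T ->
  `|p1 i t - p1 i v| <= omega ->
  (forall x y, 0 <= x <= T -> 0 <= y <= T -> `|x - y| <= t - v ->
     `|p2 i x - p2 i y| <= omega) ->
  `|noise i t - noise i v| <= 4 * delta + 2 * omega + 2 * (data_sum + 1) * (t - v).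
Proof.
move=> v0 vt tT h1 h2; have t0T : 0 <= t <= T by rewrite (le_trans v0).
have v0T : 0 <= v <= T by rewrite v0 (le_trans vt).
have /andP[ht0 ht] := busy_itv i t0T; have /andP[hv0 hv] := busy_itv i v0T.
have htT : 0 <= Tt i t <= T by rewrite ht0 (le_trans ht).
have hvT : 0 <= Tt i v <= T by rewrite hv0 (le_trans hv)// (le_trans vt).
case: pre => /(_ i)[c1 c2 c3] /(_ i) cl [_ nd sm] _ _.
have [cat _] := cl t t0T; have [cav _] := cl v v0T.
have [_ cst] := cl _ htT; have [_ csv] := cl _ hvT.
have inc0 := nd i v t v0 vt tT.
have inc : Tt i t - Tt i v <= t - v.
  apply: le_trans (sm v t v0 vt tT); rewrite (bigD1 i)//= lerDl sumr_ge0// => j _.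
  by rewrite subr_ge0 nd.
have h3 : `|p2 i (Tt i t) - p2 i (Tt i v)| <= omega.
  by apply: h2 => //; rewrite ger0_norm// subr_ge0.
have dg := data_sum_ge i.
have n1 := normr_ge0 (x0 i); have n2 := normr_ge0 (dlam i); have n3 := normr_ge0 (dmu i).
have hl : `|dl i * (t - v)| <= (data_sum + 1) * (t - v).
  rewrite normrM (@ger0_norm _ (t - v)) ?subr_ge0// ler_wpM2r ?subr_ge0//.
  have := ler_normD (dl i - dlam i) (dlam i); rewrite subrK.
  by move: c2 delta1; lra.
have hm : `|dm i * (Tt i t - Tt i v)| <= (data_sum + 1) * (t - v).
  rewrite normrM (@ger0_norm _ (Tt i t - Tt i v)) ?subr_ge0// ler_pM ?subr_ge0//.
  have := ler_normD (dm i - dmu i) (dmu i); rewrite subrK.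
  by move: c3 delta1; lra.
have -> : noise i t - noise i v = (a i t - p1 i t) - (a i v - p1 i v) +
   (p1 i t - p1 i v) - (s i (Tt i t) - p2 i (Tt i t)) + (s i (Tt i v) - p2 i (Tt i v)) -
   (p2 i (Tt i t) - p2 i (Tt i v)) + dl i * (t - v) - dm i * (Tt i t - Tt i v).
  by rewrite /noise; ring.
move: cat cav cst csv h1 h3 hl hm; rewrite !ler_norml.
move=> /andP[? ?] /andP[? ?] /andP[? ?] /andP[? ?] /andP[? ?] /andP[? ?] /andP[? ?]
  /andP[? ?].
by apply/andP; split; lra.
Qed.

Lemma free_workload_le t : 0 <= t <= T -> `|free_workload t| <= weight_sum * noise_bound.
Proof.
move=> t0T; have /andP[t0 tT] := t0T.
apply: weighted_norm => i; have dg := data_sum_ge i.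
have n1 := normr_ge0 (x0 i); have n2 := normr_ge0 (dlam i); have n3 := normr_ge0 (dmu i).
have B1 := b1 i t0T; have B2 := b2 i (ratio_itv i t0T).
have hd : `|t * (dlam i - lam i / mu i * dmu i)| <= T * data_sum.
  rewrite normrM (ger0_norm t0) ler_pM//; apply: le_trans (ler_normB _ _) _.
  have : `|lam i / mu i * dmu i| <= `|dmu i|.
    by rewrite normrM (ger0_norm (ratio_ge0 i)) ler_piMl// ratio_le1.
  by lra.
have D0 := data_sum_ge0; have T0' := ltW T0.
have DT : 0 <= data_sum * T by exact: mulr_ge0.
have xd : `|x0 i| <= data_sum by lra.
move: B1 B2 hd xd; rewrite /noise_bound !ler_norml.
move=> /andP[? ?] /andP[? ?] /andP[? ?] /andP[? ?].
by apply/andP; split; lra.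
Qed.

Lemma workload_error t : 0 <= t <= T ->
  `|workload X t - idleness r Tt t - free_workload t| <= 2 * (weight_sum * noise_bound).
Proof.
move=> t0T; rewrite workloadE// addrK; apply: le_trans (ler_normB _ _) _.
have := free_workload_le t0T.
by have := weighted_norm (fun i => noise_le i t0T); lra.
Qed.

End prelimit_facts.

Lemma bound_ge0 : 0 <= weight_sum * noise_bound.
Proof.
have [j _|] := pickP 'I_I; last first.
  by move=> no; rewrite /weight_sum big1 ?mul0r// => i _; have := no i.
have D0 := data_sum_ge0; apply: mulr_ge0; first exact: weight_sum_ge0.
have z : 0 <= (0 : R) <= T by rewrite lexx ltW.
have := mulr_ge0 D0 (ltW T0); have := normr_ge0 (p1 j 0); move: T0 D0 (b1 j z).
by rewrite /noise_bound; lra.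
Qed.

(* While the workload stays below Mb each queue does, hence r large forces
   Tt i t to be close to lam i / mu i * t. *)
Lemma workload_dichotomy e (Mb : R) : 0 < e -> exists delta r0 : R,
  [/\ 0 < delta, delta <= 1, 0 < r0 & forall delta' r xn dl dm a s Tt X,
    delta' <= delta -> r0 <= r -> prelimit delta' r xn dl dm a s Tt X ->
    forall t, 0 <= t <= T ->
    `|workload X t - idleness r Tt t - free_workload t| <= e \/ Mb <= workload X t].
Proof.
move=> e0; have W0 := weight_sum_ge0; have D0 := data_sum_ge0.
(* Each class may err by [3 * e']; after weighting the total stays below [e]. *)
pose e' := e / (4 * (weight_sum + 1)).
have e'0 : 0 < e' by rewrite divr_gt0// mulr_gt0// ltr_wpDl.
have /choice[kap Hk] : forall i, exists kap : R, 0 < kap /\ forall u v, 0 <= u <= T ->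
    0 <= v <= T -> `|u - v| <= kap -> `|p2 i u - p2 i v| <= e'.
  by move=> i; have [k k0 H] := u2 i e'0; exists k.
pose kappa := \big[Num.min/(e' / (data_sum + 1))]_i kap i.
have kappa0 : 0 < kappa.
  apply/bigmin_gtP; split; first by rewrite divr_gt0// ltr_wpDl.
  by move=> i _; have [] := Hk i.
have kD : data_sum * kappa <= e'.
  apply: (@le_trans _ _ (data_sum * (e' / (data_sum + 1)))).
    by rewrite ler_wpM2l// bigmin_le_id.
  rewrite mulrCA ler_piMr ?(ltW e'0)// ler_pdivrMr ?ltr_wpDl// mul1r lerDl//.
pose delta := Num.min 1 (e' / (3 + 2 * T)).
have T3 : 0 < 3 + 2 * T by have := T0; lra.
have delta0 : 0 < delta by rewrite lt_min ltr01 divr_gt0.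
have K0 := bound_ge0.
(* Chosen so that a deviation [kappa] of the effort, magnified by the speed, outweighs both the
   noise and [Mb]. *)
pose r0 := (weight_sum * noise_bound + `|Mb| + 1) / kappa.
exists delta, r0; split => //.
- by rewrite ge_min lexx.
- by rewrite divr_gt0// ltr_wpDl// addr_ge0.
move=> delta' r xn dl dm a s Tt X dd rr0 pre t t0T.
have d1 : delta' <= 1 by apply: le_trans dd _; rewrite ge_min lexx.
have rk : weight_sum * noise_bound + `|Mb| + 1 <= r * kappa.
  by rewrite -ler_pdivrMr.
have [all|] := pselect (forall i, `|Tt i t - lam i / mu i * t| <= kappa).
  left; rewrite (workloadE pre)// addrK /free_workload -weightedB.
  have d3 : 3 * delta' + 2 * delta' * T <= e'.
    have -> : 3 * delta' + 2 * delta' * T = delta' * (3 + 2 * T) by ring.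
    by rewrite -ler_pdivlMr//; apply: le_trans dd _; rewrite ge_min lexx orbT.
  apply: le_trans (weighted_norm (c := 3 * e') _) _.
    move=> i; have [_ Hki] := Hk i.
    apply: le_trans (noise_error pre t0T (all i) _) _.
      move=> u v u0T v0T uv; apply: Hki => //; apply: le_trans uv _.
      exact: bigmin_le_cond.
    by move: d3 kD; lra.
  have -> : e = 4 * (weight_sum + 1) * e'.
    by rewrite /e'; field; rewrite lt0r_neq0// ltr_wpDl.
  have := mulr_ge0 W0 (ltW e'0); move: e'0.
  by rewrite mulrDr mulrDl; lra.
move=> /existsNP[i /negP]; rewrite -ltNge => hi; right.
have nb := noise_le pre d1 i t0T.
have X0 : forall j, 0 <= X j t by move=> j; case: pre => _ _ _ _; exact.
apply: le_trans (weighted_ge i X0); rewrite (queueE pre i t0T).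
have nmu : (mu i)^-1 * `|noise xn dl dm a s Tt i t| <= weight_sum * noise_bound.
  by apply: ler_pM => //; [exact: muV_ge0|exact: muV_le].
have mui := lt0r_neq0 (mu0 i).
have eqq : (mu i)^-1 * (noise xn dl dm a s Tt i t + r * (lam i * t - mu i * Tt i t)) =
    (mu i)^-1 * noise xn dl dm a s Tt i t - r * (Tt i t - lam i / mu i * t).
  by field.
have r0' : 0 < r by apply: lt_le_trans rr0; rewrite divr_gt0// ltr_wpDl// addr_ge0.
have nmu' : `|(mu i)^-1 * noise xn dl dm a s Tt i t| <= weight_sum * noise_bound.
  by rewrite normrM (ger0_norm (muV_ge0 i)).
have := ler_norm Mb; have := normr_ge0 Mb; rewrite eqq.
(* Service in excess by [kappa] would make queue [i] negative, a contradiction; service in default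
   by [kappa] makes this queue alone push the workload above [Mb]. *)
have [pos|neg] := lerP 0 (Tt i t - lam i / mu i * t).
  have : 0 <= (mu i)^-1 * X i t by rewrite mulr_ge0 ?muV_ge0.
  rewrite (queueE pre i t0T) eqq; rewrite ger0_norm// in hi.
  have : r * kappa <= r * (Tt i t - lam i / mu i * t) by rewrite ler_pM2l// ltW.
  by move: nmu'; rewrite ler_norml => /andP[_]; move: rk; lra.
rewrite ltr0_norm// in hi.
have : r * kappa <= r * (- (Tt i t - lam i / mu i * t)) by rewrite ler_pM2l// ltW.
by rewrite mulrN; move: nmu'; rewrite ler_norml => /andP[+ _]; move: rk; lra.
Qed.

Lemma free_workload_bounded : bounded_on T free_workload (weight_sum * noise_bound).
Proof. by move=> t; exact: free_workload_le. Qed.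

(** At a time [u <= t] where the workload is close to its prediction, nonnegativity gives
    [- free_workload u <= idleness u + e / 4]. Idleness is nondecreasing, so its value at [t]
    dominates the regulator up to the error. *)
Lemma fluid_lower e : 0 < e -> exists delta r0 : R,
  [/\ 0 < delta, 0 < r0 & forall delta' r xn dl dm a s Tt X,
    delta' <= delta -> r0 <= r -> prelimit delta' r xn dl dm a s Tt X ->
    forall t, 0 <= t <= T -> reflection free_workload t <= workload X t + e].
Proof.
move=> e0; set K := weight_sum * noise_bound; have K0 : 0 <= K := bound_ge0.
have e40 : 0 < e / 4 by rewrite divr_gt0.
(* With [K] bounding the free workload and [2 * K] the crude error, a workload of [4 * K + e] at [u]
   forces idleness at least [K + e], more than [- free_workload u]; at time [t] itself such a
   workload already exceeds the reflection. *)
have [delta [r0 [d0 d1 r00 H]]] := workload_dichotomy (4 * K + e) e40.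
exists delta, r0; split => // delta' r xn dl dm a s Tt X dd rr pre t t0T.
have {}H := H _ _ _ _ _ _ _ _ _ dd rr pre.
have r_ge0 : 0 <= r by apply: le_trans rr; exact: ltW.
have /andP[t0 tT] := t0T; have d1' := le_trans dd d1.
have X0 u : 0 <= u <= T -> 0 <= workload X u.
  move=> u0T; apply: sumr_ge0 => i _; rewrite mulr_ge0 ?muV_ge0//.
  by case: pre => _ _ _ _; exact.
have bx := free_workload_bounded.
have xt := bx t t0T; rewrite -/K ler_norml in xt; case/andP: xt => xt1 xt2.
rewrite /reflection addrC -lerBrDr.
suff : regulator free_workload t <= workload X t + e - free_workload t by [].
have [big|small] := leP (4 * K + e) (workload X t).
  apply: regulator_le => //; first by lra.
  move=> u u0 ut; have := bx u; rewrite u0 (le_trans ut tT) => /(_ isT).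
  by rewrite -/K ler_norml => /andP[+ _]; lra.
have Et : `|workload X t - idleness r Tt t - free_workload t| <= e / 4.
  by have [//|h] := H t t0T; move: small h; lra.
move: Et; rewrite ler_norml => /andP[E1 E2].
have L0 : 0 <= idleness r Tt t.
  by rewrite -(idleness0 pre) (idleness_nd pre).
apply: regulator_le => //; first by lra.
move=> u u0 ut; have u0T : 0 <= u <= T by rewrite u0 (le_trans ut tT).
have Lu := idleness_nd pre r_ge0 u0 ut tT.
have [Eu|big] := H u u0T.
  by move: Eu; rewrite ler_norml => /andP[? ?]; have := X0 u u0T; lra.
have := workload_error pre d1' u0T; have := bx u u0T; rewrite -/K !ler_norml.
by move=> /andP[? ?] /andP[? ?]; lra.
Qed.

(** * Upper bound on the workload and tracking of the minimizing curve *)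

Section tracking.
Variables (f : R -> 'I_I -> R).
Hypothesis f0 : forall w i, 0 <= w -> 0 <= f w i.
Hypothesis fw : forall w, 0 <= w -> weighted (f w) = w.
Hypothesis fc : forall (D : R) i, unif_cont D (f ^~ i).

(** Idleness accrues only while the system is empty: unless it is still negligible at [t], its value
    there was reached, up to [eta], by a time of zero workload. *)
Definition work_conserving r (Tt X : 'I_I -> R -> R) := forall t eta,
  0 <= t <= T -> 0 < eta -> idleness r Tt t <= eta \/ exists u,
  [/\ 0 <= u, u <= t, workload X u = 0 & idleness r Tt t <= idleness r Tt u + eta].

(* A class that receives service in [u, t] is at or above the target curve at
   (nearly) the last moment of service. *)
Definition curve_tracking (Tt X : 'I_I -> R -> R) := forall u t i eta,
  0 <= u -> u <= t -> t <= T -> 0 < eta -> Tt i t = Tt i u \/ exists v,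
  [/\ u <= v, v <= t, f (workload X v) i <= X i v & Tt i t - Tt i v <= eta].

(** At the last empty time [u] the idleness equals [- free_workload u] up to error, and the
    regulator dominates the latter. *)
Lemma fluid_workload_upper e : 0 < e -> exists delta r0 : R,
  [/\ 0 < delta, 0 < r0 & forall delta' r xn dl dm a s Tt X,
    delta' <= delta -> r0 <= r -> prelimit delta' r xn dl dm a s Tt X ->
    work_conserving r Tt X ->
    forall t, 0 <= t <= T -> workload X t <= reflection free_workload t + e].
Proof.
move=> e0; set K := weight_sum * noise_bound; have K0 : 0 <= K := bound_ge0.
have e40 : 0 < e / 4 by rewrite divr_gt0.
(* At an empty time the crude bounds give idleness at most [3 * K], so idleness never exceeds
   [3 * K + 1] and the workload never exceeds [6 * K + 1]; the threshold [8 * K + 2] excludes the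
   large alternative. *)
have [delta [r0 [d0 d1 r00 H]]] := workload_dichotomy (8 * K + 2) e40.
exists delta, r0; split => // delta' r xn dl dm a s Tt X dd rr pre wc t t0T.
have d1' := le_trans dd d1; have bx := free_workload_bounded.
have EK u : 0 <= u <= T -> idleness r Tt u <= 3 * K + 1.
  move=> u0T; have [|[v [v0 vu Wv Lv]]] := wc u 1 u0T ltr01; first by lra.
  have v0T : 0 <= v <= T by rewrite v0 (le_trans vu); case/andP: u0T.
  have := workload_error pre d1' v0T; have := bx v v0T; rewrite -/K !ler_norml Wv.
  by move=> /andP[? ?] /andP[? ?]; lra.
have Ee u : 0 <= u <= T ->
    `|workload X u - idleness r Tt u - free_workload u| <= e / 4.
  move=> u0T; have [//|big] := H _ _ _ _ _ _ _ _ _ dd rr pre u u0T.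
  have := workload_error pre d1' u0T; have := bx u u0T; have := EK u u0T.
  by rewrite -/K !ler_norml => ? /andP[? ?] /andP[? ?]; exfalso; move: K0; lra.
have /andP[t0 tT] := t0T; have := Ee t t0T; rewrite ler_norml => /andP[_ Et].
have g0 := regulator_ge0 bx t0T; rewrite /reflection.
have [|[u [u0 ut Wu Lu]]] := wc t (e / 4) t0T e40; first by lra.
have u0T : 0 <= u <= T by rewrite u0 (le_trans ut).
have := Ee u u0T; rewrite ler_norml Wu => /andP[+ _].
by have := regulator_ub bx u0 ut tT; lra.
Qed.

Lemma free_workload_unif_cont : unif_cont T free_workload.
Proof.
move=> e e0; have W0 := weight_sum_ge0; have D0 := data_sum_ge0.
pose e' := e / (3 * (weight_sum + 1)).
have e'0 : 0 < e' by rewrite divr_gt0// mulr_gt0// ltr_wpDl.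
have /choice[kap Hk] : forall i, exists kap : R, 0 < kap /\ forall u v, 0 <= u <= T ->
    0 <= v <= T -> `|u - v| <= kap -> `|p1 i u - p1 i v| <= e' /\ `|p2 i u - p2 i v| <= e'.
  move=> i; have [k k0 H] := u1 i e'0; have [k' k'0 H'] := u2 i e'0.
  exists (Num.min k k'); split; first by rewrite lt_min k0.
  by move=> u v u0 v0; rewrite le_min => /andP[a b]; split; [apply: H|apply: H'].
pose kappa := \big[Num.min/(e' / (data_sum + 1))]_i kap i.
exists kappa.
  apply/bigmin_gtP; split; first by rewrite divr_gt0// ltr_wpDl.
  by move=> i _; have [] := Hk i.
move=> s t s0T t0T st.
have kD : data_sum * `|s - t| <= e'.
  apply: (@le_trans _ _ (data_sum * (e' / (data_sum + 1)))).
    by rewrite ler_wpM2l// (le_trans st)// bigmin_le_id.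
  by rewrite mulrCA ler_piMr ?(ltW e'0)// ler_pdivrMr ?ltr_wpDl// mul1r lerDl.
rewrite /free_workload -weightedB; apply: le_trans (weighted_norm (c := 3 * e') _) _.
  move=> i; have [_ Hi] := Hk i; have dg := data_sum_ge i.
  have ski : `|s - t| <= kap i by apply: le_trans st _; exact: bigmin_le_cond.
  have [h1 _] := Hi s t s0T t0T ski.
  have h2 : `|p2 i (lam i / mu i * s) - p2 i (lam i / mu i * t)| <= e'.
    have [|//] := Hi _ _ (ratio_itv i s0T) (ratio_itv i t0T).
    rewrite -mulrBr normrM (ger0_norm (ratio_ge0 i)); apply: le_trans ski.
    by rewrite ler_piMl// ratio_le1.
  have h3 : `|(s - t) * (dlam i - lam i / mu i * dmu i)| <= e'.
    apply: le_trans kD; rewrite normrM mulrC ler_wpM2r//.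
    apply: le_trans (ler_normB _ _) _.
    have : `|lam i / mu i * dmu i| <= `|dmu i|.
      by rewrite normrM (ger0_norm (ratio_ge0 i)) ler_piMl// ratio_le1.
    by have := normr_ge0 (x0 i); lra.
  move: h1 h2 h3; rewrite !ler_norml => /andP[? ?] /andP[? ?] /andP[? ?].
  by apply/andP; split; lra.
have -> : e = 3 * (weight_sum + 1) * e'.
  by rewrite /e'; field; rewrite lt0r_neq0// ltr_wpDl.
by have := mulr_ge0 W0 (ltW e'0); move: e'0; rewrite mulrDr mulrDl; lra.
Qed.

Lemma reflection_unif_cont : unif_cont T (reflection free_workload).
Proof.
move=> e e0; have e20 : 0 < e / 2 by rewrite divr_gt0.
have [k k0 H] := free_workload_unif_cont e20.
have [k' k'0 H'] := regulator_unif_cont free_workload_bounded free_workload_unif_cont e20.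
exists (Num.min k k'); first by rewrite lt_min k0.
move=> s t s0 t0; rewrite le_min => /andP[/(H s t s0 t0) a /(H' s t s0 t0) b].
rewrite /reflection opprD addrACA; apply: le_trans (ler_normD _ _) _.
by rewrite (splitr e) lerD.
Qed.

(** With zero weighted sum, positive parts only compensate negative ones, which are bounded by [c];
    the factor [mu j] undoes the weight of class [j]. *)
Lemma weighted_lower (v : 'I_I -> R) (c : R) j : 0 <= c -> weighted v = 0 ->
  (forall i, - c <= v i) -> `|v j| <= c + \sum_i mu i * (weight_sum * c).
Proof.
move=> c0 w0 vc; have W0 := weight_sum_ge0; have Wc := mulr_ge0 W0 c0.
have S0 : mu j * (weight_sum * c) <= \sum_i mu i * (weight_sum * c).
  by rewrite (bigD1 j)//= lerDl sumr_ge0// => i _; rewrite mulr_ge0// ltW.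
have Sj : 0 <= mu j * (weight_sum * c) by rewrite mulr_ge0// ltW.
have up : v j + c <= mu j * (weight_sum * c).
  have := weighted_ge (v := fun i => v i + c) j.
  have vc0 i : 0 <= v i + c by have := vc i; lra.
  move=> /(_ vc0).
  rewrite ler_pdivrMl// => /le_trans; apply; rewrite ler_pM2l//.
  by rewrite weightedD w0 add0r /weighted /weight_sum mulr_suml.
have vcj := vc j; by rewrite ler_norml; apply/andP; split; lra.
Qed.

(** On a window [t - tau, t] a class either received no service, so that its arrivals alone lift it
    above the curve, or was at or above the curve at a nearly last service time [v], after which
    noise, curve and remaining service change little. Both cases give a lower bound, made two-sided
    by [weighted_lower]. The condition [e <= t] leaves room for the window. *)
Lemma fluid_tracking e : 0 < e -> exists delta r0 : R,
  [/\ 0 < delta, 0 < r0 & forall delta' r xn dl dm a s Tt X,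
    delta' <= delta -> r0 <= r -> prelimit delta' r xn dl dm a s Tt X ->
    work_conserving r Tt X -> curve_tracking Tt X ->
    forall t i, e <= t -> t <= T ->
    `|X i t - f (reflection free_workload t) i| <= e].
Proof.
move=> e0; set K := weight_sum * noise_bound; have K0 : 0 <= K := bound_ge0.
have W0 := weight_sum_ge0; have D0 := data_sum_ge0.
pose MW := \sum_i mu i * weight_sum.
have MW0 : 0 <= MW by apply: sumr_ge0 => i _; rewrite mulr_ge0// ltW.
(* The lower bound loses [3 * eta], which becomes [3 * eta * (1 + MW)] after [weighted_lower]; one
   more [eta] replaces the workload by its reflection. *)
pose eta := e / (4 * (1 + MW)).
have MW1 : 0 < 1 + MW by rewrite ltr_pwDl.
have eta0 : 0 < eta by rewrite divr_gt0// mulr_gt0.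
have etaE : 4 * eta + 4 * (MW * eta) = e.
  by rewrite /eta; field; rewrite lt0r_neq0.
(* The reflection is at most [2 * K], and the workload exceeds it by at most [kap / 3], where
   [kap <= 1]. *)
pose Wm := 2 * K + 1.
have Wm0 : 0 <= Wm by rewrite /Wm; lra.
have /choice[kf Hf] : forall i, exists k : R, 0 < k /\ forall w w', 0 <= w <= Wm ->
    0 <= w' <= Wm -> `|w - w'| <= k -> `|f w i - f w' i| <= eta.
  by move=> i; have [k k0 H] := fc Wm i eta0; exists k.
pose kap := \big[Num.min/(1 : R)]_i kf i.
have kap0 : 0 < kap by apply/bigmin_gtP; split => // i _; have [] := Hf i.
have kap1 : kap <= 1 by exact: bigmin_le_id.
have kap30 : 0 < kap / 3 by rewrite divr_gt0.
have [dA [rA [dA0 rA0 HA]]] := fluid_lower kap30.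
have [dB [rB [dB0 rB0 HB]]] := fluid_workload_upper kap30.
have [tg tg0 Hg] := reflection_unif_cont kap30.
have eta80 : 0 < eta / 8 by rewrite divr_gt0.
have /choice[tp Hp] : forall i, exists k : R, 0 < k /\ forall x y, 0 <= x <= T ->
    0 <= y <= T -> `|x - y| <= k -> `|p1 i x - p1 i y| <= eta / 8 /\
    `|p2 i x - p2 i y| <= eta / 8.
  move=> i; have [k k0 H] := u1 i eta80; have [k' k'0 H'] := u2 i eta80.
  exists (Num.min k k'); split; first by rewrite lt_min k0.
  by move=> u v u0 v0; rewrite le_min => /andP[? ?]; split; [apply: H|apply: H'].
(* Short enough for the window to fit before [t], for the reflection to move by at most [kap / 3],
   and for the noise to move by at most [eta]. *)
pose tau := \big[Num.min/Num.min e (Num.min tg (eta / (8 * (data_sum + 1))))]_i tp i.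
have dd1 : 0 < 8 * (data_sum + 1) by rewrite mulr_gt0// ltr_wpDl.
have tau0 : 0 < tau.
  apply/bigmin_gtP; split; last by move=> i _; have [] := Hp i.
  by rewrite !lt_min e0 tg0 divr_gt0.
have taui i : tau <= tp i by exact: bigmin_le_cond.
have : tau <= Num.min e (Num.min tg (eta / (8 * (data_sum + 1)))) by exact: bigmin_le_id.
rewrite !le_min => /and3P[taue taug taud].
pose Cf i := mu i * Wm.
(* Beyond this speed the arrivals [r * (lam j * tau)] of an unserved class exceed [Cf j], a bound on
   coordinate [j] of the curve over [0, Wm]. *)
pose rT := \sum_i Cf i / (lam i * tau).
have rTi i : Cf i <= rT * (lam i * tau).
  rewrite -ler_pdivrMr ?mulr_gt0// /rT (bigD1 i)//= lerDl sumr_ge0// => j _.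
  by rewrite divr_ge0 ?mulr_ge0// ltW.
have rT0 : 0 <= rT.
  by apply: sumr_ge0 => j _; rewrite divr_ge0 ?mulr_ge0// ltW.
exists (Num.min (Num.min 1 (eta / 16)) (Num.min dA dB)), (Num.max rT (Num.max rA rB)).
split; first by rewrite !lt_min ltr01 dA0 dB0 !andbT divr_gt0.
  by rewrite !lt_max rA0 orbT.
move=> delta r xn dl dm a s Tt X; rewrite !le_min !ge_max.
move=> /andP[/andP[d1 d16] /andP[dAi dBi]] /and3P[rTr rAr rBr] pre wc ct t i et tT.
have {}HA := HA _ _ _ _ _ _ _ _ _ dAi rAr pre.
have {}HB := HB _ _ _ _ _ _ _ _ _ dBi rBr pre wc.
have r0 : 0 < r by apply: lt_le_trans rA0 rAr.
have bx := free_workload_bounded.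
have X0 j v : 0 <= v <= T -> 0 <= X j v by move=> ?; case: pre => _ _ _ _; exact.
have WX v : 0 <= v <= T -> 0 <= workload X v <= Wm.
  move=> v0T; apply/andP; split.
    by apply: sumr_ge0 => j _; rewrite mulr_ge0 ?muV_ge0 ?X0.
  apply: (le_trans (HB v v0T)); have := reflection_le bx K0 v0T.
  by rewrite /Wm -/K; lra.
have GX v : 0 <= v <= T -> 0 <= reflection free_workload v <= Wm.
  move=> v0T; rewrite (reflection_ge0 bx v0T) /=.
  by have := reflection_le bx K0 v0T; rewrite /Wm -/K; lra.
have fclose w w' j : 0 <= w <= Wm -> 0 <= w' <= Wm -> `|w - w'| <= kap ->
    `|f w j - f w' j| <= eta.
  move=> w0 w'0 ww; have [_ Hj] := Hf j; apply: Hj => //.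
  by apply: le_trans ww _; exact: bigmin_le_cond.
have fCf w j : 0 <= w <= Wm -> f w j <= Cf j.
  move=> /andP[w0 wm]; have := weighted_ge (v := f w) j (fun i => f0 i w0).
  by rewrite (fw w0) ler_pdivrMl// => /le_trans; apply; rewrite /Cf ler_pM2l.
pose u := t - tau.
have u0 : 0 <= u by rewrite /u subr_ge0 (le_trans taue).
have ut : u <= t by rewrite /u gerBl ltW.
have t0T : 0 <= t <= T by rewrite (le_trans u0 ut).
have nclose v j : u <= v -> v <= t -> `|noise xn dl dm a s Tt j t -
    noise xn dl dm a s Tt j v| <= eta.
  move=> uv vt; have v0 := le_trans u0 uv; have [_ Hj] := Hp j.
  have tv : t - v <= tau by move: uv; rewrite /u; lra.
  have v0T : 0 <= v <= T by rewrite v0 (le_trans vt).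
  have m1 : `|p1 j t - p1 j v| <= eta / 8.
    have [] // := Hj t v t0T v0T; rewrite ger0_norm ?subr_ge0//.
    exact: le_trans tv (taui j).
  have m2 x y : 0 <= x <= T -> 0 <= y <= T -> `|x - y| <= t - v ->
      `|p2 j x - p2 j y| <= eta / 8.
    move=> x0T y0T xy; have [] // := Hj x y x0T y0T.
    exact: le_trans xy (le_trans tv (taui j)).
  apply: le_trans (noise_diff pre d1 v0 vt tT m1 m2) _.
  have : 8 * (data_sum + 1) * (t - v) <= eta.
    by rewrite mulrC -ler_pdivlMr// (le_trans tv).
  by move: d16; lra.
have lower j : - (3 * eta) <= X j t - f (workload X t) j.
  have [un|[v [uv vt fv Tv]]] := ct u t j (eta / (r * mu j)) u0 ut tT
      (divr_gt0 eta0 (mulr_gt0 r0 (mu0 j))).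
    have u0T : 0 <= u <= T by rewrite u0 (le_trans ut).
    have := nclose u j (lexx u) ut; have := X0 j u u0T.
    rewrite (queueE pre j t0T) (queueE pre j u0T) un.
    have -> : t = u + tau by rewrite /u subrK.
    have : Cf j <= r * (lam j * tau).
      by apply: le_trans (rTi j) _; rewrite ler_pM2r// mulr_gt0.
    have := fCf _ j (WX t t0T); rewrite {1}(_ : t = u + tau) ?/u ?subrK//.
    rewrite mulrBr (mulrDr (lam j)) ler_norml => ? ? ? /andP[? _].
    by move: eta0; lra.
  have v0 := le_trans u0 uv; have v0T : 0 <= v <= T by rewrite v0 (le_trans vt).
  have := nclose v j uv vt.
  have : `|f (workload X t) j - f (workload X v) j| <= eta.
    apply: fclose; [exact: WX|exact: WX|].
    have := HB t t0T; have := HB v v0T; have := HA t t0T; have := HA v v0T.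
    have := Hg t v t0T v0T; rewrite (ger0_norm (_ : 0 <= t - v)) ?subr_ge0//.
    have tv : t - v <= tg by move: uv taug; rewrite /u; lra.
    by move=> /(_ tv); rewrite !ler_norml => /andP[? ?] ? ? ? ?; apply/andP; split; lra.
  have : r * mu j * (Tt j t - Tt j v) <= eta.
    by rewrite mulrC -ler_pdivlMr// mulr_gt0.
  have : 0 <= r * (lam j * (t - v)).
    by rewrite mulr_ge0 ?mulr_ge0 ?subr_ge0// ltW.
  have := queueE pre j t0T; have := queueE pre j v0T; rewrite !ler_norml.
  by move=> ? ? ? ? /andP[? ?] /andP[? ?]; lra.
have wz : weighted (fun j => X j t - f (workload X t) j) = 0.
  by rewrite weightedB fw ?subrr//; case/andP: (WX t t0T).
have := weighted_lower i (_ : 0 <= 3 * eta) wz lower.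
rewrite mulr_ge0 ?(ltW eta0)// => /(_ isT).
have -> : \sum_(j < I) mu j * (weight_sum * (3 * eta)) = 3 * (MW * eta).
  transitivity (\sum_(j < I) (mu j * weight_sum) * (3 * eta)).
    by apply: eq_bigr => j _; ring.
  by rewrite -mulr_suml -/MW; ring.
have : `|f (workload X t) i - f (reflection free_workload t) i| <= eta.
  apply: fclose; [exact: WX|exact: GX|].
  by have := HB t t0T; have := HA t t0T; rewrite ler_norml => ? ?; apply/andP; split; lra.
have Me := mulr_ge0 MW0 (ltW eta0).
rewrite !ler_norml => /andP[? ?] /andP[? ?]; move: etaE => ?.
by apply/andP; split; lra.
Qed.

End tracking.

End fluid.

(** * The differential game *)

Section min_curve.
Context {R : realType} {I : nat}.
Variables (theta : 'rV[R]_I) (f : R -> 'rV[R]_I) (cost : 'rV[R]_I -> R).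
Hypothesis theta0 : forall i, 0 < theta ord0 i.
Hypothesis cf : {within `[0, +oo[, continuous f}.
Hypothesis f_orthant : forall w, 0 <= w -> orthant I (f w).
Hypothesis f_level : forall w, 0 <= w -> dotp theta (f w) = w.
Hypothesis cost_ok : cost_function cost.
Hypothesis f_min : forall w, 0 <= w ->
  cost (f w) = inf [set cost q | q in [set q | orthant I q /\ dotp theta q = w]].

Lemma curve_unif_cont (D : R) i : unif_cont D (fun w => f w ord0 i).
Proof.
apply: cpath_unif_cont; apply: continuous_subspaceW cf => x.
by rewrite /= !in_itv /= andbT => /andP[].
Qed.

Lemma curve_minimal q : orthant I q -> cost (f (dotp theta q)) <= cost q.
Proof.
move=> oq; have w0 : 0 <= dotp theta q.
  by apply: sumr_ge0 => i _; rewrite mulr_ge0// ltW.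
rewrite f_min//; apply: ge_inf; last by exists q.
by exists 0 => _ [p [op _] <-]; case: cost_ok => + _ _; exact.
Qed.

(** The optimal cost is nondecreasing in the workload level: scaling [f w'] by [w / w' <= 1] lands
    on level [w], where [f w] is optimal, and lowers every coordinate. *)
Lemma curve_cost_le w q : 0 <= w -> orthant I q -> w <= dotp theta q ->
  cost (f w) <= cost q.
Proof.
move=> w0 oq wq; apply: le_trans (curve_minimal oq); set w' := dotp theta q in wq *.
have w'0 := le_trans w0 wq.
have [w'z|w'n] := eqVneq w' 0.
  by rewrite w'z in wq *; rewrite (_ : w = 0)//; apply/eqP; rewrite eq_le w0 wq.
have w'p : 0 < w' by rewrite lt_neqAle eq_sym w'n.
pose p := (w / w') *: f w'.
have c0 : 0 <= w / w' by rewrite divr_ge0.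
have op : orthant I p by move=> i; rewrite mxE mulr_ge0// f_orthant.
have pw : dotp theta p = w.
  rewrite /p /dotp (eq_bigr (fun i => w / w' * (theta ord0 i * f w' ord0 i))); last first.
    by move=> i _; rewrite mxE mulrCA.
  by rewrite -mulr_sumr -/(dotp theta (f w')) f_level// divfK.
apply: (@le_trans _ _ (cost p)); first by rewrite -{1}pw curve_minimal.
case: cost_ok => _ _; apply => //; first exact: f_orthant.
move=> i; rewrite mxE ler_piMl ?f_orthant//.
by rewrite ler_pdivrMr// mul1r.
Qed.

(** The cost is continuous only within the orthant, so uniformity is obtained along the compact
    piece of curve over [0, D], by comparing points of the orthant with points of the curve. *)
Lemma curve_cost_cont (D e : R) : 0 < e -> exists2 delta : R, 0 < delta &
  forall w q, 0 <= w <= D -> orthant I q ->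
  (forall i, `|q ord0 i - f w ord0 i| <= delta) -> `|cost q - cost (f w)| <= e.
Proof.
move=> e0; case: cost_ok => _ /subspace_continuousP cc _.
have /compact_near_coveringP/near_covering_withinP cpt := @segment_compact R 0 D.
pose Q (delta w : R) := forall q, orthant I q ->
  (forall i, `|q ord0 i - f w ord0 i| <= delta) -> `|cost q - cost (f w)| <= e.
have e20 : 0 < e / 2 by rewrite divr_gt0.
have [|delta /= d0 Hd] := cpt R (0 : R)^'+ Q _.
  move=> w Kw; have /andP[w0 wD] : 0 <= w <= D by move: Kw; rewrite /= in_itv.
  have /cvgrPdist_le/(_ _ e20) := cc (f w) (f_orthant w0).
  rewrite near_withinE => /nbhs_ballP[r /= r0 rP].
  have r40 : 0 < r / 4 by rewrite divr_gt0.
  have /choice[kf Hf] : forall i, exists k : R, 0 < k /\ forall u v, 0 <= u <= D ->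
      0 <= v <= D -> `|u - v| <= k -> `|f u ord0 i - f v ord0 i| <= r / 4.
    by move=> i; have [k k0 H] := curve_unif_cont D i r40; exists k.
  pose k := \big[Num.min/(1 : R)]_i kf i.
  have k0 : 0 < k by apply/bigmin_gtP; split => // i _; have [] := Hf i.
  exists (ball w k, [set delta | delta < r / 4]).
    by split; [exact: nbhsx_ballx|exact: nbhs_right_lt].
  move=> [w' delta] [/= ww' dr] Kw' q oq qf.
  have w'D : 0 <= w' <= D by move: Kw'; rewrite /= in_itv.
  have ff i : `|f w ord0 i - f w' ord0 i| <= r / 4.
    have [_ Hi] := Hf i; apply: Hi => //.
    apply: le_trans (ltW ww') _; exact: bigmin_le_cond.
  have r4r : r / 4 < r by move: r0; lra.
  have h1 : `|cost (f w) - cost (f w')| <= e / 2.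
    apply: rP; last by apply: f_orthant; case/andP: w'D.
    split => // i j; rewrite ord1 /ball /=; exact: le_lt_trans (ff j) r4r.
  have h2 : `|cost (f w) - cost q| <= e / 2.
    apply: rP => //; split => // i j; rewrite ord1 /ball /=.
    have := ff j; have := qf j; have := dr; rewrite !ler_norml ltr_norml.
    by move=> ? /andP[? ?] /andP[? ?]; apply/andP; split; lra.
  move: h1 h2; rewrite !ler_norml => /andP[? ?] /andP[? ?].
  by apply/andP; split; lra.
exists (delta / 2); first by rewrite divr_gt0.
move=> w q wD oq qf; apply: (Hd (delta / 2)) => //=.
- by rewrite sub0r normrN gtr0_norm ?divr_gt0//; move: d0; lra.
- by rewrite divr_gt0.
Qed.

Lemma curve_cost_unif_cont (D : R) : unif_cont D (fun w => cost (f w)).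
Proof.
move=> e e0; have [delta d0 H] := curve_cost_cont D e0.
have /choice[kf Hf] : forall i, exists k : R, 0 < k /\ forall u v, 0 <= u <= D ->
    0 <= v <= D -> `|u - v| <= k -> `|f u ord0 i - f v ord0 i| <= delta.
  by move=> i; have [k k0 H'] := curve_unif_cont D i d0; exists k.
exists (\big[Num.min/(1 : R)]_i kf i).
  by apply/bigmin_gtP; split => // i _; have [] := Hf i.
move=> s t s0 t0 st; apply: H => //; first by apply: f_orthant; case/andP: s0.
move=> i; have [_ Hi] := Hf i; apply: Hi => //; apply: le_trans st _.
exact: bigmin_le_cond.
Qed.

End min_curve.

Section game.
Context {R : realType} {d : measure_display} {Omega : measurableType d}
  {P : probability Omega R} {I : nat}.
Variable M : queue_model P I.
Hypothesis mht : moderate_heavy_traffic M.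
Hypothesis costs : cost_functions M.
Variable f : R -> 'rV[R]_I.
Hypothesis cf : {within `[0, +oo[, continuous f}.
Hypothesis fmin : forall w : R, 0 <= w ->
  let level := [set q | orthant I q /\ dotp (theta M) q = w] in
  [/\ orthant I (f w), dotp (theta M) (f w) = w,
      cost_h M (f w) = inf [set cost_h M q | q in level] &
      cost_g M (f w) = inf [set cost_g M q | q in level]].
Notation T := (horizon M).
Notation leb := (@lebesgue_measure R).
Implicit Types (psi : R -> 'rV[R]_(I + I)) (i : 'I_I).

Lemma lam_gt0 i : 0 < lam M i.
Proof. by case: mht => _ _ /(_ i)[]. Qed.

Lemma mu_gt0 i : 0 < mu M i.
Proof. by case: mht => _ _ _ /(_ i)[]. Qed.

Lemma critical_load : \sum_i lam M i / mu M i = 1.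
Proof. by case: mht => _ _ _ _ []. Qed.

Lemma theta_gt0 i : 0 < theta M ord0 i.
Proof. by rewrite mxE invr_gt0 mu_gt0. Qed.

Lemma x0_ge0 i : 0 <= x0 M ord0 i.
Proof. by case: mht => _ _ _ _ [_ /(_ i)[]]. Qed.

Definition path1 psi i t := lsubmx (psi t) ord0 i.
Definition path2 psi i t := rsubmx (psi t) ord0 i.

Definition netput psi := free_workload (lam M) (mu M) (dlam M) (dmu M)
  (fun i => x0 M ord0 i) (path1 psi) (path2 psi).

Definition min_workload psi := reflection (netput psi).

Definition free_path psi t : 'rV[R]_I :=
  x0 M + t *: drift M + lsubmx (psi t) - time_scaled M (rsubmx \o psi) t.

Lemma dotp_thetaE (v : 'rV[R]_I) : dotp (theta M) v = weighted (mu M) (fun i => v ord0 i).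
Proof. by apply: eq_bigr => i _; rewrite mxE. Qed.

Lemma netputE psi t : netput psi t = dotp (theta M) (free_path psi t).
Proof. by rewrite dotp_thetaE; apply: eq_bigr => i _; rewrite /path1 /path2 !mxE /rho. Qed.

Lemma dynamicsE psi zeta t : dynamics M psi zeta t = free_path psi t + zeta t.
Proof. by []. Qed.

Lemma game_path psi : game_P M psi -> exists C : R,
  [/\ forall i, unif_cont T (path1 psi i), forall i, unif_cont T (path2 psi i),
      forall i, bounded_on T (path1 psi i) C & forall i, bounded_on T (path2 psi i) C].
Proof.
move=> [cpsi _].
have p1 i : unif_cont T (path1 psi i).
  rewrite /path1; under eq_fun do rewrite mxE; exact: cpath_unif_cont.
have p2 i : unif_cont T (path2 psi i).
  rewrite /path2; under eq_fun do rewrite mxE; exact: cpath_unif_cont.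
have /choice[C1 H1] := fun i => unif_cont_bounded (p1 i).
have /choice[C2 H2] := fun i => unif_cont_bounded (p2 i).
have T00 : 0 <= (0 : R) <= T by rewrite lexx ltW ?(horizon_gt0 mht).
have C10 i : 0 <= C1 i by apply: le_trans (H1 i 0 T00).
have C20 i : 0 <= C2 i by apply: le_trans (H2 i 0 T00).
exists (\sum_i (C1 i + C2 i)); split => // i t t0T.
  apply: le_trans (H1 i t t0T) _; rewrite (bigD1 i)//= -addrA lerDl addr_ge0//.
  by apply: sumr_ge0 => j _; rewrite addr_ge0.
apply: le_trans (H2 i t t0T) _; rewrite (bigD1 i)//= addrAC -[leLHS]add0r lerD//.
by rewrite addr_ge0// sumr_ge0// => j _; rewrite addr_ge0.
Qed.

Lemma netput_bounded psi : game_P M psi -> exists2 C : R, 0 <= C & bounded_on T (netput psi) C.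
Proof.
move=> /game_path[C [_ _ b1 b2]].
exists (weight_sum (mu M) * noise_bound T (dlam M) (dmu M) (fun i => x0 M ord0 i) C).
  exact: (bound_ge0 _ _ _ (horizon_gt0 mht) mu_gt0 b1).
exact: (free_workload_bounded _ _ _ (horizon_gt0 mht) lam_gt0 mu_gt0 critical_load b1 b2).
Qed.

Lemma netput_unif_cont psi : game_P M psi -> unif_cont T (netput psi).
Proof.
move=> /game_path[C [u1 u2 _ _]].
exact: (free_workload_unif_cont _ _ _ lam_gt0 mu_gt0 critical_load u1 u2).
Qed.

Lemma min_workload_unif_cont psi : game_P M psi -> unif_cont T (min_workload psi).
Proof.
move=> Ppsi; have [C C0 bx] := netput_bounded Ppsi; have ux := netput_unif_cont Ppsi.
exact: unif_contD ux (regulator_unif_cont bx ux).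
Qed.

Lemma min_workload_itv psi : game_P M psi -> exists2 D : R, 0 <= D &
  forall t, 0 <= t <= T -> 0 <= min_workload psi t <= D.
Proof.
move=> Ppsi; have [C C0 bx] := netput_bounded Ppsi; exists (2 * C); first by rewrite mulr_ge0.
by move=> t t0T; rewrite (reflection_ge0 bx t0T) (reflection_le bx C0 t0T).
Qed.

Definition min_cost psi : \bar R :=
  (\int[leb]_(t in `[0%R, T]) (cost_h M (f (min_workload psi t)))%:E
   + (cost_g M (f (min_workload psi T)))%:E)%E.

Lemma f_orth w : 0 <= w -> orthant I (f w). Proof. by move=> /fmin[]. Qed.
Lemma f_lev w : 0 <= w -> dotp (theta M) (f w) = w. Proof. by move=> /fmin[]. Qed.

Let costh : cost_function (cost_h M). Proof. by case: costs. Qed.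
Let costg : cost_function (cost_g M). Proof. by case: costs. Qed.

Lemma hcurve_le w q : 0 <= w -> orthant I q -> w <= dotp (theta M) q ->
  cost_h M (f w) <= cost_h M q.
Proof.
by move=> w0 oq wq; apply: (curve_cost_le theta_gt0 f_orth f_lev costh) => // v /fmin[].
Qed.

Lemma gcurve_le w q : 0 <= w -> orthant I q -> w <= dotp (theta M) q ->
  cost_g M (f w) <= cost_g M q.
Proof.
by move=> w0 oq wq; apply: (curve_cost_le theta_gt0 f_orth f_lev costg) => // v /fmin[].
Qed.

Lemma running_cost_unif_cont psi : game_P M psi ->
  unif_cont T (fun t => cost_h M (f (min_workload psi t))).
Proof.
move=> Ppsi e e0; have [D D0 HD] := min_workload_itv Ppsi.
have [k k0 Hk] := curve_cost_unif_cont cf f_orth costh D e0.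
have [k' k'0 Hk'] := min_workload_unif_cont Ppsi k0.
by exists k' => // s t s0 t0 st; apply: Hk; [exact: HD|exact: HD|exact: Hk'].
Qed.

Lemma running_cost_measurable psi : game_P M psi ->
  measurable_fun `[0, T] (fun t => cost_h M (f (min_workload psi t))).
Proof. by move=> /running_cost_unif_cont; exact: unif_cont_measurable. Qed.

Lemma h_ge0 q : orthant I q -> 0 <= cost_h M q. Proof. by case: costh => + _ _; exact. Qed.
Lemma g_ge0 q : orthant I q -> 0 <= cost_g M q. Proof. by case: costg => + _ _; exact. Qed.

Lemma running_cost_ge0 psi t : game_P M psi -> 0 <= t <= T ->
  0 <= cost_h M (f (min_workload psi t)).
Proof.
move=> Ppsi t0T; apply/h_ge0/f_orth; have [D _ HD] := min_workload_itv Ppsi.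
by have /andP[] := HD t t0T.
Qed.

Lemma terminal_time : 0 <= T <= T. Proof. by rewrite lexx ltW ?(horizon_gt0 mht). Qed.

Lemma min_cost_ge0 psi : game_P M psi -> (0 <= min_cost psi)%E.
Proof.
move=> Ppsi; apply: adde_ge0.
  by apply: integral_ge0 => t /=; rewrite in_itv /= lee_fin => /(running_cost_ge0 Ppsi).
rewrite lee_fin; apply/g_ge0/f_orth; have [D _ HD] := min_workload_itv Ppsi.
by have /andP[] := HD T terminal_time.
Qed.

Lemma leb_horizon : leb `[0, T]%classic = T%:E.
Proof. by rewrite lebesgue_measure_itv /= lte_fin (horizon_gt0 mht) sube0. Qed.

Lemma min_cost_fin psi : game_P M psi -> min_cost psi \is a fin_num.
Proof.
move=> Ppsi; rewrite /min_cost fin_numD andbT.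
have [C HC] := unif_cont_bounded (running_cost_unif_cont Ppsi).
rewrite ge0_fin_numE; last first.
  by apply: integral_ge0 => t /=; rewrite in_itv /= lee_fin => /(running_cost_ge0 Ppsi).
apply: (@le_lt_trans _ _ (\int[leb]_(t in `[0%R, T]) (C%:E))%E).
  have C0 : 0 <= C by apply: le_trans (HC _ terminal_time).
  apply: ge0_integral_le => [t tT|t _]; last by rewrite lee_fin.
  have t0T : 0 <= t <= T by move: tT; rewrite /= in_itv.
  split => //; first by rewrite lee_fin running_cost_ge0.
  by rewrite lee_fin; apply: le_trans (ler_norm _) (HC _ t0T).
rewrite integral_cst//= -/leb leb_horizon; exact: ltry.
Qed.

End game.

Section horizon_integral.
Context {R : realType}.
Variable T : R.
Hypothesis T0 : 0 < T.
Notation leb := (@lebesgue_measure R).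

Lemma integral_le_addl (u v : R -> R) (c : R) : 0 <= c -> measurable_fun `[0, T] v ->
  (forall t, 0 <= t <= T -> [/\ 0 <= u t, 0 <= v t & u t <= v t + c]) ->
  (\int[leb]_(t in `[0%R, T]) (u t)%:E <=
   \int[leb]_(t in `[0%R, T]) (v t)%:E + (T * c)%:E)%E.
Proof.
move=> c0 mv H.
have -> : ((T * c)%:E = \int[leb]_(t in `[0%R, T]) (cst c%:E) t)%E.
  rewrite integral_cst//= lebesgue_measure_itv /= lte_fin T0 sube0 -EFinM mulrC//.
rewrite -ge0_integralD//; last 2 first.
- by move=> t /=; rewrite in_itv /= lee_fin => /H[].
- exact/measurable_EFinP.
apply: ge0_integral_le => t tT; have t0T : 0 <= t <= T by move: tT; rewrite /= in_itv.
  by have [a b h] := H t t0T; split => //; rewrite -EFinD lee_fin.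
by have [a b h] := H t t0T; rewrite -EFinD lee_fin addr_ge0.
Qed.

(** Here the smaller function is the measurable one, and the measurable [max 0 (u - c)] is inserted
    below [v]. This is the variant that applies when [v] is the cost of an arbitrary control. *)
Lemma integral_le_addr (u v : R -> R) (c : R) : 0 <= c -> measurable_fun `[0, T] u ->
  (forall t, 0 <= t <= T -> [/\ 0 <= u t, 0 <= v t & u t <= v t + c]) ->
  (\int[leb]_(t in `[0%R, T]) (u t)%:E <=
   \int[leb]_(t in `[0%R, T]) (v t)%:E + (T * c)%:E)%E.
Proof.
move=> c0 mu H; pose w t := Num.max 0 (u t - c).
apply: (@le_trans _ _ (\int[leb]_(t in `[0%R, T]) (w t)%:E + (T * c)%:E)%E).
  apply: integral_le_addl => //.
    by apply: measurable_maxr => //; exact: measurable_funB.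
  move=> t /H[a b h]; split => //; first by rewrite le_max lexx.
  by rewrite -lerBlDr le_max lexx orbT.
rewrite leeD2r//; apply: ge0_integral_le => t /=; rewrite in_itv /= => t0T; have [a b h] := H t t0T.
  by split; rewrite ?in_itv// lee_fin ?le_max ?lexx// ge_max b lerBlDr.
by rewrite lee_fin.
Qed.

End horizon_integral.

Section game_value.
Context {R : realType} {d : measure_display} {Omega : measurableType d}
  {P : probability Omega R} {I : nat}.
Variable M : queue_model P I.
Hypothesis mht : moderate_heavy_traffic M.
Hypothesis costs : cost_functions M.
Variable f : R -> 'rV[R]_I.
Hypothesis cf : {within `[0, +oo[, continuous f}.
Hypothesis fmin : forall w : R, 0 <= w ->
  let level := [set q | orthant I q /\ dotp (theta M) q = w] in
  [/\ orthant I (f w), dotp (theta M) (f w) = w,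
      cost_h M (f w) = inf [set cost_h M q | q in level] &
      cost_g M (f w) = inf [set cost_g M q | q in level]].
Notation T := (horizon M).
Notation leb := (@lebesgue_measure R).
Implicit Types (psi : R -> 'rV[R]_(I + I)) (i : 'I_I).

Let T0 : 0 < T := horizon_gt0 mht.
Let lam0 := lam_gt0 mht.
Let mu0 := mu_gt0 mht.
Let crit := critical_load mht.

Lemma free_pathE psi t i : free_path M psi t ord0 i = x0 M ord0 i +
  t * (dlam M i - lam M i / mu M i * dmu M i) + path1 psi i t -
  path2 psi i (lam M i / mu M i * t).
Proof. by rewrite /free_path /path1 /path2 !mxE /= ?mxE /rho. Qed.

Lemma free_path_lip psi psi' (e t : R) i : cball T psi e psi' -> 0 <= t <= T ->
  `|free_path M psi' t ord0 i - free_path M psi t ord0 i| <= 2 * e.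
Proof.
move=> b t0T; have := b t t0T (lshift I i).
have := b (lam M i / mu M i * t) (ratio_itv lam0 mu0 crit i t0T) (rshift I i).
rewrite !free_pathE /path1 /path2 !mxE !ler_norml => /andP[? ?] /andP[? ?].
by apply/andP; split; lra.
Qed.

Lemma netput_lip psi psi' (e t : R) : cball T psi e psi' -> 0 <= t <= T ->
  `|netput M psi' t - netput M psi t| <= weight_sum (mu M) * (2 * e).
Proof.
move=> b t0T; rewrite !netputE !dotp_thetaE -weightedB; apply: weighted_norm => // i.
exact: free_path_lip.
Qed.

Lemma min_workload_lip psi psi' (e t : R) : game_P M psi -> game_P M psi' ->
  cball T psi e psi' -> 0 <= t <= T ->
  `|min_workload M psi' t - min_workload M psi t| <= 2 * (weight_sum (mu M) * (2 * e)).
Proof.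
move=> Pp Pp' b t0T; have [C _ bC] := netput_bounded mht Pp.
have [C' _ bC'] := netput_bounded mht Pp'.
by apply: (reflection_lip bC' bC) => // s s0T; exact: netput_lip.
Qed.

Lemma min_workload_cont psi (k : R) : game_P M psi -> 0 < k -> exists D delta : R,
  [/\ 0 < delta, delta <= k & forall psi', game_P M psi' -> cball T psi delta psi' ->
    forall t, 0 <= t <= T -> [/\ 0 <= min_workload M psi t <= D,
      0 <= min_workload M psi' t <= D &
      `|min_workload M psi t - min_workload M psi' t| <= k]].
Proof.
move=> Pp k0; have [D D0 HD] := min_workload_itv mht Pp.
have W0 := weight_sum_ge0 mu0.
have W4 : 0 < 4 * weight_sum (mu M) + 1 by rewrite ltr_wpDl// mulr_ge0.
exists (D + k), (k / (4 * weight_sum (mu M) + 1)); split; first by rewrite divr_gt0.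
  by rewrite ler_pdivrMr// ler_peMr ?(ltW k0)// lerDr mulr_ge0.
move=> psi' Pp' b t t0T; have h := min_workload_lip Pp Pp' b t0T.
have {}h : `|min_workload M psi' t - min_workload M psi t| <= k.
  apply: le_trans h _; set x := k / _.
  have xE : x * (4 * weight_sum (mu M) + 1) = k by rewrite /x divfK ?lt0r_neq0.
  have : 0 <= x by rewrite divr_ge0// ltW.
  by move: xE; lra.
have [D' D'0 HD'] := min_workload_itv mht Pp'.
have /andP[a1 a2] := HD t t0T; have /andP[a3 _] := HD' t t0T.
move: h; rewrite distrC => h; split => //; first by rewrite a1 (le_trans a2)// lerDl ltW.
by rewrite a3 /=; move: h; rewrite ler_norml => /andP[? _]; lra.
Qed.

(** At time 0 this jumps from [x0] to the point of the curve with the same workload; [game_E]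
    permits it because only [theta . zeta] has to start from 0. *)
Definition alpha_star psi t : 'rV[R]_I := f (min_workload M psi t) - free_path M psi t.

Lemma alpha_starE psi t i : alpha_star psi t ord0 i =
  f (min_workload M psi t) ord0 i - free_path M psi t ord0 i.
Proof. by rewrite /alpha_star mxE [in X in _ + X]mxE. Qed.

Lemma min_workload_ge0 psi t : game_P M psi -> 0 <= t <= T -> 0 <= min_workload M psi t.
Proof. by move=> Pp t0T; have [D _ /(_ t t0T)/andP[]] := min_workload_itv mht Pp. Qed.

(** Continuity for the uniform topology, from which Borel measurability of the strategy follows. *)
Lemma alpha_star_cont psi (e : R) : game_P M psi -> 0 < e -> exists2 delta : R, 0 < delta &
  forall psi', game_P M psi' -> cball T psi delta psi' ->
    cball T (alpha_star psi) e (alpha_star psi').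
Proof.
move=> Pp e0; have e40 : 0 < e / 4 by rewrite divr_gt0.
(* A first radius gives a common range [0, D0] for the two workloads; the modulus of [f] on that
   range then determines the second radius. *)
have [D0 [delta0 [d00 _ H0]]] := min_workload_cont Pp ltr01.
have /choice[kf Hf] : forall i, exists k : R, 0 < k /\ forall u v, 0 <= u <= D0 ->
    0 <= v <= D0 -> `|u - v| <= k -> `|f u ord0 i - f v ord0 i| <= e / 4.
  by move=> i; have [k k0 H] := curve_unif_cont cf D0 i e40; exists k.
pose k := \big[Num.min/(e / 4)]_i kf i.
have k0 : 0 < k by apply/bigmin_gtP; split => // i _; have [] := Hf i.
have [D1 [delta1 [d10 d1k H1]]] := min_workload_cont Pp k0.
exists (Num.min delta0 delta1); first by rewrite lt_min d00.
move=> psi' Pp' b t t0T i.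
have b0 : cball T psi delta0 psi'.
  by move=> s s0T j; apply: le_trans (b s s0T j) _; rewrite ge_min lexx.
have b1 : cball T psi delta1 psi'.
  by move=> s s0T j; apply: le_trans (b s s0T j) _; rewrite ge_min lexx orbT.
have [a1 a2 _] := H0 _ Pp' b0 t t0T; have [_ _ a3] := H1 _ Pp' b1 t t0T.
have [_ Hi] := Hf i; have := Hi _ _ a1 a2.
have ki : k <= kf i by exact: bigmin_le_cond.
move=> /(_ (le_trans a3 ki)) h1; have h2 := free_path_lip i b1 t0T.
have ke : k <= e / 4 by exact: bigmin_le_id.
have h3 := le_trans d1k ke.
rewrite !alpha_starE; move: h1 h2; rewrite !ler_norml => /andP[? ?] /andP[? ?].
by apply/andP; split; lra.
Qed.

Lemma free_path_unif_cont psi i : game_P M psi -> unif_cont T (fun t => free_path M psi t ord0 i).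
Proof.
move=> Pp; have [C [u1 u2 _ _]] := game_path mht Pp.
have -> : (fun t => free_path M psi t ord0 i) = (fun t => (x0 M ord0 i +
   t * (dlam M i - lam M i / mu M i * dmu M i) + path1 psi i t) +
   - path2 psi i (lam M i / mu M i * t)).
  by apply/funext => t; exact: free_pathE.
apply: unif_contD; last first.
  apply/unif_contN/unif_cont_scaled => //.
  by rewrite (ratio_ge0 lam0 mu0) (ratio_le1 lam0 mu0 crit).
apply: unif_contD => //.
have := unif_cont_lin T (dlam M i - lam M i / mu M i * dmu M i).
move=> H e /H[k k0 Hk]; exists k => // s t s0 t0 st.
by rewrite opprD addrACA subrr add0r; exact: Hk.
Qed.

Lemma min_workload0 psi : game_P M psi -> min_workload M psi 0 = netput M psi 0.
Proof.
move=> Pp; have [C _ bC] := netput_bounded mht Pp.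
have n0 : 0 <= netput M psi 0.
  rewrite netputE dotp_thetaE; apply: sumr_ge0 => i _; rewrite mulr_ge0//.
    exact: muV_ge0.
  case: Pp => _ p0; rewrite free_pathE /path1 /path2 mulr0 p0 !mxE mul0r subr0 !addr0.
  exact: x0_ge0.
rewrite /min_workload /reflection; suff -> : regulator (netput M psi) 0 = 0 by rewrite addr0.
apply/eqP; rewrite eq_le (regulator_ge0 bC) ?lexx ?(ltW T0)// andbT.
apply: regulator_le => // s s0 s0'; have -> : s = 0 by apply/eqP; rewrite eq_le s0'.
by rewrite oppr_le0.
Qed.

Lemma dotp_alpha_star psi t : game_P M psi -> 0 <= t <= T ->
  dotp (theta M) (alpha_star psi t) = regulator (netput M psi) t.
Proof.
move=> Pp t0T.
have -> : dotp (theta M) (alpha_star psi t) =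
    dotp (theta M) (f (min_workload M psi t)) - dotp (theta M) (free_path M psi t).
  rewrite !dotp_thetaE -weightedB; apply: eq_bigr => i _.
  by rewrite alpha_starE.
have [_ -> _ _] := fmin (min_workload_ge0 Pp t0T).
by rewrite -netputE /min_workload /reflection; ring.
Qed.

Lemma alpha_star_game_E psi : game_P M psi -> game_E M (alpha_star psi).
Proof.
move=> Pp; have [C _ bC] := netput_bounded mht Pp.
have z : 0 <= (0 : R) <= T by rewrite lexx (ltW T0).
split.
- apply: unif_cont_cpath => i.
  have -> : (fun t => alpha_star psi t ord0 i) = (fun t => f (min_workload M psi t) ord0 i +
      - free_path M psi t ord0 i).
    by apply/funext => t; rewrite /alpha_star; do 2 rewrite [in LHS]mxE.
  apply: unif_contD; last exact/unif_contN/free_path_unif_cont.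
  have [D _ HD] := min_workload_itv mht Pp.
  move=> e e0; have [k k0 Hk] := curve_unif_cont cf D i e0.
  have [k' k'0 Hk'] := min_workload_unif_cont mht Pp k0.
  by exists k' => // s t s0 t0 st; apply: Hk; [exact: HD|exact: HD|exact: Hk'].
- rewrite dotp_alpha_star//; have := min_workload0 Pp.
  by rewrite /min_workload /reflection; lra.
- move=> s t s0 st tT; rewrite !dotp_alpha_star// ?s0 ?(le_trans st)//; last first.
    by rewrite (le_trans s0).
  exact: (regulator_nd bC).
Qed.

Lemma uniform_nbhsP (k : nat) (phi : R -> 'rV[R]_k) (U : set (R -> 'rV[R]_k)) :
  @nbhs _ {uniform` `[0%R, T]%classic -> 'rV[R]_k} phi U <->
  exists2 e : R, 0 < e & cball T phi e `<=` U.
Proof.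
split=> [/uniform_nbhs[E [+ EU]]|[e e0 eU]].
  rewrite -entourage_from_ballE => -[e /= e0 eE]; exists (e / 2); first by rewrite divr_gt0.
  move=> h He; apply: EU => y /=; rewrite in_itv /= => y0T; apply: eE => /=.
  split => // i j; rewrite ord1 /ball /= distrC; apply: le_lt_trans (He y y0T j) _.
  by move: e0; lra.
apply/uniform_nbhs; exists [set xy | ball xy.1 e xy.2]; split.
  by rewrite -entourage_from_ballE; exists e.
move=> h He; apply: eU => t t0T i; rewrite distrC; apply: ltW.
have tT : `[0, T]%classic t by rewrite /= in_itv.
by have [_ /(_ ord0 i)] := He t tT.
Qed.

(** Sets with measurable preimage form a sigma-algebra, so it suffices to treat traces of open sets.
    Continuity is known only among paths of [game_P]; the open set with the right trace is the
    interior of the set where membership in [game_P] implies that the image lies in [U]. *)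
Lemma alpha_star_borel U : uniform_borel T (game_E M) U ->
  uniform_borel T (game_P M) (game_P M `&` alpha_star @^-1` U).
Proof.
have [s0 sD sU] := smallest_sigma_algebra (game_P M)
  [set game_P M `&` U | U in (@open {uniform` `[0%R, T]%classic -> 'rV[R]_(I + I)}
       : set (set (R -> 'rV[R]_(I + I))))].
apply: (@smallest_sub _ (sigma_algebra (game_E M)) _
  [set U | uniform_borel T (game_P M) (game_P M `&` alpha_star @^-1` U)]).
  split => [|A HA|F HF].
  - by rewrite /= preimage_set0 setI0.
  - rewrite /= (_ : _ `&` _ = game_P M `\` (game_P M `&` alpha_star @^-1` A)).
      exact: sD.
    apply/seteqP; split => [psi [Pp [_ nA]]|psi [Pp nA]]; split => //; first by case.
    by split; [exact: alpha_star_game_E|move=> Ap; apply: nA].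
  - by rewrite /= preimage_bigcup setI_bigcupr; exact: sU.
move=> _ [{}U oU <-]; pose V := [set psi | @nbhs _ {uniform` `[0%R, T]%classic ->
  'rV[R]_(I + I)} psi [set psi' | game_P M psi' -> U (alpha_star psi')]].
have oV : @open {uniform` `[0%R, T]%classic -> 'rV[R]_(I + I)} V.
  have -> : V = @interior {uniform` `[0%R, T]%classic -> 'rV[R]_(I + I)}
    [set psi' | game_P M psi' -> U (alpha_star psi')] by [].
  exact: open_interior.
rewrite /= (_ : _ `&` _ = game_P M `&` V).
  by apply: sub_sigma_algebra; exists V.
apply/seteqP; split => psi [Pp]; last first.
  move=> /nbhs_singleton H; split => //; split; last exact: H.
  exact: alpha_star_game_E.
move=> [_ Up]; split => //; apply/uniform_nbhsP.
have : @nbhs _ {uniform` `[0%R, T]%classic -> 'rV[R]_I} (alpha_star psi) U.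
  exact: open_nbhs_nbhs.
move=> /uniform_nbhsP[e e0 eU]; have [delta d0 Hd] := alpha_star_cont Pp e0.
by exists delta => // psi' b Pp'; apply: eU; exact: Hd.
Qed.

(** Causality holds because the value at [s] sees the noise only through [free_path] on [0, s], the
    range of the supremum in the regulator. *)
Lemma alpha_star_admissible : admissible_strategy M alpha_star.
Proof.
split; last first.
  move=> psi Pp t t0T i; rewrite dynamicsE /alpha_star addrC subrK.
  by have [H _ _ _] := fmin (min_workload_ge0 Pp t0T); exact: H.
split; [exact: alpha_star_game_E|exact: alpha_star_borel|].
move=> psi psi' t Pp Pp' /andP[t0 tT] agree.
have fp s : 0 <= s <= t -> free_path M psi s = free_path M psi' s.
  by move=> st; have [e1 e2] := agree s st; rewrite /free_path e1 e2.
move=> s /andP[s0 st]; rewrite /alpha_star fp ?s0//.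
have np u : 0 <= u <= t -> netput M psi u = netput M psi' u.
  by move=> ut; rewrite !netputE fp.
congr (f _ - _); rewrite /min_workload /reflection np ?s0//; congr (_ + sup _).
apply/seteqP; split => _ [u /= + <-]; rewrite in_itv /= => /andP[u0 us];
  by exists u; rewrite /= ?in_itv /= ?u0// np// u0 (le_trans us st).
Qed.

Lemma game_cost_alpha_star psi :
  game_cost M psi (alpha_star psi) = (min_cost M f psi - rate M psi)%E.
Proof.
have dE t : dynamics M psi (alpha_star psi) t = f (min_workload M psi t).
  by rewrite dynamicsE /alpha_star addrC subrK.
by rewrite /game_cost /min_cost dE; under eq_integral do rewrite dE.
Qed.

(** Minimality of the Skorohod regulator: an admissible [theta . zeta] is nondecreasing and starts
    at 0, and nonnegative queues force it above [- netput] at every earlier time. *)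
Lemma game_cost_ge alpha psi : admissible_strategy M alpha -> game_P M psi ->
  (min_cost M f psi - rate M psi <= game_cost M psi (alpha psi))%E.
Proof.
move=> [[aE _ _] a0] Pp; have [_ z0 zn] := aE _ Pp.
have W t : 0 <= t <= T -> min_workload M psi t <= dotp (theta M) (dynamics M psi (alpha psi) t).
  move=> /andP[t0 tT].
  have dE s : dotp (theta M) (dynamics M psi (alpha psi) s) =
      netput M psi s + dotp (theta M) (alpha psi s).
    rewrite dynamicsE netputE !dotp_thetaE -weightedD; apply: eq_bigr => i _.
    by rewrite mxE.
  rewrite dE /min_workload /reflection lerD2l; apply: regulator_le => //.
    by rewrite -z0; apply: zn.
  move=> s s0 st; apply: (@le_trans _ _ (dotp (theta M) (alpha psi s))); last exact: zn.
  have : 0 <= dotp (theta M) (dynamics M psi (alpha psi) s).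
    apply: sumr_ge0 => i _; rewrite mulr_ge0 ?(ltW (theta_gt0 mht _))//.
    by apply: a0 => //; rewrite s0 (le_trans st).
  by rewrite dE; lra.
rewrite /game_cost; apply: leeD2r; apply: leeD.
  apply: ge0_integral_le => t /=; rewrite in_itv /= => t0T.
    split => //; first by rewrite lee_fin (running_cost_ge0 mht costs fmin).
    rewrite lee_fin; apply: (hcurve_le mht costs fmin) => //; first exact: min_workload_ge0.
      exact: a0.
    exact: W.
  by rewrite lee_fin; apply: (h_ge0 costs); exact: a0.
have TT := terminal_time mht.
rewrite lee_fin; apply: (gcurve_le mht costs fmin) => //; first exact: min_workload_ge0.
  exact: a0.
exact: W.
Qed.

Lemma game_valueE :
  game_value M = ereal_sup [set (min_cost M f psi - rate M psi)%E | psi in game_P M].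
Proof.
apply/eqP; rewrite eq_le; apply/andP; split.
  apply: (@le_trans _ _ (ereal_sup [set game_cost M psi (alpha_star psi) | psi in game_P M])).
    by apply: ereal_inf_lbound; exists alpha_star => //; exact: alpha_star_admissible.
  by apply: ge_ereal_sup => _ [psi Pp <-]; rewrite game_cost_alpha_star;
     apply: ereal_sup_ubound; exists psi.
apply: le_ereal_inf_tmp => _ [alpha aA <-]; apply: ge_ereal_sup => _ [psi Pp <-].
apply: le_trans (game_cost_ge aA Pp) _; apply: ereal_sup_ubound; by exists psi.
Qed.

(** On the ball around [psi], a bound [min_cost - rate <= v] at [phi] becomes the lower bound
    [min_cost psi - e - v] on the rate of [phi], ready for the closed-set estimate. *)
Lemma min_cost_usc psi (e : R) : game_P M psi -> 0 < e -> exists2 delta : R, 0 < delta &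
  forall psi', game_P M psi' -> cball T psi delta psi' ->
    (min_cost M f psi <= min_cost M f psi' + e%:E)%E.
Proof.
move=> Pp e0; have [D0 [delta0 [d00 _ H0]]] := min_workload_cont Pp ltr01.
have eT : 0 < e / (T + 1) by rewrite divr_gt0// ltr_wpDl// ltW.
have fo := f_orth fmin; case: (costs) => ch cg _.
have [k1 k10 Hk1] := curve_cost_unif_cont cf fo ch D0 eT.
have [k2 k20 Hk2] := curve_cost_unif_cont cf fo cg D0 eT.
have k0 : 0 < Num.min k1 k2 by rewrite lt_min k10.
have [D1 [delta1 [d10 _ H1]]] := min_workload_cont Pp k0.
exists (Num.min delta0 delta1); first by rewrite lt_min d00.
move=> psi' Pp' b.
have b0 : cball T psi delta0 psi'.
  by move=> s s0T j; apply: le_trans (b s s0T j) _; rewrite ge_min lexx.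
have b1 : cball T psi delta1 psi'.
  by move=> s s0T j; apply: le_trans (b s s0T j) _; rewrite ge_min lexx orbT.
have ee : e = T * (e / (T + 1)) + e / (T + 1).
  by field; rewrite lt0r_neq0// ltr_wpDl// ltW.
rewrite /min_cost [in X in (_ <= _ + X)%E]ee EFinD addeACA; apply: leeD.
  apply: integral_le_addr => //; first exact: ltW.
    exact: (running_cost_measurable mht costs cf fmin).
  move=> t t0T; have [a1 a2 _] := H0 _ Pp' b0 t t0T; have [_ _ a3] := H1 _ Pp' b1 t t0T.
  split; [exact: (running_cost_ge0 mht costs fmin)|exact: (running_cost_ge0 mht costs fmin)|].
  have := Hk1 _ _ a1 a2; rewrite le_min in a3; case/andP: a3 => -> _ /(_ isT).
  by rewrite ler_norml => /andP[_]; lra.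
have TT := terminal_time mht.
have [a1 a2 _] := H0 _ Pp' b0 T TT; have [_ _ a3] := H1 _ Pp' b1 T TT.
rewrite -EFinD lee_fin; have := Hk2 _ _ a1 a2; rewrite le_min in a3; case/andP: a3 => _ -> /(_ isT).
by rewrite ler_norml => /andP[_]; lra.
Qed.

End game_value.

(** * Compactness of the sublevels of the rate *)

(** A separate name, so that paths carry the topology of pointwise convergence, to which Tychonoff's
    theorem applies. *)
Definition ptws_path (R : realType) k := prod_topology (fun _ : R => 'rV[R]_k).
HB.instance Definition _ (R : realType) k := Topological.on (ptws_path R k).
HB.instance Definition _ (R : realType) k := Pointed.on (ptws_path R k).

Section holder_paths.
Context {R : realType}.
Variables (T : R) (k : nat).
Hypothesis T0 : 0 < T.
Implicit Types (phi psi : R -> 'rV[R]_k) (e L : R).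

(** A violation of the bound by [eta] at time [t] survives a J1-small perturbation, at the displaced
    time [l t]: the modulus of the center costs one third of [eta] and the J1 distance another. *)
Lemma j1_closed_cball psi e : cpath T k psi -> j1_closed T (rcll T k `&` cball T psi e).
Proof.
move=> cpsi; split; first by move=> phi [].
split; first by move=> phi [].
move=> phi [rphi /not_andP[//|/existsNP[t /not_implyP[t0T /existsNP[i /negP]]]]].
rewrite -ltNge => far; set eta := `|phi t ord0 i - psi t ord0 i| - e.
have eta0 : 0 < eta by rewrite subr_gt0.
have eta30 : 0 < eta / 3 by rewrite divr_gt0.
have [delta d0 Hd] := cpath_unif_cont i cpsi eta30.
exists (Num.min delta (eta / 3)); first by rewrite lt_min d0.
move=> phi' rphi' /(j1_dist_lt (ltW T0))[l [l1 l2 _]]; split => // -[_ H].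
have [lt0T ltt] := l1 t t0T; have h1 := l2 t t0T i; have h2 := H _ lt0T i.
move: ltt h1; rewrite !le_min => /andP[ltt _] /andP[_ h1].
have h3 := Hd _ _ lt0T t0T ltt.
have : `|phi t ord0 i - psi t ord0 i| <= eta / 3 + e + eta / 3.
  have -> : phi t ord0 i - psi t ord0 i = (phi t ord0 i - phi' (l t) ord0 i) +
    (phi' (l t) ord0 i - psi (l t) ord0 i) + (psi (l t) ord0 i - psi t ord0 i) by ring.
  apply: le_trans (ler_normD _ _) _; apply: lerD => //.
  by apply: le_trans (ler_normD _ _) _; exact: lerD.
by move: eta0; rewrite /eta; lra.
Qed.

(* Optimizing over c recovers the 1/2-Hoelder bound with constant
   2 sqrt L; the present form avoids square roots. *)
Definition holder L : set (R -> 'rV[R]_k) :=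
  [set phi | (forall i, phi 0 ord0 i = 0) /\ forall s t i (c : R), 0 < c ->
    `|phi t ord0 i - phi s ord0 i| <= c * `|clamp T t - clamp T s| + L / c].

Lemma holder0 L phi i : holder L phi -> phi 0 ord0 i = 0.
Proof. by case. Qed.

Lemma holder_unif_cont L e : 0 <= L -> 0 < e -> exists2 delta : R, 0 < delta &
  forall phi s t i, holder L phi -> 0 <= s <= T -> 0 <= t <= T -> `|s - t| <= delta ->
    `|phi s ord0 i - phi t ord0 i| <= e.
Proof.
(* Makes [L / c <= e / 2]; the radius [e / (2 * c)] then handles the other half. *)
move=> L0 e0; pose c := 2 * L / e + 1.
have c0 : 0 < c by rewrite ltr_wpDl// divr_ge0 ?mulr_ge0// ltW.
exists (e / (2 * c)); first by rewrite divr_gt0// mulr_gt0.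
move=> phi s t i [_ H] s0T t0T st; apply: le_trans (H t s i c c0) _.
rewrite !clamp_id//.
have h1 : c * `|s - t| <= e / 2.
  by rewrite mulrC -ler_pdivlMr// (le_trans st)// -mulrA invfM.
have h2 : L / c <= e / 2.
  rewrite ler_pdivrMr// /c mulrDr mulr1.
  have -> : e / 2 * (2 * L / e) = L by field; rewrite lt0r_neq0.
  by rewrite lerDl divr_ge0// ltW.
by rewrite (splitr e) lerD.
Qed.

(** Paths of [holder L] share a modulus of continuity, so closeness on a fine enough grid is uniform
    closeness. Relative to [holder L], uniform balls are thus neighborhoods for pointwise
    convergence. *)
Lemma holder_grid L psi e : 0 <= L -> holder L psi -> 0 < e ->
  exists (m : nat) (g : 'I_m -> R), forall phi, holder L phi ->
    (forall l i, `|phi (g l) ord0 i - psi (g l) ord0 i| < e / 4) -> oball T psi e phi.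
Proof.
move=> L0 Hpsi e0; have e40 : 0 < e / 4 by rewrite divr_gt0.
have [delta d0 H] := holder_unif_cont L0 e40.
pose m := (Num.bound (T / delta)).+1; exists m, (fun l : 'I_m => clamp T (l%:R * delta)).
move=> phi Hphi close; exists (3 / 4 * e); first by move: e0; lra.
move=> t t0T i; have /andP[t0 tT] := t0T.
have td0 : 0 <= t / delta by rewrite divr_ge0// ltW.
pose l := Num.truncn (t / delta).
have /andP[l1 l2] : l%:R <= t / delta < l.+1%:R by exact: truncn_itv.
have lm : (l < m)%N.
  rewrite /m ltnS -(ler_nat R); apply: le_trans l1 _.
  apply: (@le_trans _ _ (T / delta)); first by rewrite ler_pM2r// invr_gt0.
  by apply/ltW/archi_boundP; rewrite divr_ge0// ltW.
have [s0T st] : 0 <= l%:R * delta <= T /\ `|t - l%:R * delta| <= delta.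
  rewrite ler_pdivlMr// in l1; rewrite ltr_pdivrMr// -natr1 mulrDl mul1r in l2.
  rewrite mulr_ge0 ?(ltW d0)//= (le_trans l1)//; split => //.
  by rewrite ger0_norm ?subr_ge0//; move: l2; lra.
have := close (Ordinal lm) i; rewrite /= clamp_id//.
have := H phi _ _ i Hphi t0T s0T st; have := H psi _ _ i Hpsi t0T s0T st.
rewrite ltr_norml !ler_norml => /andP[? ?] /andP[? ?] /andP[? ?].
by apply/andP; split; lra.
Qed.

Notation ptws := (ptws_path R k).

Lemma ptws_near (psi : ptws) t i e : 0 < e ->
  nbhs psi [set phi : ptws | `|phi t ord0 i - psi t ord0 i| < e].
Proof.
move=> e0; have /(_ psi) := @proj_continuous R (fun _ => 'rV[R]_k) t.
move=> /(_ [set v | `|v ord0 i - psi t ord0 i| < e]); apply => /=.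
apply/nbhs_ballP; exists e => //= v [_ /(_ ord0 i)]; rewrite /ball /= distrC.
exact.
Qed.

(** The compact set is the product [A] of boxes, and it is covered as a whole: around a path of [A]
    outside [holder L] the violated inequality persists for nearby paths, which gives a neighborhood
    that misses [holder L]. *)
Lemma holder_cover L (delta : (R -> 'rV[R]_k) -> R) : 0 <= L ->
  (forall psi, holder L psi -> 0 < delta psi) ->
  exists (m : nat) (psi : 'I_m -> R -> 'rV[R]_k), (forall j, holder L (psi j)) /\
    forall phi, holder L phi -> exists j, oball T (psi j) (delta (psi j)) phi.
Proof.
(* Comparing with time 0 and taking [c = 1] bounds every coordinate by [T + L]; the degenerate box
   at time 0 encodes the initial condition. *)
move=> L0 dpos; pose B (t : R) := if t == 0 then 0 else T + L.
pose A : set ptws := [set phi | forall t, [set v : 'rV[R]_k |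
  forall i, `[- B t, B t]%classic (v ord0 i)] (phi t)].
have cA : compact A.
  apply: (@tychonoff R (fun _ => 'rV[R]_k) (fun t => [set v : 'rV[R]_k |
    forall i, `[- B t, B t]%classic (v ord0 i)])) => t.
  apply: (@rV_compact _ _ (fun=> `[- B t, B t]%classic)) => i.
  exact: segment_compact.
pose N (psi : ptws) := [set phi : ptws | holder L phi ->
  holder L psi /\ oball T psi (delta psi) phi].
have HA : holder L `<=` A.
  move=> phi Hphi t i; have [_ H] := Hphi.
  have hp0 := holder0 i Hphi; rewrite /= in_itv /= -ler_norml /B.
  have [->|_] := eqVneq t 0; first by rewrite hp0 normr0.
  have := H 0 t i 1 ltr01; rewrite hp0 subr0 divr1 mul1r => /le_trans; apply.
  have /andP[a b] := clamp_itv t (ltW T0).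
  have -> : clamp T 0 = 0 by rewrite clamp_id// lexx ltW.
  by rewrite subr0 ger0_norm//; move: b; lra.
have Nn (psi : ptws) : A psi -> nbhs psi (N psi).
  move=> Apsi; have [Hpsi|nH] := pselect (holder L psi).
    have dp := dpos _ Hpsi; have d4 : 0 < delta psi / 4 by rewrite divr_gt0.
    have [m [g Hg]] := holder_grid L0 Hpsi dp.
    have : \forall phi \near psi, forall l i,
        `|(phi : ptws) (g l) ord0 i - psi (g l) ord0 i| < delta psi / 4.
      pose Q l i (phi : ptws) := `|phi (g l) ord0 i - psi (g l) ord0 i| < delta psi / 4.
      have HQ l : nbhs psi [set phi | forall i, Q l i phi].
        exact: (@filter_forall ptws 'I_k (Q l) (nbhs psi) _ (fun i => ptws_near psi (g l) i d4)).
      exact: (@filter_forall ptws 'I_m (fun l phi => forall i, Q l i phi) (nbhs psi) _ HQ).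
    by apply: filterS => phi close Hphi; split => //; exact: Hg.
  have p0 i : psi 0 ord0 i = 0.
    have := Apsi 0 i; rewrite /= in_itv /= /B eqxx oppr0.
    by move=> h; apply/eqP; rewrite eq_le andbC.
  have : exists s t i (c : R), 0 < c /\
      c * `|clamp T t - clamp T s| + L / c < `|psi t ord0 i - psi s ord0 i|.
    apply: contrapT => H; apply: nH; split => // s t i c c0; rewrite leNgt; apply/negP => h.
    by apply: H; exists s, t, i, c.
  move=> [s [t [i [c [c0]]]]]; rewrite -subr_gt0; set eta := _ - _ => eta0.
  have eta20 : 0 < eta / 2 by rewrite divr_gt0.
  have : \forall phi \near psi, `|(phi : ptws) t ord0 i - psi t ord0 i| < eta / 2 /\
     `|phi s ord0 i - psi s ord0 i| < eta / 2.
    by apply: filterI; exact: ptws_near.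
  apply: filterS => phi [h1 h2] [_ /(_ s t i c c0)] h3; exfalso.
  have : `|psi t ord0 i - psi s ord0 i| <= `|phi t ord0 i - phi s ord0 i| +
      `|phi t ord0 i - psi t ord0 i| + `|phi s ord0 i - psi s ord0 i|.
    have -> : psi t ord0 i - psi s ord0 i = (phi t ord0 i - phi s ord0 i) -
      (phi t ord0 i - psi t ord0 i) + (phi s ord0 i - psi s ord0 i) by ring.
    by apply: le_trans (ler_normD _ _) _; rewrite lerD2r; exact: ler_normB.
  by move: h1 h2 h3; rewrite /eta; lra.
move: cA; rewrite compact_cover => /(_ ptws A (fun psi => interior (N psi)))-/(_ _ _)[].
- move=> psi _; exact: open_interior.
- by move=> psi Apsi; exists psi => //; exact: Nn.
move=> D' D'A cov.
(* Centers outside [holder L] are discarded: their neighborhoods contain no path of [holder L]. *)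
pose s := [seq psi <- (finmap.enum_fset D' : seq ptws) | `[< holder L psi >]].
exists (size s), (fun j => nth (fun _ => 0) s j); split.
  move=> j; have : nth (fun _ => 0) s j \in s by rewrite mem_nth.
  by rewrite mem_filter => /andP[/asboolP].
move=> phi Hphi; have [psi /= psiD] := cov _ (HA _ Hphi).
move=> /interior_subset/(_ Hphi)[Hpsi ob].
have ps : psi \in s by rewrite mem_filter asboolT.
have js : (index psi s < size s)%N by rewrite index_mem.
by exists (Ordinal js) => /=; rewrite nth_index.
Qed.

End holder_paths.

Section action_bound.
Context {R : realType}.
Variable T : R.
Hypothesis T0 : 0 < T.

Lemma action_ge0 k (v : 'I_k -> R) phi : (forall i, 0 < v i) -> (0 <= action T v phi)%E.
Proof.
move=> v0; rewrite /action; case: ifP => // _; apply: mule_ge0; first by rewrite lee_fin.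
apply: sume_ge0 => i _; apply: mule_ge0; first by rewrite lee_fin invr_ge0 ltW.
by apply: integral_ge0 => t _; rewrite lee_fin sqr_ge0.
Qed.

(** One summand of the action bounds the integral of the squared derivative by [2 * (v i * K)],
    which [abs_continuous_increment] converts into an increment bound. *)
Lemma action_increment k (v : 'I_k -> R) phi (K s t c : R) i : (forall i, 0 < v i) ->
  (action T v phi <= K%:E)%E -> 0 <= s -> s <= t -> t <= T -> 0 < c ->
  `|phi t ord0 i - phi s ord0 i| <= c * (t - s) + v i * K / c.
Proof.
move=> v0; rewrite /action; case: ifP => [/asboolP[ac _] HK|]; last by rewrite leye_eq.
move=> s0 st tT c0.
set J := (fun i => \int[@lebesgue_measure R]_(x in `[0%R, T])
  (derive1 (fun u => phi u ord0 i) x ^+ 2)%:E)%E in HK *.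
have J0 j : (0 <= J j)%E by apply: integral_ge0 => x _; rewrite lee_fin sqr_ge0.
have vJ j : (0 <= ((v j)^-1)%:E * J j)%E.
  by apply: mule_ge0 => //; rewrite lee_fin invr_ge0 ltW.
have JK : (J i <= (2 * (v i * K))%:E)%E.
  have h : ((2^-1)%:E * (((v i)^-1)%:E * J i) <= K%:E)%E.
    apply: le_trans HK; apply: lee_wpmul2l; first by rewrite lee_fin.
    by rewrite (bigD1 i)//= leeDl// sume_ge0.
  rewrite muleA -EFinM -lee_pdivlMl in h; last by rewrite mulr_gt0 ?invr_gt0.
  apply: le_trans h _; rewrite -EFinM lee_fin invfM !invrK mulrA; exact: lexx.
have := abs_continuous_increment T0 (ac i) s0 st tT c0; rewrite -/(J i) => /le_trans h.
rewrite -lee_fin; apply: h.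
apply: (@le_trans _ _ ((c / 2 * (t - s))%:E + ((2 * c)^-1)%:E * (2 * (v i * K))%:E)%E).
  by rewrite leeD2l// lee_wpmul2l// lee_fin invr_ge0 mulr_ge0// ltW.
rewrite -EFinM -EFinD lee_fin; apply: lerD.
  by rewrite ler_wpM2r ?subr_ge0// ler_pdivrMr// ler_peMr ?ltW// ltr1n.
by rewrite invfM mulrACA mulVf// mul1r mulrC.
Qed.

Lemma action_phi0 k (v : 'I_k -> R) phi (K : R) i : (action T v phi <= K%:E)%E ->
  phi 0 ord0 i = 0.
Proof.
rewrite /action; case: ifP => [/asboolP[_ ->] _|_]; last by rewrite leye_eq.
by rewrite ?mxE.
Qed.

End action_bound.

(** * Queue lengths under a control *)

Section cumulated.
Context {R : realType}.
Variable T : R.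
Hypothesis T0 : 0 < T.
Notation leb := (@lebesgue_measure R).
Implicit Types (g : R -> R) (s t : R).

(** The step function [h m] evaluates [g] at the next grid point to the right, clamped to [T], so
    the approximations converge pointwise by right continuity. *)
Lemma right_cont_measurable g : right_cont T g -> measurable_fun `[0, T] g.
Proof.
move=> rg; pose delta m : R := m.+1%:R^-1.
have d0 m : 0 < delta m by rewrite invr_gt0.
pose N m := (Num.truncn (T / delta m)).+1.
pose J m (l : nat) : set R := `[l%:R * delta m, l.+1%:R * delta m[%classic.
pose h m s := \sum_(l < N m) g (clamp T (l.+1%:R * delta m)) * \1_(J m l) s.
have mh m : measurable_fun `[0, T] (h m).
  apply: measurable_sum => l; apply: measurable_funM => //.
  by apply: measurable_indic; exact: measurable_itv.
have hE m s : 0 <= s <= T -> exists2 q, s < q <= s + delta m & h m s = g (clamp T q).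
  move=> /andP[s0 sT]; have sd0 : 0 <= s / delta m by rewrite divr_ge0// ltW.
  pose l := Num.truncn (s / delta m).
  have /andP[l1 l2] : l%:R <= s / delta m < l.+1%:R by exact: truncn_itv.
  have lN : (l < N m)%N.
    rewrite -(ltr_nat R); apply: (le_lt_trans l1); apply: (@le_lt_trans _ _ (T / delta m)).
      by rewrite ler_pM2r// invr_gt0.
    have : 0 <= T / delta m by rewrite divr_ge0// ltW.
    by move=> /truncn_itv/andP[_]; rewrite /N.
  rewrite ler_pdivlMr// in l1; rewrite ltr_pdivrMr// in l2.
  exists (l.+1%:R * delta m); first by rewrite l2 -natr1 mulrDl mul1r lerD2r.
  rewrite /h (bigD1 (Ordinal lN))//= big1 => [|j jl].
    by rewrite addr0 indicE mem_set ?mulr1// /J /= in_itv /= l1.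
  rewrite indicE memNset ?mulr0// /J /= in_itv /= => /andP[j1 j2].
  move/eqP: jl; apply; apply/val_inj => /=; apply/eqP; rewrite eqn_leq.
  have := le_lt_trans j1 l2; have := le_lt_trans l1 j2.
  by rewrite !ltr_pM2r// !ltr_nat !ltnS => -> ->.
apply: (@measurable_fun_cvg _ _ _ _ h) => // s /=; rewrite in_itv /= => s0T.
have /andP[s0 sT] := s0T; apply/cvgrPdist_le => e e0.
have [sE|sn] := eqVneq s T.
  apply: nearW => m; have [q /andP[sq _] ->] := hE m s s0T.
  by rewrite clamp_ge ?(ltW T0)//; [rewrite -sE subrr normr0 ltW|rewrite -sE ltW].
have sT' : 0 <= s < T by rewrite s0 lt_neqAle sn.
have [k k0 Hk] := rg s sT' e e0.
have kT : 0 < Num.min k (T - s) by rewrite lt_min k0 subr_gt0; case/andP: sT'.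
near=> m; have [q /andP[sq qs] ->] := hE m s s0T.
have dm : delta m < Num.min k (T - s) by near: m; exact: near_infty_natSinv_lt (PosNum kT).
rewrite lt_min in dm; case/andP: dm => dk dT.
rewrite distrC clamp_id; last by rewrite (le_trans s0 (ltW sq)) /=; move: qs dT; lra.
by apply: Hk; [exact: ltW|move: qs dk; lra].
Unshelve. all: by end_near. Qed.

Definition cumul g t := \int[leb]_(s in `[0, t]) g s.

Lemma leb_bounded (J : interval R) s t : [set` J] `<=` `[s, t]%classic -> (leb [set` J] < +oo)%E.
Proof.
move=> Jst; apply: (@le_lt_trans _ _ (leb `[s, t]%classic)).
  by apply: le_measure => //; rewrite inE; exact: measurable_itv.
by rewrite lebesgue_measure_itv /=; case: ifP => _; rewrite -?EFinD ?ltry.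
Qed.

Lemma leb_itvoc s t : s <= t -> fine (leb `]s, t]%classic) = t - s.
Proof.
rewrite le_eqVlt => /predU1P[->|st].
  by rewrite set_itv_ge ?bnd_simp ?ltxx// measure0 subrr.
by rewrite lebesgue_measure_itv /= lte_fin st -EFinD.
Qed.

Lemma leb_itvoo s t : s <= t -> fine (leb `]s, t[%classic) = t - s.
Proof.
rewrite le_eqVlt => /predU1P[->|st].
  by rewrite set_itv_ge ?bnd_simp ?ltxx// measure0 subrr.
by rewrite lebesgue_measure_itv /= lte_fin st -EFinD.
Qed.

Lemma cst_integrable s t : leb.-integrable `]s, t] (EFin \o cst (1 : R)).
Proof.
apply: measurable_bounded_integrable; [exact: measurable_itv| |exact: measurable_cst|].
  by apply: (@leb_bounded _ s t); apply: subset_itv; rewrite bnd_simp.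
by exists 1; split => // x x1 y _; rewrite /= normr1 ltW.
Qed.

Section rates.
Variable g : R -> R.
Hypothesis rg : right_cont T g.
Hypothesis g01 : forall t, 0 <= t <= T -> 0 <= g t <= 1.

Lemma rate_integrable : leb.-integrable `[0, T] (EFin \o g).
Proof.
apply: measurable_bounded_integrable => //.
- exact: (@leb_bounded _ 0 T).
- exact: right_cont_measurable.
exists 1; split => // x x1 t /=; rewrite in_itv /= => /g01/andP[g0 g1].
by rewrite ger0_norm// (le_trans g1)// ltW.
Qed.

Lemma rate_integrable_sub (J : interval R) : [set` J] `<=` `[0, T] ->
  leb.-integrable [set` J] (EFin \o g).
Proof. by move=> JT; apply: integrableS rate_integrable => //; exact: measurable_itv. Qed.

Lemma cumul0 : cumul g 0 = 0.
Proof. by rewrite /cumul set_itv1 Rintegral_set1. Qed.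

Lemma cumulB s t : 0 <= s -> s <= t -> t <= T ->
  cumul g t - cumul g s = \int[leb]_(x in `]s, t]) g x.
Proof.
move=> s0 st tT; apply: (@Rintegral_itvB _ g (BLeft 0) (BRight t) s); rewrite ?bnd_simp//.
by apply: rate_integrable_sub; apply: subset_itv; rewrite bnd_simp.
Qed.

Let sub_T s t : 0 <= s -> t <= T -> `]s, t]%classic `<=` `[0, T]%classic.
Proof. by move=> s0 tT; apply: subset_itv; rewrite bnd_simp. Qed.

Lemma cumul_nd s t : 0 <= s -> s <= t -> t <= T -> cumul g s <= cumul g t.
Proof.
move=> s0 st tT; rewrite -subr_ge0 cumulB//; apply: Rintegral_ge0 => x /(sub_T s0 tT) /=.
by rewrite in_itv /= => /g01/andP[].
Qed.

Lemma cumul_lip s t : 0 <= s -> s <= t -> t <= T -> cumul g t - cumul g s <= t - s.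
Proof.
move=> s0 st tT; rewrite cumulB//.
have -> : t - s = \int[leb]_(x in `]s, t]) cst 1 x.
  by rewrite Rintegral_cst ?leb_itvoc ?mul1r//; exact: measurable_itv.
apply: le_Rintegral; first exact: measurable_itv.
- by apply: rate_integrable_sub; exact: sub_T.
- exact: cst_integrable.
by move=> x /(sub_T s0 tT) /=; rewrite in_itv /= => /g01/andP[].
Qed.

Lemma cumul_step s t c : 0 <= s -> s <= t -> t <= T ->
  (forall x, s <= x -> x < t -> g x = c) -> cumul g t = cumul g s + c * (t - s).
Proof.
move=> s0 st tT gc; apply/eqP; rewrite addrC -subr_eq cumulB//; apply/eqP.
rewrite -Rintegral_itv_bndo_bndc; last first.
  apply: rate_integrable_sub; apply: subset_trans (sub_T s0 tT).
  by apply: subset_itvl; rewrite bnd_simp.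
rewrite (@eq_Rintegral _ _ _ _ _ (cst c)); last first.
  by move=> x; rewrite inE /= in_itv /= => /andP[sx xt]; apply: gc => //; exact: ltW.
by rewrite Rintegral_cst ?leb_itvoo//; exact: measurable_itv.
Qed.

End rates.

Lemma cumul_sum (I : nat) (b : 'I_I -> R -> R) s t : (forall i, right_cont T (b i)) ->
  (forall t, 0 <= t <= T -> (forall i, 0 <= b i t <= 1) /\ \sum_i b i t <= 1) ->
  0 <= s -> s <= t -> t <= T -> \sum_i (cumul (b i) t - cumul (b i) s) <= t - s.
Proof.
move=> rb b01 s0 st tT; pose g u := \sum_i b i u.
have ib i : leb.-integrable `]s, t] (EFin \o b i).
  apply: (rate_integrable_sub (rb i)) => [u u0T|]; last by apply: subset_itv; rewrite bnd_simp.
  by have [] := b01 u u0T.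
have mst : measurable (`]s, t]%classic : set (measurableTypeR R)) by exact: measurable_itv.
(* Stated for sequences so that integrability and additivity are proved together by induction. *)
have sumE (r : seq 'I_I) : leb.-integrable `]s, t] (EFin \o (fun x => \sum_(i <- r) b i x)) /\
    \sum_(i <- r) (cumul (b i) t - cumul (b i) s) =
    \int[leb]_(x in `]s, t]) (\sum_(i <- r) b i x).
  elim: r => [|i r [ih1 ih2]].
    have -> : (fun x : R => \sum_(i <- [::]) b i x) = cst 0.
      by apply/funext => x; rewrite big_nil.
    by rewrite big_nil Rintegral_cst// mul0r; split => //; exact: integrable0.
  have -> : (fun x : R => \sum_(i <- i :: r) b i x) = (fun x => b i x + \sum_(i <- r) b i x).
    by apply/funext => x; rewrite big_cons.
  rewrite big_cons; split.
    by rewrite (_ : _ \o _ = (EFin \o b i) \+ (EFin \o (fun x => \sum_(i <- r) b i x)))//;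
      exact: integrableD.
  rewrite RintegralD// ih2 cumulB// => u u0T; by have [] := b01 u u0T.
have [_ ->] := sumE (index_enum _).
apply: (@le_trans _ _ (\int[leb]_(x in `]s, t]) cst 1 x)).
  apply: le_Rintegral => //; first by have [] := sumE (index_enum _).
    exact: cst_integrable.
  move=> x /=; rewrite in_itv /= => /andP[sx xt].
  by have [|_] := b01 x; first by rewrite (le_trans s0 (ltW sx)) (le_trans xt).
by rewrite Rintegral_cst// leb_itvoc// mul1r.
Qed.

End cumulated.

Section queue_length.
Context {R : realType}.
Variables (T ra rs : R) (xa xs : nat -> R) (X0 : nat) (Z b : R -> R).
Hypotheses (T0 : 0 < T) (ra0 : 0 < ra) (rs0 : 0 < rs).
Hypotheses (xa0 : forall l, 0 < xa l) (xs0 : forall l, 0 < xs l).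
Hypothesis ea : exists m, T < epoch ra xa m.
Hypothesis es : exists m, T < epoch rs xs m.
Hypothesis Z0 : Z 0 = 0.
Hypothesis Znd : forall s t, 0 <= s -> s <= t -> t <= T -> Z s <= Z t.
Hypothesis Zlip : forall s t, 0 <= s -> s <= t -> t <= T -> Z t - Z s <= t - s.
Hypothesis Zconst : forall s t, 0 <= s -> s <= t -> t <= T ->
  (forall x, s <= x -> x < t -> b x = 0) -> Z t = Z s.
Hypothesis idle : forall t, 0 <= t <= T ->
  X0%:R + renewal_count ra xa t - renewal_count rs xs (Z t) = 0 -> b t = 0.

Let A := renewal_count ra xa.

Lemma clock_itv t : 0 <= t <= T -> 0 <= Z t <= t.
Proof.
move=> /andP[t0 tT]; have := Znd (lexx 0) t0 tT; rewrite Z0 => ->/=.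
by have := Zlip (lexx 0) t0 tT; rewrite Z0 !subr0.
Qed.

(* A service completion needs a customer: the server does not work on an
   empty class just before the k-th completion. *)
Lemma service_le_arrival k t : 0 <= t <= T -> epoch rs xs k <= Z t -> k%:R <= X0%:R + A t.
Proof.
elim: k t => [|k ih] t t0T Ek; first by rewrite addr_ge0// renewal_count_ge0.
rewrite leNgt; apply/negP => lt.
have [m Tm] := ea; have /andP[t0 tT] := t0T.
have [a aE] := renewal_count_nat ra0 xa0 t.
have Xk : X0%:R + A t <= k%:R.
  by move: lt; rewrite /A aE -natrD ltr_nat ler_nat ltnS.
pose U := [set u | 0 <= u <= t /\ Z u < epoch rs xs k.+1].
have Ek0 : 0 < epoch rs xs k.+1.
  by rewrite -[X in X < _](epoch0 rs xs); apply: epoch_lt.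
have supU : has_sup U.
  split; first by exists 0; split; rewrite ?lexx ?t0// Z0.
  by exists t => u [/andP[]].
(* The instant of completion number [k.+1]: the clock is below that epoch before [s] and, by [Zs],
   has reached it at [s]. *)
pose s := sup U.
have s0 : 0 <= s by apply: ub_le_sup; [case: supU|split; rewrite ?lexx ?t0// Z0].
have st : s <= t by apply: ge_sup; [case: supU|move=> u [/andP[]]].
have sT := le_trans st tT.
have Zs : epoch rs xs k.+1 <= Z s.
  rewrite leNgt; apply/negP => h; pose g := epoch rs xs k.+1 - Z s.
  have g0 : 0 < g by rewrite subr_gt0.
  have st' : s < t.
    by rewrite lt_neqAle st andbT; apply/eqP => e; move: h; rewrite e ltNge Ek.
  pose u := Num.min t (s + g / 2).
  have su : s < u by rewrite lt_min st' ltrDl divr_gt0.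
  have ut : u <= t by rewrite ge_min lexx.
  have us : u <= s + g / 2 by rewrite ge_min lexx orbT.
  have : u <= s.
    apply: ub_le_sup; first by case: supU.
    split; first by rewrite (le_trans s0 (ltW su)).
    have := Zlip s0 (ltW su) (le_trans ut tT); move: us g0; rewrite /g; lra.
  by rewrite leNgt su.
have below u : 0 <= u -> u < s -> Z u < epoch rs xs k.+1.
  move=> u0 us; have : 0 < s - u by rewrite subr_gt0.
  move=> /(sup_adherent)/(_ supU)[v [/andP[v0 vt] Zv]]; rewrite -/s opprB addrC subrK => uv.
  exact: le_lt_trans (Znd u0 (ltW uv) (le_trans vt tT)) Zv.
pose g := epoch rs xs k.+1 - epoch rs xs k.
have g0 : 0 < g by rewrite subr_gt0 epochS.
have s00 : 0 < s.
  rewrite lt_neqAle s0 andbT; apply/eqP => e; move: Zs; rewrite -e Z0.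
  by rewrite leNgt Ek0.
(* Going back by at most one service requirement [g] keeps the clock above epoch [k]. On [u0, s[ the
   induction hypothesis and [Xk] make the queue exactly 0, so the server idles there and the clock
   cannot have advanced to its value at [s]. *)
pose u0 := Num.max 0 (s - g).
have u00 : 0 <= u0 by rewrite le_max lexx.
have u0s : u0 < s by rewrite gt_max s00 ltrBlDr ltrDl.
have : Z s = Z u0.
  apply: Zconst => //; first exact: ltW.
  move=> x u0x xs'; have x0 := le_trans u00 u0x; have xT := ltW (lt_le_trans xs' sT).
  have x0T : 0 <= x <= T by rewrite x0.
  have Zx : epoch rs xs k <= Z x.
    have := Zlip x0 (ltW xs') sT.
    have : s - g <= x by apply: le_trans u0x; rewrite le_max lexx orbT.
    by move: Zs; rewrite /g; lra.
  apply: idle => //; rewrite (@renewal_countE _ _ _ rs0 xs0 k); last by rewrite Zx below.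
  apply/eqP; rewrite subr_eq0 eq_le; apply/andP; split; last exact: ih.
  apply: le_trans Xk; rewrite lerD2l; apply: (renewal_count_le ra0 xa0 (m := m)).
    exact: le_trans (ltW xs') st.
  exact: le_lt_trans tT Tm.
by move: (below _ u00 u0s) Zs; lra.
Qed.

Lemma queue_nonneg t : 0 <= t <= T ->
  0 <= X0%:R + renewal_count ra xa t - renewal_count rs xs (Z t).
Proof.
move=> t0T; have [m Tm] := es; have /andP[Zt0 Zt] := clock_itv t0T.
have /andP[_ tT] := t0T.
have [l _ lE] := epoch_bracket Zt0 (le_lt_trans (le_trans Zt tT) Tm).
rewrite (renewal_countE rs0 xs0 lE) subr_ge0; apply: service_le_arrival => //.
by case/andP: lE.
Qed.

End queue_length.

Section model_paths.
Context {R : realType} {d : measure_display} {Omega : measurableType d}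
  {P : probability Omega R} {I : nat}.
Variable M : queue_model P I.
Hypothesis prim : renewal_primitives M.
Hypothesis mht : moderate_heavy_traffic M.
Notation T := (horizon M).
Implicit Types (n : nat) (w : Omega) (i : 'I_I) (B : @control R d Omega I).

Let T0 : 0 < T := horizon_gt0 mht.

Lemma primitive_lshift n i w t : renewal_count (prim_rate M n (lshift I i))
  (primitive M (lshift I i) ^~ w) t = An M n i t w.
Proof.
rewrite /prim_rate /primitive /An; have -> // : fintype.split (lshift I i) = inl i.
exact: (unsplitK (inl _ i)).
Qed.

Lemma primitive_rshift n i w t : renewal_count (prim_rate M n (rshift I i))
  (primitive M (rshift I i) ^~ w) t = Sn M n i t w.
Proof.
rewrite /prim_rate /primitive /Sn; have -> // : fintype.split (rshift I i) = inr i.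
exact: (unsplitK (inr _ i)).
Qed.

Section control_path.
Variables (n : nat) (B : @control R d Omega I) (w : Omega).
Hypothesis n0 : (0 < n)%N.
Hypothesis Badm : admissible M n B.
Hypothesis ne : no_explosion M n w.

Let rb i : right_cont T (fun t => B w t ord0 i).
Proof. by apply: rcll_right_cont; case: Badm => + _ _ _; exact. Qed.

Let b01 i t : 0 <= t <= T -> 0 <= B w t ord0 i <= 1.
Proof. by case: Badm => _ /(_ w t) + _ _ => /[apply] -[]. Qed.

Lemma busyE i t : busy B i t w = cumul (fun t => B w t ord0 i) t.
Proof. by []. Qed.

Lemma busy_facts : [/\ forall i, busy B i 0 w = 0,
  forall i t u, 0 <= t -> t <= u -> u <= T -> busy B i t w <= busy B i u w &
  forall t u, 0 <= t -> t <= u -> u <= T ->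
    \sum_i (busy B i u w - busy B i t w) <= u - t].
Proof.
split => [i|i t u|t u].
- exact: cumul0.
- exact: (cumul_nd T0 (rb i) (@b01 i)).
- apply: (cumul_sum T0 rb) => s s0T; by case: Badm => _ /(_ w s s0T).
Qed.

Lemma queue_ge0 i t : 0 <= t <= T -> 0 <= Xn M n B i t w.
Proof.
rewrite /Xn -(primitive_lshift n i w t) -(primitive_rshift n i w (busy B i t w)).
apply: (@queue_nonneg _ T _ _ _ _ (X0 M n i) (fun t => busy B i t w)
  (fun t => B w t ord0 i)) => //.
- exact: prim_rate_gt0.
- exact: prim_rate_gt0.
- by move=> l; exact: primitive_gt0.
- by move=> l; exact: primitive_gt0.
- exact: (ne (lshift I i)).
- exact: (ne (rshift I i)).
- exact: cumul0.
- by move=> s u; exact: (cumul_nd T0 (rb i) (@b01 i)).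
- by move=> s u; exact: (cumul_lip T0 (rb i) (@b01 i)).
- move=> s u s0 su uT bz; rewrite !busyE.
  by rewrite (cumul_step T0 (rb i) (@b01 i) s0 su uT bz) mul0r addr0.
- move=> s s0T; rewrite primitive_lshift primitive_rshift.
  by case: Badm => _ _ _ /(_ w s i s0T).
Qed.

Definition speedup : R := n%:R / scale M n.

Lemma X_tildeE i t : X_tilde M n B t w ord0 i = Xn M n B i t w / scale M n.
Proof. by rewrite mxE. Qed.

Lemma X_tilde_ge0 t : 0 <= t <= T -> orthant I (X_tilde M n B t w).
Proof.
move=> t0T i; rewrite X_tildeE divr_ge0 ?queue_ge0// ltW//.
exact: scale_gt0.
Qed.

(** Substituting [lamn = n * lam + scale * dl], and likewise for [mun], splits the scaled drift into
    the fast part with factor [speedup] and the moderate drifts. *)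
Lemma prelimit_path (p1 p2 : 'I_I -> R -> R) (delta : R) :
  (forall i, [/\ `|(X0 M n i)%:R / scale M n - x0 M ord0 i| <= delta,
    `|(lamn M n i - n%:R * lam M i) / scale M n - dlam M i| <= delta &
    `|(mun M n i - n%:R * mu M i) / scale M n - dmu M i| <= delta]) ->
  (forall i t, 0 <= t <= T -> `|AS_tilde M n w t ord0 (lshift I i) - p1 i t| <= delta /\
     `|AS_tilde M n w t ord0 (rshift I i) - p2 i t| <= delta) ->
  prelimit T (lam M) (mu M) (dlam M) (dmu M) (fun i => x0 M ord0 i) p1 p2 delta
    speedup (fun i => (X0 M n i)%:R / scale M n)
    (fun i => (lamn M n i - n%:R * lam M i) / scale M n)
    (fun i => (mun M n i - n%:R * mu M i) / scale M n)
    (fun i t => AS_tilde M n w t ord0 (lshift I i))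
    (fun i t => AS_tilde M n w t ord0 (rshift I i))
    (fun i t => busy B i t w) (fun i t => X_tilde M n B t w ord0 i).
Proof.
move=> Hp Hb; have s0 := scale_gt0 mht n0; split => //.
- exact: busy_facts.
- move=> i t t0T; rewrite X_tildeE !AS_tildeE primitive_lshift primitive_rshift /Xn.
  have -> : prim_rate M n (lshift I i) = lamn M n i.
    by rewrite /prim_rate (unsplitK (inl _ i)).
  have -> : prim_rate M n (rshift I i) = mun M n i.
    by rewrite /prim_rate (unsplitK (inr _ i)).
  by rewrite /speedup; field; rewrite lt0r_neq0.
- by move=> i t t0T; exact: X_tilde_ge0.
Qed.

Lemma workload_X_tilde t : workload (mu M) (fun i t => X_tilde M n B t w ord0 i) t =
  dotp (theta M) (X_tilde M n B t w).
Proof. by rewrite dotp_thetaE. Qed.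

End control_path.

(** The speed equals [sqrt n / bn], the inverse of a positive sequence tending to 0. *)
Lemma speedup_large (r0 : R) : \forall n \near \oo, r0 <= speedup n.
Proof.
case: mht => _ [bpos _ /cvgrPdist_lt bs] _ _ _.
have e0 : 0 < (`|r0| + 1)^-1 by rewrite invr_gt0 ltr_wpDl.
apply: filterS2 (nbhs_infty_gt 0) (bs _ e0) => n n0.
have b0 := bpos n n0; have s0 : 0 < Num.sqrt n%:R :> R by rewrite sqrtr_gt0 ltr0n.
rewrite sub0r normrN gtr0_norm ?divr_gt0//.
rewrite -[X in X < _]invrK ltf_pV2 ?posrE ?invr_gt0 ?divr_gt0 ?ltr_wpDl// invf_div => h.
have -> : speedup n = Num.sqrt n%:R / bn M n.
  rewrite /speedup /scale -[X in X / _](@sqr_sqrtr _ n%:R)//.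
  by field; rewrite !lt0r_neq0.
by apply/ltW/(le_lt_trans _ h); have := ler_norm r0; lra.
Qed.

Lemma parameters_close (delta : R) : 0 < delta -> \forall n \near \oo, forall i,
  [/\ `|(X0 M n i)%:R / scale M n - x0 M ord0 i| <= delta,
    `|(lamn M n i - n%:R * lam M i) / scale M n - dlam M i| <= delta &
    `|(mun M n i - n%:R * mu M i) / scale M n - dmu M i| <= delta].
Proof.
move=> d0; case: mht => _ _ lamP muP [_ xP].
apply: filter_forall => i; have [_ _ _ /cvgrPdist_le/(_ _ d0) h1] := lamP i.
have [_ _ _ /cvgrPdist_le/(_ _ d0) h2] := muP i.
have [_ /cvgrPdist_le/(_ _ d0) h3] := xP i.
by apply: filterS3 h1 h2 h3 => n; rewrite ![`|_ - _ / _|]distrC.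
Qed.

End model_paths.

(** * Lower bound *)

Section lower_bound.
Context {R : realType} {d : measure_display} {Omega : measurableType d}
  {P : probability Omega R} {I : nat}.
Variable M : queue_model P I.
Hypothesis prim : renewal_primitives M.
Hypothesis mht : moderate_heavy_traffic M.
Hypothesis costs : cost_functions M.
Variable f : R -> 'rV[R]_I.
Hypothesis cf : {within `[0, +oo[, continuous f}.
Hypothesis fmin : forall w : R, 0 <= w ->
  let level := [set q | orthant I q /\ dotp (theta M) q = w] in
  [/\ orthant I (f w), dotp (theta M) (f w) = w,
      cost_h M (f w) = inf [set cost_h M q | q in level] &
      cost_g M (f w) = inf [set cost_g M q | q in level]].
Notation T := (horizon M).
Notation leb := (@lebesgue_measure R).
Implicit Types (psi : R -> 'rV[R]_(I + I)) (n : nat) (w : Omega) (i : 'I_I).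

Let T0 : 0 < T := horizon_gt0 mht.

Lemma path1E psi i t : path1 psi i t = psi t ord0 (lshift I i).
Proof. by rewrite /path1 mxE. Qed.

Lemma path2E psi i t : path2 psi i t = psi t ord0 (rshift I i).
Proof. by rewrite /path2 mxE. Qed.

Definition path_cost n (B : @control R d Omega I) w : \bar R :=
  (\int[leb]_(s in `[0%R, T]) (cost_h M (X_tilde M n B s w))%:E
   + (cost_g M (X_tilde M n B T w))%:E)%E.

Lemma JnE n (B : @control R d Omega I) : Jn M n B = (((bn M n ^+ 2)^-1)%:E *
  lne (\int[P]_w expeR ((bn M n ^+ 2)%:E * path_cost n B w)))%E.
Proof. by []. Qed.

(** [delta] and the threshold on [n] are chosen before the control, so the bound is uniform over all
    admissible controls. *)
Lemma path_cost_ge psi (e : R) : game_P M psi -> 0 < e -> exists2 delta : R, 0 < delta &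
  \forall n \near \oo, forall B w, admissible M n B -> no_explosion M n w ->
    cball T psi delta (AS_tilde M n w) -> (min_cost M f psi <= path_cost n B w + e%:E)%E.
Proof.
move=> Pp e0; have [C [u1 u2 b1 b2]] := game_path mht Pp.
have [D D0 HD] := min_workload_itv mht Pp.
have eT : 0 < e / (T + 1) by rewrite divr_gt0// ltr_wpDl// ltW.
have fo := f_orth fmin; case: (costs) => ch cg _.
have [k1 k10 Hk1] := curve_cost_unif_cont cf fo ch D eT.
have [k2 k20 Hk2] := curve_cost_unif_cont cf fo cg D eT.
have k0 : 0 < Num.min k1 k2 by rewrite lt_min k10.
have [delta [r0 [d0 r00 HF]]] := fluid_lower (dlam M) (dmu M) (fun i => x0 M ord0 i)
  T0 (lam_gt0 mht) (mu_gt0 mht) (critical_load mht) u2 b1 b2 k0.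
exists delta => //; near=> n => B w aB ne bw.
have n0 : (0 < n)%N by near: n; exact: nbhs_infty_gt.
have pre := prelimit_path prim mht n0 aB ne (p1 := path1 psi) (p2 := path2 psi)
  (delta := delta).
have {}pre := HF _ _ _ _ _ _ _ _ _ (lexx delta) _ (pre _ _).
have G t : 0 <= t <= T -> min_workload M psi t <=
    dotp (theta M) (X_tilde M n B t w) + Num.min k1 k2.
  move=> t0T; rewrite -workload_X_tilde; apply: pre => //.
  - by near: n; exact: speedup_large.
  - by near: n; exact: parameters_close.
  - move=> i s s0T; rewrite path1E path2E; split; exact: bw.
have low (c : 'rV[R]_I -> R) k : cost_function c -> 0 < k ->
    (forall (v : R) q, 0 <= v -> orthant I q -> v <= dotp (theta M) q -> c (f v) <= c q) ->
    (forall s t, 0 <= s <= D -> 0 <= t <= D -> `|s - t| <= k ->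
      `|c (f s) - c (f t)| <= e / (T + 1)) ->
    Num.min k1 k2 <= k -> forall t, 0 <= t <= T ->
    c (f (min_workload M psi t)) <= c (X_tilde M n B t w) + e / (T + 1).
  move=> cc kp cle ck kk t t0T; have /andP[m0 mD] := HD t t0T.
  (* A level that the actual workload dominates and that lies within [Num.min k1 k2] of the minimal
     workload: monotonicity gives [c (f v) <= c X], and the modulus of the curve cost does the
     rest. *)
  pose v := Num.max 0 (min_workload M psi t - Num.min k1 k2).
  have v0 : 0 <= v by rewrite le_max lexx.
  have vm : v <= min_workload M psi t.
    by rewrite ge_max m0 gerBl ltW.
  have h1 : `|c (f (min_workload M psi t)) - c (f v)| <= e / (T + 1).
    apply: ck; rewrite ?m0 ?v0 ?(le_trans vm)//.
    apply: le_trans kk; rewrite ger0_norm ?subr_ge0//.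
    by rewrite lerBlDr -lerBlDl le_max lexx orbT.
  have h2 : c (f v) <= c (X_tilde M n B t w).
    have oX : orthant I (X_tilde M n B t w) by exact: (X_tilde_ge0 prim mht n0 aB ne).
    apply: cle => //; rewrite ge_max; apply/andP; split; last by rewrite lerBlDr G.
    by apply: sumr_ge0 => i _; rewrite mulr_ge0// ltW// theta_gt0.
  by move: h1; rewrite ler_norml => /andP[_]; move: h2; lra.
have ee : e = T * (e / (T + 1)) + e / (T + 1).
  by field; rewrite lt0r_neq0// ltr_wpDl// ltW.
rewrite /min_cost /path_cost [in X in (_ <= _ + X)%E]ee EFinD addeACA; apply: leeD.
  apply: integral_le_addr => //; first exact: ltW.
    exact: (running_cost_measurable mht costs cf fmin).
  move=> t t0T; split; first exact: (running_cost_ge0 mht costs fmin).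
    by apply: (h_ge0 costs); exact: (X_tilde_ge0 prim mht n0 aB ne).
  apply: (low _ _ ch k10) => //; last by rewrite ge_min lexx.
  by move=> v q; exact: (hcurve_le mht costs fmin).
rewrite -EFinD lee_fin; apply: (low _ _ cg k20) => //; last exact: terminal_time.
  by move=> v q; exact: (gcurve_le mht costs fmin).
by rewrite ge_min lexx orbT.
Unshelve. all: by end_near. Qed.

Lemma rate_ge0 psi : (0 <= rate M psi)%E.
Proof.
case: prim => _ _ _ _ sp; apply: adde_ge0; apply: action_ge0 => i; have [a b _ _] := sp i 0%N.
  by rewrite mulr_gt0 ?lam_gt0// exprn_gt0.
by rewrite mulr_gt0 ?mu_gt0// exprn_gt0.
Qed.

Lemma game_P_rcll psi : cpath T (I + I) psi -> rcll T (I + I) psi.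
Proof.
move=> cpsi; split=> [t /andP[t0 tT]|t /andP[t0 tT]].
  apply: row_cvg => j; apply/cvgrPdist_le => e e0.
  have t0T : 0 <= t < T by rewrite t0.
  have [delta d0 H] := unif_cont_right_cont (cpath_unif_cont j cpsi) t0T e0.
  exists delta => //= s /= std ts; rewrite distrC; apply: H; first exact: ltW.
  by move: std; rewrite distrC gtr0_norm ?subr_gt0// ltrBlDl.
exists (psi t); apply: row_cvg => j; apply/cvgrPdist_le => e e0.
have [delta d0 H] := cpath_unif_cont j cpsi e0.
exists (Num.min delta t); first by rewrite /= lt_min d0.
move=> s /=; rewrite lt_min => /andP[s1 s2] st; apply: H; last exact: ltW.
  by rewrite (ltW t0).
by move: s2; rewrite gtr0_norm ?subr_gt0// => s2; rewrite (le_trans (ltW st) tT) andbT; lra.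
Qed.

Lemma Vn_ge (a : R) : moderate_deviation_principle M ->
  (a%:E < ereal_sup [set (min_cost M f psi - rate M psi)%E | psi in game_P M])%E ->
  \forall n \near \oo, (a%:E <= Vn M n)%E.
Proof.
move=> [_ mdp] /ereal_sup_gt[_ [psi Pp <-]].
have mcf := min_cost_fin mht costs cf fmin Pp; rewrite -(fineK mcf).
(* A path of infinite rate cannot beat the real bound [a], so the rate is a real [rr]. *)
set mc := fine _; have := rate_ge0 psi; case rE : (rate M psi) => [rr||]// _.
(* One [e] is lost in the pathwise cost and one in the probability of the ball; the third is
   slack. *)
rewrite -EFinB lte_fin => a_lt; pose e := (mc - rr - a) / 3.
have e0 : 0 < e by rewrite divr_gt0// subr_gt0.
have [delta d0 Hc] := path_cost_ge Pp e0.
have [cpsi _] := Pp.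
have := mdp _ (j1_open_oball delta (ltW T0) cpsi).
set G := _ `&` _ => HG.
have : ((- rr - e)%:E < limn_einf (fun n => ((bn M n ^+ 2)^-1)%:E *
                         lne (P [set w | G (AS_tilde M n w)])))%E.
  apply: lt_le_trans HG; apply: (@lt_le_trans _ _ (- rr%:E)%E).
    by rewrite -EFinN lte_fin; move: e0; lra.
  rewrite leeN2 -rE; apply: ereal_inf_lbound; exists psi => //; split; first exact: game_P_rcll.
  by exists 0 => // t _ i; rewrite subrr normr0.
move=> /limn_einf_gt HP; near=> n.
have n0 : (0 < n)%N by near: n; exact: nbhs_infty_gt.
have b0 : 0 < bn M n ^+ 2 by case: mht => _ [bpos _ _] _ _ _; rewrite exprn_gt0// bpos.
apply: le_ereal_inf_tmp => _ [B aB <-]; rewrite JnE.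
have mG : measurable [set w | G (AS_tilde M n w)].
  have -> : [set w | G (AS_tilde M n w)] = [set w | no_explosion M n w] `&`
      [set w | oball T psi delta (AS_tilde M n w)].
    by apply/seteqP; split => w [/(rcll_AS_tilde prim mht w n0) r o].
  apply: measurableI; last exact: measurable_oball.
  by have [] := no_explosion_ae prim mht n0.
have PG : ((expR (bn M n ^+ 2 * (- rr - e)))%:E <= P [set w | G (AS_tilde M n w)])%E.
  have : ((- rr - e)%:E <= ((bn M n ^+ 2)^-1)%:E * lne (P [set w | G (AS_tilde M n w)]))%E.
    by apply: ltW; near: n.
  by rewrite lee_pdivlMl// -EFinM lne_geP.
have low : ((expR (bn M n ^+ 2 * (mc - e)))%:E * P [set w | G (AS_tilde M n w)] <=
    \int[P]_w expeR ((bn M n ^+ 2)%:E * path_cost n B w))%E.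
  apply: ge0_integral_ge_cst => //.
    by move=> w _; exact: expeR_ge0.
  move=> w [/(rcll_AS_tilde prim mht w n0) ne [eta eta_lt ob]].
  rewrite -[_%:E]/(expeR (_%:E)) lee_expeR EFinM lee_pmul2l ?lte_fin//.
  have : (min_cost M f psi <= path_cost n B w + e%:E)%E.
    have : forall B w, admissible M n B -> no_explosion M n w ->
      cball T psi delta (AS_tilde M n w) -> (min_cost M f psi <= path_cost n B w + e%:E)%E.
      by near: n.
    apply => // t t0T i; exact: le_trans (ob t t0T i) (ltW eta_lt).
  by rewrite -(fineK mcf) -/mc EFinB leeBlDr.
rewrite lee_pdivlMl// -EFinM lne_geP; last first.
  by apply: integral_ge0 => w _; exact: expeR_ge0.
apply: le_trans low; apply: le_trans (lee_wpmul2l _ PG); last by rewrite lee_fin expR_ge0.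
rewrite -EFinM -expRD /= lee_fin ler_expR -mulrDr ler_pM2l//.
by rewrite /e; lra.
Unshelve. all: by end_near. Qed.

End lower_bound.

(** * An event-driven policy *)

(* A finite family of clocks, each running at speed 0 or 1; clock j rings when
   it reaches E j 1, E j 2, ..., and the speeds depend only on the numbers of
   rings so far. *)
Section clocks.
Context {R : realType} {J : finType}.
Variables (E : J -> nat -> R) (speed : (J -> nat) -> J -> bool) (j0 : J).
Hypothesis E0 : forall j, E j 0 = 0.
Hypothesis Einc : forall j k, E j k < E j k.+1.
Hypothesis speed0 : forall k, speed k j0.

(** The delay until the next ring among the running clocks. Clock [j0] always runs and supplies the
    default of the minimum. *)
Definition step_len (k : J -> nat) (z : J -> R) : R :=
  \big[Num.min/E j0 (k j0).+1 - z j0]_(j | speed k j) (E j (k j).+1 - z j).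

(** Clocks that reach their next epoch at the same instant all ring in one step. *)
Definition next_state (s : (J -> nat) * (J -> R) * R) :=
  let z := fun j => s.1.2 j + (speed s.1.1 j)%:R * step_len s.1.1 s.1.2 in
  (fun j => (s.1.1 j + (speed s.1.1 j && (E j (s.1.1 j).+1 <= z j)%R))%N, z,
   s.2 + step_len s.1.1 s.1.2).

Definition state m := iter m next_state (fun=> 0%N, fun=> 0, 0).
Definition rings m : J -> nat := (state m).1.1.
Definition clocks m : J -> R := (state m).1.2.
Definition times m : R := (state m).2.
Definition active m j : bool := speed (rings m) j.
Definition len m : R := step_len (rings m) (clocks m).

Lemma timesS m : times m.+1 = times m + len m. Proof. by []. Qed.

Lemma clocksS m j : clocks m.+1 j = clocks m j + (active m j)%:R * len m.
Proof. by []. Qed.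

Lemma ringsS m j : rings m.+1 j =
  (rings m j + (active m j && (E j (rings m j).+1 <= clocks m.+1 j)%R))%N.
Proof. by []. Qed.

Lemma len_le m j : active m j -> len m <= E j (rings m j).+1 - clocks m j.
Proof. by move=> aj; rewrite /len /step_len; exact: bigmin_le_cond. Qed.

Lemma clocks_itv m j : E j (rings m j) <= clocks m j < E j (rings m j).+1.
Proof.
elim: m j => [|m ih] j; first by rewrite /rings /clocks /= E0 lexx -(E0 j) Einc.
have len0 : 0 < len m.
  apply/bigmin_gtP; split=> [|i _]; rewrite subr_gt0; first by have /andP[] := ih j0.
  by have /andP[] := ih i.
have /andP[lo hi] := ih j; rewrite ringsS clocksS.
have [aj|_] /= := boolP (active m j); last by rewrite mul0r addr0 addn0 lo.
rewrite mul1r; have le := len_le aj.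
case: (leP (E j (rings m j).+1) (clocks m j + len m)) => h /=; last first.
  by rewrite addn0 (le_trans lo) ?lerDl ?ltW.
by rewrite addn1 h /=; apply: le_lt_trans (Einc j _); move: le; lra.
Qed.

Lemma len_gt0 m : 0 < len m.
Proof.
apply/bigmin_gtP; split=> [|i _]; rewrite subr_gt0; first by have /andP[] := clocks_itv m j0.
by have /andP[] := clocks_itv m i.
Qed.

Lemma times_lt m : times m < times m.+1. Proof. by rewrite timesS ltrDl len_gt0. Qed.

Lemma times0 : times 0 = 0. Proof. by []. Qed.

Lemma times_le m m' : (m <= m')%N -> times m <= times m'.
Proof.
elim: m' => [|m' ih]; first by rewrite leqn0 => /eqP ->.
by rewrite leq_eqVlt => /predU1P[->//|]; rewrite ltnS => /ih /le_trans; apply; rewrite ltW// times_lt.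
Qed.

Lemma times_ge0 m : 0 <= times m. Proof. by rewrite -times0 times_le. Qed.

Lemma times_unique m m' t : times m <= t < times m.+1 -> times m' <= t < times m'.+1 -> m = m'.
Proof.
move=> /andP[a b] /andP[c e]; apply/eqP; rewrite eqn_leq; apply/andP; split.
  by rewrite leqNgt; apply/negP => /times_le h; have := lt_le_trans e (le_trans h a); rewrite ltxx.
by rewrite leqNgt; apply/negP => /times_le h; have := lt_le_trans b (le_trans h c); rewrite ltxx.
Qed.

Lemma times_bracket t M : 0 <= t -> t < times M ->
  exists2 m, (m < M)%N & times m <= t < times m.+1.
Proof.
elim: M => [|M ih] t0; first by rewrite times0 => /(le_lt_trans t0); rewrite ltxx.
have [mt tm|/(ih t0)[l lm lE] _] := leP (times M) t; first by exists M; rewrite ?mt.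
by exists l => //; exact: leq_trans lm _.
Qed.

Lemma times_bracket_left t M : 0 < t -> t <= times M ->
  exists2 m, (m < M)%N & times m < t <= times m.+1.
Proof.
elim: M => [|M ih] t0; first by rewrite times0 => /(lt_le_trans t0); rewrite ltxx.
have [mt tm|/(ih t0)[l lm lE] _] := ltP (times M) t; first by exists M; rewrite ?mt.
by exists l => //; exact: leq_trans lm _.
Qed.

Definition clock_at m j t := clocks m j + (active m j)%:R * (t - times m).

Lemma clock_at_itv m j t : times m <= t < times m.+1 ->
  E j (rings m j) <= clock_at m j t < E j (rings m j).+1.
Proof.
rewrite timesS /clock_at => /andP[mt tm]; have /andP[lo hi] := clocks_itv m j.
have [aj|_] := boolP (active m j); last by rewrite mul0r addr0 lo.
have := len_le aj; rewrite mul1r => h; apply/andP; split.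
  by rewrite (le_trans lo)// lerDl subr_ge0.
by move: tm h; lra.
Qed.

Lemma rings_le m j : (rings m j <= rings m.+1 j)%N.
Proof. by rewrite ringsS leq_addr. Qed.

(** The minimum defining the step length is attained, so at least one clock rings. Consequently a
    cap on rings is also a cap on steps. *)
Lemma rings_sum_lt m : (\sum_j rings m j < \sum_j rings m.+1 j)%N.
Proof.
rewrite ltnNge; apply/negP => le.
have same j : rings m.+1 j = rings m j.
  apply/eqP; rewrite eqn_leq rings_le andbT leqNgt; apply/negP => lt.
  move: le; rewrite leqNgt => /negP; apply.
  rewrite (bigD1 j)//= [ltnRHS](bigD1 j)//= -addSn leq_add//.
  by apply: leq_sum => i _; exact: rings_le.
have late j : active m j -> len m < E j (rings m j).+1 - clocks m j.
  move=> aj; rewrite ltrBrDl ltNge; apply/negP => h.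
  have := same j; rewrite ringsS clocksS aj mul1r h /=.
  by move/eqP; rewrite -[X in _ == X]addn0 eqn_add2l.
have : len m < len m.
  apply/bigmin_gtP; split=> [|j aj].
    exact: (late _ (speed0 _)).
  exact: late.
by rewrite ltxx.
Qed.

Lemma rings_sum_ge m : (m <= \sum_j rings m j)%N.
Proof. by elim: m => // m ih; exact: leq_ltn_trans ih (rings_sum_lt m). Qed.

Lemma rings_sum_le m m' : (m <= m')%N -> (\sum_j rings m j <= \sum_j rings m' j)%N.
Proof.
elim: m' => [|m' ih]; first by rewrite leqn0 => /eqP ->.
rewrite leq_eqVlt => /predU1P[->//|]; rewrite ltnS => /ih /leq_trans; apply.
exact: ltnW (rings_sum_lt m').
Qed.

(* If Z only moves, at rate at most c, during the stretches where act holds,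
   then G holds at (nearly) the last time before t at which Z moved. *)
Lemma last_active (T c : R) (Z : R -> R) (act : nat -> bool) (G : R -> Prop) M : 0 < c ->
  (forall m s t, (m < M)%N -> times m <= s -> s <= t -> t <= times m.+1 -> t <= T ->
     if act m then is_true (Z t - Z s <= c * (t - s)) else Z t = Z s) ->
  (forall m v, (m < M)%N -> act m -> times m <= v < times m.+1 -> v <= T -> G v) ->
  forall u t eta, 0 <= u -> u <= t -> t <= times M -> t <= T -> 0 < eta ->
  Z t = Z u \/ exists v, [/\ u <= v, v <= t, G v & Z t - Z v <= eta].
Proof.
move=> c0; elim: M => [|M ih] HZ HG u t eta u0 ut.
  rewrite times0 => t0 _ _; left; congr Z; apply/eqP; rewrite eq_le ut andbT.
  exact: le_trans t0 u0.
move=> tM tT eta0.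
have HZ' m s v : (m < M)%N -> times m <= s -> s <= v -> v <= times m.+1 -> v <= T ->
     if act m then is_true (Z v - Z s <= c * (v - s)) else Z v = Z s.
  by move=> mM; apply: HZ; exact: ltnW.
have HG' m v : (m < M)%N -> act m -> times m <= v < times m.+1 -> v <= T -> G v.
  by move=> mM; apply: HG; exact: ltnW.
have {}ih := ih HZ' HG'.
have [tM'|Mt] := leP t (times M); first exact: ih.
have [->|nut] := eqVneq u t; first by left.
have {nut}ut' : u < t by rewrite lt_neqAle nut.
pose s := Num.max u (times M).
have st : s < t by rewrite gt_max ut' Mt.
have Ms : times M <= s by rewrite le_max lexx orbT.
have us : u <= s by rewrite le_max lexx.
have [aM|naM] := boolP (act M).
  (* Backing up by [eta / c], at a rate of at most [c], costs at most [eta]. *)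
  right; pose v := Num.max s (t - eta / c).
  have sv : s <= v by rewrite le_max lexx.
  have vt : v < t by rewrite gt_max st ltrBlDr ltrDl divr_gt0.
  exists v; split; [exact: le_trans us sv|exact: ltW| |].
    apply: (HG M) => //; last exact: le_trans (ltW vt) tT.
    by rewrite (le_trans Ms sv) (lt_le_trans vt tM).
  have := HZ M v t (ltnSn M) (le_trans Ms sv) (ltW vt) tM tT; rewrite aM => /le_trans; apply.
  rewrite mulrC -ler_pdivlMr//; have : t - eta / c <= v by rewrite le_max lexx orbT.
  by lra.
have := HZ M s t (ltnSn M) Ms (ltW st) tM tT; rewrite (negbTE naM) => ->.
have [Mu|uM] := leP (times M) u; first by left; rewrite /s max_l.
rewrite /s max_r ?(ltW uM)//.
have [|[v [a b g h]]] := ih u (times M) eta u0 (ltW uM) (lexx _) (le_trans (ltW Mt) tT) eta0.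
  by left.
by right; exists v; split => //; exact: le_trans b (ltW Mt).
Qed.

Section allocation.
Variables (N : nat) (T : R).
Hypothesis T0 : 0 < T.
Variable j : J.
Hypothesis stop : forall k, (N <= \sum_j k j)%N -> ~~ speed k j.

(** A finite sum of indicators of right-open intervals, hence RCLL on every outcome, even if the
    steps accumulate; by [stop] the truncation at [N] discards only steps where clock [j] is off. *)
Definition alloc (t : R) : R :=
  \sum_(m < N) ((times m <= t < times m.+1)%R)%:R * (active m j)%:R.

Lemma active_lt m : active m j -> (m < N)%N.
Proof.
move=> a; rewrite ltnNge; apply/negP => Nm; move: a; rewrite /active.
by apply/negP/stop/(leq_trans Nm)/rings_sum_ge.
Qed.

Lemma alloc_in m t : times m <= t < times m.+1 -> alloc t = (active m j)%:R.
Proof.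
move=> mt; have [mN|Nm] := ltnP m N.
  rewrite /alloc (bigD1 (Ordinal mN))//= mt mul1r big1 ?addr0// => l lm.
  case: (boolP (times l <= t < times l.+1)) => [lt|_]; last by rewrite mul0r.
  by move/eqP: lm; case; apply/val_inj => /=; exact: times_unique lt mt.
rewrite [active m j](_ : _ = false); last first.
  by apply/negP => /active_lt; rewrite ltnNge Nm.
apply: big1 => l _; case: (boolP (times l <= t < times l.+1)) => [lt|_]; last by rewrite mul0r.
by move: (ltn_ord l); rewrite (times_unique lt mt) ltnNge Nm.
Qed.

Lemma alloc_after t : times N <= t -> alloc t = 0.
Proof.
move=> Nt; apply: big1 => l _; rewrite [_ < _](_ : _ = false) ?andbF ?mul0r//.
apply/negbTE; rewrite -leNgt; apply: le_trans Nt; exact: times_le.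
Qed.

Lemma alloc_before t : t < 0 -> alloc t = 0.
Proof.
move=> t0; apply: big1 => l _; rewrite [_ <= _](_ : _ = false) ?mul0r//.
by apply/negbTE; rewrite -ltNge (lt_le_trans t0)// times_ge0.
Qed.

Lemma alloc01 t : 0 <= alloc t <= 1.
Proof.
have [t0|t0] := ltP t 0; first by rewrite alloc_before// lexx ler01.
have [/(times_bracket t0)[m _ /alloc_in ->]|/alloc_after ->] := ltP t (times N).
  by case: active; rewrite lexx ler01.
by rewrite lexx ler01.
Qed.

Lemma alloc_cst_right t : 0 <= t -> exists2 e : R, 0 < e &
  forall s, t <= s -> s < t + e -> alloc s = alloc t.
Proof.
move=> t0; have [/(times_bracket t0)[m _ mE]|Nt] := ltP t (times N).
  have /andP[mt tm] := mE; exists (times m.+1 - t); first by rewrite subr_gt0.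
  move=> s ts; rewrite addrC subrK => sm; rewrite (alloc_in mE) (@alloc_in m)//.
  by rewrite (le_trans mt).
by exists 1 => // s ts _; rewrite !alloc_after// (le_trans Nt).
Qed.

Lemma alloc_cst_left t : 0 < t -> exists2 e : R, 0 < e & exists c,
  forall s, t - e < s -> s < t -> alloc s = c.
Proof.
move=> t0; have [/(times_bracket_left t0)[m _ /andP[mt tm]]|Nt] := leP t (times N).
  exists (t - times m); first by rewrite subr_gt0.
  exists (active m j)%:R => s; rewrite opprB addrC subrK => ms st.
  by rewrite (@alloc_in m)// (ltW ms) (lt_le_trans st).
exists (t - times N); first by rewrite subr_gt0.
exists 0 => s; rewrite opprB addrC subrK => Ns st; exact/alloc_after/ltW.
Qed.

Lemma alloc_right_cont : right_cont T alloc.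
Proof.
move=> t /andP[t0 _] e e0; have [k k0 H] := alloc_cst_right t0; exists k => // s ts st.
by rewrite H// subrr normr0 ltW.
Qed.

Let alloc01T t : 0 <= t <= T -> 0 <= alloc t <= 1. Proof. by move=> _; exact: alloc01. Qed.

Lemma cumul_alloc_times m : times m <= T -> cumul alloc (times m) = clocks m j.
Proof.
elim: m => [_|m ih]; first by rewrite times0 cumul0.
move=> mT; have mT' := le_trans (ltW (times_lt m)) mT.
have step := cumul_step T0 alloc_right_cont alloc01T (times_ge0 m) (ltW (times_lt m)) mT.
rewrite (step (active m j)%:R); last first.
  by move=> x mx xm; apply: alloc_in; rewrite mx.
by rewrite ih// clocksS timesS [times m + _]addrC addrK.
Qed.

Lemma cumul_alloc m t : times m <= t -> t <= times m.+1 -> t <= T ->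
  cumul alloc t = clock_at m j t.
Proof.
move=> mt tm tT; have step := cumul_step T0 alloc_right_cont alloc01T (times_ge0 m) mt tT.
rewrite (step (active m j)%:R); last first.
  by move=> x mx xt; apply: alloc_in; rewrite mx (lt_le_trans xt).
by rewrite cumul_alloc_times// (le_trans mt).
Qed.

End allocation.

End clocks.

Section policy.
Context {R : realType} {d : measure_display} {Omega : measurableType d}
  {P : probability Omega R} {I : nat}.
Variable M : queue_model P I.
Hypothesis prim : renewal_primitives M.
Hypothesis mht : moderate_heavy_traffic M.
Variable f : R -> 'rV[R]_I.
Variables (n : nat) (i0 : 'I_I).
Hypothesis n0 : (0 < n)%N.
Notation T := (horizon M).
Implicit Types (w : Omega) (i : 'I_I) (j : 'I_(I + I)) (k : 'I_(I + I) -> nat) (m : nat).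

Let T0 : 0 < T := horizon_gt0 mht.

Lemma split_lshift i : fintype.split (lshift I i) = inl i.
Proof. exact: (unsplitK (inl _ i)). Qed.

Lemma split_rshift i : fintype.split (rshift I i) = inr i.
Proof. exact: (unsplitK (inr _ i)). Qed.

(* Beyond this number of events the policy idles: it keeps the paths of the
   control regular on outcomes where a renewal sequence explodes. *)
Definition event_cap : nat := Num.bound (\sum_j prim_rate M n j * T + n%:R).

Definition queue_of (c : 'I_(I + I) -> R) i : R :=
  (X0 M n i)%:R + c (lshift I i) - c (rshift I i).

(* By dotp theta (f W) = W, some nonempty class sits above the curve unless all
   queues are empty. *)
Definition served (x : 'I_I -> R) : option 'I_I :=
  let W := dotp (theta M) (\row_i (x i / scale M n)) in
  [pick i | (0 < x i) && (f W ord0 i <= x i / scale M n)].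

Definition service_on k i : bool :=
  (\sum_j k j < event_cap)%N && (served (queue_of (fun j => (k j)%:R)) == Some i).

Definition clock_on k j : bool :=
  match fintype.split j with inl _ => true | inr i => service_on k i end.

Definition clock_epoch w j l := prim_epoch M n j w l.
(** Any class will do: an arrival clock is never switched off. *)
Definition arrival_clock : 'I_(I + I) := lshift I i0.

Lemma clock_on_l k i : clock_on k (lshift I i).
Proof. by rewrite /clock_on split_lshift. Qed.

Lemma clock_on_r k i : clock_on k (rshift I i) = service_on k i.
Proof. by rewrite /clock_on split_rshift. Qed.

Definition policy : @control R d Omega I := fun w t => \row_i
  alloc (clock_epoch w) clock_on arrival_clock event_cap (rshift I i) t.

Let E0 w j : clock_epoch w j 0 = 0. Proof. exact: epoch0. Qed.

Let Einc w j l : clock_epoch w j l < clock_epoch w j l.+1.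
Proof. by apply: epochS; [exact: prim_rate_gt0|move=> m; exact: primitive_gt0]. Qed.

Let on0 k : clock_on k arrival_clock. Proof. exact: clock_on_l. Qed.

Let stop i k : (event_cap <= \sum_j k j)%N -> ~~ clock_on k (rshift I i).
Proof. by move=> Nk; rewrite clock_on_r /service_on ltnNge Nk. Qed.

Notation times w := (times (clock_epoch w) clock_on arrival_clock).
Notation rings w := (rings (clock_epoch w) clock_on arrival_clock).
Notation clocks w := (clocks (clock_epoch w) clock_on arrival_clock).

Lemma policyE w t i :
  policy w t ord0 i = alloc (clock_epoch w) clock_on arrival_clock event_cap (rshift I i) t.
Proof. by rewrite mxE. Qed.

Lemma policy_in w m t i : times w m <= t < times w m.+1 ->
  policy w t ord0 i = (service_on (rings w m) i)%:R.
Proof.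
by move=> mt; rewrite policyE (alloc_in (E0 w) (Einc w) on0 (@stop i) mt) /active clock_on_r.
Qed.

Lemma busy_policy w i t : busy policy i t w =
  cumul (alloc (clock_epoch w) clock_on arrival_clock event_cap (rshift I i)) t.
Proof. by apply: eq_Rintegral => s _; rewrite policyE. Qed.

Lemma busy_policy_in w m i t : times w m <= t -> t <= times w m.+1 -> t <= T ->
  busy policy i t w = clocks w m (rshift I i) +
    (service_on (rings w m) i)%:R * (t - times w m).
Proof.
move=> mt tm tT; rewrite busy_policy.
by rewrite (cumul_alloc (E0 w) (Einc w) on0 T0 (@stop i) mt tm tT) /clock_at /active clock_on_r.
Qed.

Lemma arrival_clockE w m i : clocks w m (lshift I i) = times w m.
Proof.
elim: m => // m ih; rewrite clocksS timesS ih /active clock_on_l mul1r//.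
Qed.

(** The counts as an observer sees them, arrivals up to [t] and services completed in the time
    actually worked; these are the variables that generate [history]. *)
Definition ring_count j t w : R :=
  renewal_count (prim_rate M n j) (primitive M j ^~ w)
    (match fintype.split j with inl _ => t | inr i => busy policy i t w end).

Lemma ring_count_l i t w : ring_count (lshift I i) t w = An M n i t w.
Proof. by rewrite /ring_count split_lshift primitive_lshift. Qed.

Lemma ring_count_r i t w : ring_count (rshift I i) t w = Sn M n i (busy policy i t w) w.
Proof. by rewrite /ring_count split_rshift primitive_rshift. Qed.

Lemma ring_countE w m t j : times w m <= t < times w m.+1 -> t <= T ->
  ring_count j t w = (rings w m j)%:R.
Proof.
move=> mt tT; have := clock_at_itv (E0 w) (Einc w) j mt.
have <- : (match fintype.split j with inl _ => t | inr i => busy policy i t w end) =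
    clock_at (clock_epoch w) clock_on arrival_clock m j t.
  rewrite -(splitK j); case: (fintype.split j) => i /=.
    by rewrite split_lshift /clock_at /active clock_on_l arrival_clockE mul1r addrC subrK.
  rewrite split_rshift /clock_at /active clock_on_r; case/andP: mt => mt tm.
  by rewrite (busy_policy_in _ mt (ltW tm) tT).
rewrite /ring_count => H; apply: renewal_countE => //.
  exact: prim_rate_gt0.
by move=> l; exact: primitive_gt0.
Qed.

Lemma Xn_policyE i t w : Xn M n policy i t w = queue_of (ring_count ^~ t ^~ w) i.
Proof. by rewrite /Xn /queue_of ring_count_l ring_count_r. Qed.

Lemma Xn_policy_in w m t : times w m <= t < times w m.+1 -> t <= T ->
  (fun i => Xn M n policy i t w) = queue_of (fun j => (rings w m j)%:R).
Proof.
move=> mt tT; apply/funext => i; rewrite Xn_policyE /queue_of.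
by rewrite !(ring_countE _ mt tT).
Qed.

Lemma served_gt0 x i : served x = Some i ->
  0 < x i /\ f (dotp (theta M) (\row_i (x i / scale M n))) ord0 i <= x i / scale M n.
Proof. by rewrite /served; case: pickP => // i' /andP[a b] [<-]. Qed.

Lemma policy_rcll w : rcll T I (policy w).
Proof.
split=> [t /andP[t0 _]|t /andP[t0 _]].
  apply: row_cvg => i; have [e e0 H] := alloc_cst_right (E0 w) (Einc w) on0 (@stop i) t0.
  apply/cvgrPdist_le => eta eta0; exists e => //= s /= ts st.
  rewrite !policyE H ?subrr ?normr0 ?ltW//.
  by move: ts; rewrite distrC gtr0_norm ?subr_gt0// ltrBlDl.
have /choice[c Hc] : forall i, exists c : R, exists2 e : R, 0 < e & forall s,
    t - e < s -> s < t -> policy w s ord0 i = c.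
  move=> i; have [e e0 [c H]] := alloc_cst_left (E0 w) (Einc w) on0 (@stop i) t0.
  by exists c, e => // s ts st; rewrite policyE H.
exists (\row_i c i); apply: row_cvg => i; rewrite mxE; have [e e0 H] := Hc i.
apply/cvgrPdist_le => eta eta0; exists e => //= s /= ts st.
rewrite H ?subrr ?normr0 ?(ltW eta0)//.
by move: ts; rewrite gtr0_norm ?subr_gt0// ltrBlDr -ltrBlDl.
Qed.

Lemma policy_after w t i : times w event_cap <= t -> policy w t ord0 i = 0.
Proof. by move=> Nt; rewrite policyE (alloc_after (E0 w) (Einc w)). Qed.

Lemma policy_simplex w t : 0 <= t <= T ->
  (forall i, 0 <= policy w t ord0 i <= 1) /\ \sum_i policy w t ord0 i <= 1.
Proof.
move=> /andP[t0 _]; split.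
  by move=> i; rewrite policyE; exact: (alloc01 (E0 w) (Einc w) on0 (@stop i)).
have [/(times_bracket t0)[m _ mt]|Nt] := ltP t (times w event_cap); last first.
  by rewrite big1 ?ler01// => i _; exact: policy_after.
rewrite (eq_bigr (fun i => (service_on (rings w m) i)%:R)); last first.
  by move=> i _; exact: policy_in.
rewrite /service_on; case: (_ < _)%N => /=; last by rewrite big1 ?ler01.
case: (served _) => [i|]; last by rewrite big1 ?ler01.
rewrite (bigD1 i)//= eqxx big1 ?addr0// => j ji.
by case: eqP => // -[] e; rewrite e eqxx in ji.
Qed.

Lemma policy_idle w t i : 0 <= t <= T -> Xn M n policy i t w = 0 -> policy w t ord0 i = 0.
Proof.
move=> /andP[t0 tT] X0; have [/(times_bracket t0)[m _ mt]|Nt] := ltP t (times w event_cap).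
  rewrite (policy_in i mt) /service_on; case: (_ < _)%N => //=.
  case: eqP => // /served_gt0[+ _]; rewrite -(Xn_policy_in mt tT) X0.
  by rewrite ltxx.
exact: policy_after.
Qed.

Definition below_cap (s : R) : set Omega := [set w | \sum_j ring_count j s w < event_cap%:R].

(** Counts read at [t] alone are unreliable after an explosion, when [sup] returns 0; the cap is
    therefore also tested at all earlier rational times, a countable condition measurable for the
    history. *)
Definition not_stopped t : set Omega :=
  below_cap t `&` \bigcap_(q in [set q : rat | 0 <= (ratr q : R) <= t]) below_cap (ratr q).

Lemma below_capE w m t : times w m <= t < times w m.+1 -> t <= T ->
  below_cap t w <-> (\sum_j rings w m j < event_cap)%N.
Proof.
move=> mt tT; rewrite /below_cap /= (eq_bigr (fun j => (rings w m j)%:R)).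
  by rewrite -natr_sum ltr_nat.
by move=> j _; exact: ring_countE.
Qed.

Lemma not_stoppedP w t : 0 <= t <= T -> not_stopped t w <->
  exists2 m, times w m <= t < times w m.+1 & (\sum_j rings w m j < event_cap)%N.
Proof.
move=> /andP[t0 tT]; split; last first.
  move=> [m mt capm]; split; first exact/(below_capE mt tT).
  move=> q /= /andP[q0 qt]; have /andP[mt1 mt2] := mt.
  have [m' mm' mq] := times_bracket q0 (le_lt_trans qt mt2).
  apply/(below_capE mq (le_trans qt tT)); apply: leq_ltn_trans capm.
  exact: (rings_sum_le (clock_epoch w) on0).
move=> [bt bq].
have ex : exists m, (event_cap <= \sum_j rings w m j)%N.
  by exists event_cap; exact: (rings_sum_ge (clock_epoch w) on0).
(* The first step at which the cap is met. If it starts by time [t], then [t] itself or a rational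
   time inside that step fails the test. *)
case: (ex_minnP ex) => m capm minm.
have [tm|mt] := ltP t (times w m).
  have [m' m'm m't] := times_bracket t0 tm; exists m' => //.
  by rewrite ltnNge; apply/negP => /minm; rewrite leqNgt m'm.
exfalso; have [tm|mt'] := ltP t (times w m.+1).
  have mtE : times w m <= t < times w m.+1 by rewrite mt.
  by move: bt; rewrite (below_capE mtE tT) ltnNge capm.
have [q] := rat_in_itvoo (times_lt clock_on arrival_clock (E0 w) (Einc w) m).
rewrite in_itv /= => /andP[mq qm]; have qt := ltW (lt_le_trans qm mt').
have mqE : times w m <= ratr q < times w m.+1 by rewrite (ltW mq).
have t_ge0 := times_ge0 clock_on arrival_clock (E0 w) (Einc w) m.
have := bq q; rewrite /= (le_trans t_ge0 (ltW mq)) qt => /(_ isT).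
by rewrite (below_capE mqE (le_trans qt tT)) ltnNge capm.
Qed.

(** The source of adaptedness: the policy becomes the indicator of an event expressed through
    observed counts, with no reference to the clocks. *)
Lemma policy_eq1 w t i : 0 <= t <= T -> policy w t ord0 i =
  \1_(not_stopped t `&` [set w | served (fun i => Xn M n policy i t w) = Some i]) w.
Proof.
move=> t0T; have /andP[t0 tT] := t0T; rewrite indicE.
have [ns|nns] := pselect (not_stopped t w).
  have [m mt capm] := (not_stoppedP w t0T).1 ns.
  rewrite (policy_in i mt) /service_on capm -(Xn_policy_in mt tT) /=.
  congr (_%:R); congr (nat_of_bool _); apply/eqP/idP => [h|].
    by rewrite inE.
  by rewrite inE => -[].
rewrite memNset; last by case.
have [/(times_bracket t0)[m _ mt]|Nt] := ltP t (times w event_cap); last exact: policy_after.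
rewrite (policy_in i mt) /service_on ltnNge [X in ~~ X && _](_ : _ = true)//.
rewrite leqNgt; apply/negP => capm; apply: nns; apply/not_stoppedP => //.
by exists m.
Qed.

Lemma policy_adapted t i U : 0 <= t <= T -> measurable U ->
  history M n policy t ((fun w => policy w t ord0 i) @^-1` U).
Proof.
move=> t0T mU; have /andP[t0 tT] := t0T.
pose Ys : set (Omega -> R) := [set Y | exists i s, 0 <= s <= t /\
    (Y = An M n i s \/ Y = fun w => Sn M n i (busy policy i s w) w)].
pose G := \bigcup_(X in Ys) preimage_set_system setT X measurable.
have mcount s j : 0 <= s <= t -> measurable_fun (setT : set (g_sigma_algebraType G)) (ring_count j s).
  move=> s0t _ V mV; apply: sub_sigma_algebra.
  exists (ring_count j s); last by exists V.
  rewrite -(splitK j); case: (fintype.split j) => i' /=; exists i', s; split => //.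
    by left; apply/funext => w; rewrite ring_count_l.
  by right; apply/funext => w; rewrite ring_count_r.
have mcap s : 0 <= s <= t -> measurable (below_cap s : set (g_sigma_algebraType G)).
  move=> s0t; rewrite (_ : below_cap s = setT `&`
      (fun w => \sum_j ring_count j s w) @^-1` `]-oo, event_cap%:R[).
    apply: measurable_sum => // j; exact: mcount.
  by rewrite setTI; apply/seteqP; split => w; rewrite /below_cap /= in_itv.
have mstop : measurable (not_stopped t : set (g_sigma_algebraType G)).
  apply: measurableI; first by apply: mcap; rewrite t0 lexx.
  rewrite bigcap_mkcond; rewrite -[X in measurable X]setCK setC_bigcap.
  apply: measurableC; apply: bigcupT_measurable_rat => q; apply: measurableC.
  by case: ifPn => // /set_mem; exact: mcap.
(* The served class depends on the integer vector of counts, so the event splits over countably many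
   such vectors. *)
pose F (k : {ffun 'I_(I + I) -> nat}) : set (g_sigma_algebraType G) :=
  if served (queue_of (fun j => (k j)%:R)) == Some i then
    \bigcap_(j in [set: 'I_(I + I)]) [set w | ring_count j t w = (k j)%:R] else set0.
have mserved : measurable ([set w | served (fun i => Xn M n policy i t w) = Some i]
    : set (g_sigma_algebraType G)).
  rewrite (_ : [set w | _] = \bigcup_k F k).
    apply: countable_bigcupT_measurable => [|k]; first exact: countableP.
    rewrite /F; case: ifP => // _; apply: fin_bigcap_measurable => // j _.
    rewrite (_ : [set w | _] = setT `&` ring_count j t @^-1` [set (k j)%:R]).
      by apply: mcount; rewrite ?t0 ?lexx.
    by rewrite setTI.
  apply/seteqP; split => w /=; last first.
    move=> [k _]; rewrite /F; case: eqP => // sk kE; rewrite -sk; congr served.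
    by apply/funext => i'; rewrite Xn_policyE /queue_of !(kE _ Logic.I).
  move=> sX; have /choice[k kE] : forall j, exists l : nat, ring_count j t w = l%:R.
    move=> j; apply: renewal_count_nat; first exact: prim_rate_gt0.
    by move=> l; exact: primitive_gt0.
  exists [ffun j => k j] => //; rewrite /F.
  have -> : queue_of (fun j => ([ffun j => k j] j)%:R) = (fun i => Xn M n policy i t w).
    by apply/funext => i'; rewrite Xn_policyE /queue_of !ffunE !kE.
  by rewrite sX eqxx => j _ /=; rewrite ffunE.
have -> : (fun w => policy w t ord0 i) =
    \1_(not_stopped t `&` [set w | served (fun i => Xn M n policy i t w) = Some i]).
  by apply/funext => w; exact: policy_eq1.
have := @measurable_indic _ (g_sigma_algebraType G) R setT _ (measurableI _ _ mstop mserved).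
by move=> /(_ measurableT _ mU); rewrite setTI.
Qed.

Lemma policy_admissible : admissible M n policy.
Proof.
split; [exact: policy_rcll|exact: policy_simplex|exact: policy_adapted|].
by move=> w t i; exact: policy_idle.
Qed.

End policy.

(** * Work conservation, curve tracking and growth under the policy *)

Section policy_paths.
Context {R : realType} {d : measure_display} {Omega : measurableType d}
  {P : probability Omega R} {I : nat}.
Variable M : queue_model P I.
Hypothesis prim : renewal_primitives M.
Hypothesis mht : moderate_heavy_traffic M.
Variable f : R -> 'rV[R]_I.
Hypothesis fo : forall v, 0 <= v -> orthant I (f v).
Hypothesis fl : forall v, 0 <= v -> dotp (theta M) (f v) = v.
Variables (n : nat) (i0 : 'I_I).
Hypothesis n0 : (0 < n)%N.
Notation T := (horizon M).
Implicit Types (w : Omega) (i : 'I_I) (j : 'I_(I + I)) (k : 'I_(I + I) -> nat) (m : nat).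

Notation clock_on := (clock_on M f n).
Notation cap := (event_cap M n).
Notation policy := (policy M f n i0).
Notation service_on := (service_on M f n).
Notation times w := (times (clock_epoch M n w) clock_on (arrival_clock i0)).
Notation rings w := (rings (clock_epoch M n w) clock_on (arrival_clock i0)).
Notation clocks w := (clocks (clock_epoch M n w) clock_on (arrival_clock i0)).

Let T0 : 0 < T := horizon_gt0 mht.
Let sc0 : 0 < scale M n := scale_gt0 mht n0.

Let E0 w j : clock_epoch M n w j 0 = 0. Proof. exact: epoch0. Qed.

Let Einc w j l : clock_epoch M n w j l < clock_epoch M n w j l.+1.
Proof. by apply: epochS; [exact: prim_rate_gt0|move=> m; exact: primitive_gt0]. Qed.

Let on0 k : clock_on k (arrival_clock i0). Proof. exact: clock_on_l. Qed.

Let padm : admissible M n policy := policy_admissible prim mht f i0 n0.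

(** If every nonempty class were strictly below the curve, the queues would lie below [f W] in each
    coordinate while having the same weighted sum, which forces equality everywhere. *)
Lemma served_none (x : 'I_I -> R) : (forall i, 0 <= x i) -> served M f n x = None ->
  forall i, x i = 0.
Proof.
move=> x0; rewrite /served; set q := \row_i _; set W := dotp _ q.
case: pickP => // none _ i; apply/eqP; rewrite eq_le x0 andbT leNgt; apply/negP => xi.
have q0 l : 0 <= q ord0 l by rewrite mxE divr_ge0// ltW.
have W0 : 0 <= W by apply: sumr_ge0 => l _; rewrite mulr_ge0// ltW// theta_gt0.
have lt l : 0 < x l -> q ord0 l < f W ord0 l.
  by move=> xl; have := none l; rewrite xl mxE /= => /negbT; rewrite -ltNge.
have le l : 0 <= f W ord0 l - q ord0 l.
  rewrite subr_ge0; have := x0 l; rewrite le_eqVlt => /predU1P[xl|/lt/ltW//].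
  by rewrite mxE -xl mul0r; exact: fo.
have : \sum_l theta M ord0 l * (f W ord0 l - q ord0 l) = 0.
  have /eqP := fl W0; rewrite -subr_eq0 => /eqP; rewrite {2}/W /dotp -sumrB => h.
  by rewrite -[RHS]h; apply: eq_bigr => l _; rewrite mulrBr.
move/psumr_eq0P => /(_ _ i isT)/eqP; rewrite mulf_eq0 gt_eqF ?theta_gt0//= subr_eq0.
move=> H; have {}H := H (fun l _ => mulr_ge0 (ltW (theta_gt0 mht l)) (le l)).
by have := lt i xi; rewrite (eqP H) ltxx.
Qed.

Lemma clocks_time_itv w m j : 0 <= clocks w m j <= times w m.
Proof.
elim: m => [|m /andP[ih1 ih2]]; first by apply/andP; split; exact: lexx.
rewrite clocksS timesS; have l0 := len_gt0 clock_on (arrival_clock i0) (E0 w) (Einc w) m.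
by case: active; rewrite ?mul1r ?mul0r; apply/andP; split; move: l0 ih1 ih2; lra.
Qed.

Definition running w := forall m, times w m <= T -> (\sum_j rings w m j < cap)%N.

Lemma running_cap w : running w -> T < times w cap.
Proof.
move=> rw; rewrite ltNge; apply/negP => /rw.
by rewrite ltnNge (rings_sum_ge (clock_epoch M n w) on0).
Qed.

(** The cap exceeds the nominal number of events, the sum of the [prim_rate * T], by at least [n].
    Reaching it by time [T] thus takes a deviation of order [n], which is of order [speedup] in
    scaled units. *)
Lemma stopped_bound w (c : R) : ~ running w ->
  (forall t j, 0 <= t <= T -> `|AS_tilde M n w t ord0 j| <= c) ->
  speedup M n <= (I + I)%:R * c.
Proof.
move=> /existsNP[m /not_implyP[mT /negP]]; rewrite -leqNgt => capm Hc.
have zT j : 0 <= clocks w m j <= T.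
  by have /andP[a b] := clocks_time_itv w m j; rewrite a (le_trans b).
have H j : (rings w m j)%:R <= prim_rate M n j * T + scale M n * c.
  have := Hc _ j (zT j); rewrite AS_tildeE (@renewal_countE _ _ _ _ _ (rings w m j)).
  - move=> /(le_trans (ler_norm _)); rewrite ler_pdivrMr// lerBlDl => /le_trans; apply.
    rewrite [c * _]mulrC lerD2r ler_wpM2l//; first by rewrite ltW// prim_rate_gt0.
    by case/andP: (zT j).
  - exact: prim_rate_gt0.
  - by move=> l; exact: primitive_gt0.
  - exact: clocks_itv.
have : (event_cap M n)%:R <= \sum_j (prim_rate M n j * T + scale M n * c) :> R.
  apply: (@le_trans _ _ (\sum_j (rings w m j)%:R)); last exact: ler_sum.
  by rewrite -natr_sum ler_nat.
have x0 : 0 <= \sum_j prim_rate M n j * T + n%:R.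
  by rewrite addr_ge0// sumr_ge0// => j _; rewrite mulr_ge0 ?ltW// prim_rate_gt0.
have := archi_boundP x0; rewrite -/(event_cap M n) big_split /= sumr_const card_ord.
move=> a b; have := lt_le_trans a b; rewrite ltrD2l => h.
by rewrite /speedup ler_pdivrMr// -mulrA [c * _]mulrC mulr_natl ltW.
Qed.

Section one_path.
Variable w : Omega.
Hypothesis ne : no_explosion M n w.
Notation Tt := (fun i t => busy policy i t w).
Notation X := (fun i t => X_tilde M n policy t w ord0 i).

Let X_ge0 t i : 0 <= t <= T -> 0 <= Xn M n policy i t w.
Proof. exact: (queue_ge0 prim mht n0 padm ne). Qed.

(** [last_active] applied to the idleness, which moves only while no class is served; by
    [served_none] the system is then empty. *)
Lemma policy_work_conserving : running w ->
  work_conserving T (mu M) (speedup M n) Tt X.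
Proof.
move=> rw t eta t0T eta0; have /andP[t0 tT] := t0T.
have r0 : 0 < speedup M n by rewrite divr_gt0// ltr0n.
pose act m := served M f n (queue_of M n (fun j => (rings w m j)%:R)) == None.
have [||Zt|[v [v0 vt Gv Zv]]] := @last_active _ _ _ _ _ T _ (idleness (speedup M n) Tt) act
  (fun v => workload (mu M) X v = 0) cap r0 _ _ 0 t eta (lexx 0) t0
  (le_trans tT (ltW (running_cap rw))) tT eta0.
- move=> m s u mcap ms su um uT.
  have mT := le_trans ms (le_trans su uT).
  have bS x : times w m <= x -> x <= times w m.+1 -> x <= T -> \sum_i Tt i x =
      \sum_i clocks w m (rshift I i) +
      (\sum_i (service_on (rings w m) i)%:R) * (x - times w m).
    move=> mx xm xT; rewrite mulr_suml -big_split; apply: eq_bigr => i _ /=.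
    by rewrite (busy_policy_in prim mht n0 i mx xm xT).
  have mu' := le_trans ms su; have sm := le_trans su um; have sT := le_trans su uT.
  have onE : \sum_i (service_on (rings w m) i)%:R = (~~ act m)%:R :> R.
    rewrite /service_on (rw m mT) /act; case: (served _ _ _ _) => [i1|]; last by rewrite big1.
    rewrite (bigD1 i1)//= [X in _ + X]big1 ?addr0 => [|i ii]; first by rewrite ?eqxx.
    by case: eqP => // -[] e; rewrite e eqxx in ii.
  rewrite /idleness !bS// onE; case: (act m); last by congr (_ * _) => /=; ring.
  by rewrite !mul0r !addr0 -mulrBr; apply: ler_wpM2l; [exact: ltW|lra].
- move=> m v mcap /eqP sn mv vT; have /andP[mv1 _] := mv.
  have v0 : 0 <= v := le_trans (times_ge0 clock_on (arrival_clock i0) (E0 w) (Einc w) m) mv1.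
  have v0T : 0 <= v <= T by rewrite v0.
  apply: big1 => i _; rewrite X_tildeE.
  have Xq := Xn_policy_in prim mht n0 mv vT.
  have -> : Xn M n policy i v w = 0; last by rewrite mul0r mulr0.
  apply: (@served_none (fun i => Xn M n policy i v w)) => [l|]; first exact: X_ge0.
  by rewrite Xq.
- left; rewrite Zt (_ : idleness _ _ 0 = 0) ?ltW//.
  rewrite /idleness big1 ?subr0 ?mulr0// => i _.
  by have [-> _ _] := busy_facts mht w padm.
- by right; exists v; split => //; rewrite -lerBlDl.
Qed.

(** [last_active] applied to the effort of class [i]: while that class is served, the rule [served]
    places it at or above the curve. *)
Lemma policy_curve_tracking : running w -> curve_tracking T (mu M) (fun v i => f v ord0 i) Tt X.
Proof.
move=> rw u t i eta u0 ut tT eta0.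
apply: (@last_active _ _ (clock_epoch M n w) clock_on (arrival_clock i0) T 1 (Tt i)
  (fun m => service_on (rings w m) i)
  (fun v => f (workload (mu M) X v) ord0 i <= X i v) cap ltr01) => //; last first.
- exact: le_trans tT (ltW (running_cap rw)).
- move=> m v mcap; rewrite /service_on => /andP[_ /eqP sv] mv vT.
  have [_] := served_gt0 sv; rewrite -(Xn_policy_in prim mht n0 mv vT) X_tildeE.
  by rewrite workload_X_tilde.
- move=> m s v mcap ms sv vm vT.
  rewrite !(busy_policy_in prim mht n0 i (m := m)) ?(le_trans ms sv) ?(le_trans sv)//.
  by case: service_on => /=; rewrite ?mul0r//; lra.
Qed.

(** Combines the two cases of [policy_robust]: twice the weighted noise bound plus 1 when the cap is
    not met, and idleness at most [(I + I) * c * T] when it is. The inner sum, times [1 + c],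
    majorizes [noise_bound] at [C = c]. *)
Definition robust_const : R :=
  2 * (weight_sum (mu M) * (data_sum (dlam M) (dmu M) (fun i => x0 M ord0 i) + 3 +
    2 * (data_sum (dlam M) (dmu M) (fun i => x0 M ord0 i) + 1) * T + 2)) + 1 +
  (I + I)%:R * T.

Lemma policy_robust (c : R) : 0 <= c ->
  (forall i, [/\ `|(X0 M n i)%:R / scale M n - x0 M ord0 i| <= 1,
    `|(lamn M n i - n%:R * lam M i) / scale M n - dlam M i| <= 1 &
    `|(mun M n i - n%:R * mu M i) / scale M n - dmu M i| <= 1]) ->
  (forall t j, 0 <= t <= T -> `|AS_tilde M n w t ord0 j| <= c) ->
  forall t, 0 <= t <= T -> dotp (theta M) (X_tilde M n policy t w) <= robust_const * (1 + c).
Proof.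
move=> c0 Hp Hc t t0T; rewrite -workload_X_tilde.
have mu0 := mu_gt0 mht; have W0 := weight_sum_ge0 mu0.
(* The noise is taken as its own limit path, so that the estimates with [delta = 1] apply although
   the noise is near no fixed path. *)
have pre := prelimit_path prim mht n0 padm ne (delta := 1)
  (p1 := fun i t => AS_tilde M n w t ord0 (lshift I i))
  (p2 := fun i t => AS_tilde M n w t ord0 (rshift I i)) Hp.
have same i u : 0 <= u <= T ->
    `|AS_tilde M n w u ord0 (lshift I i) - AS_tilde M n w u ord0 (lshift I i)| <= 1 /\
    `|AS_tilde M n w u ord0 (rshift I i) - AS_tilde M n w u ord0 (rshift I i)| <= 1.
  by rewrite !subrr !normr0 ler01.
have {same}pre := pre same.
pose ds := data_sum (dlam M) (dmu M) (fun i => x0 M ord0 i).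
have ds0 : 0 <= ds := data_sum_ge0 _ _ _.
pose A := ds + 3 + 2 * (ds + 1) * T + 2.
have dT : 0 <= (ds + 1) * T by rewrite mulr_ge0 ?addr_ge0// ltW.
have A2 : 2 <= A by rewrite /A; lra.
set nb := noise_bound T (dlam M) (dmu M) (fun i => x0 M ord0 i) c.
have nbA : nb <= A * (1 + c).
  by have := ler_wpM2r c0 A2; rewrite /nb /noise_bound -/ds /A; lra.
have WnA := ler_wpM2l W0 nbA.
have b1 i : bounded_on T (fun t => AS_tilde M n w t ord0 (lshift I i)) c by move=> u; exact: Hc.
have b2 i : bounded_on T (fun t => AS_tilde M n w t ord0 (rshift I i)) c by move=> u; exact: Hc.
have HW v : 0 <= v <= T -> exists2 q, `|q| <= weight_sum (mu M) * nb &
    workload (mu M) X v = q + idleness (speedup M n) Tt v.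
  move=> v0T; rewrite (workloadE mu0 (critical_load mht) pre v0T).
  eexists; last by reflexivity.
  apply: weighted_norm => // i; exact: (noise_le b1 b2 pre).
have KE : robust_const * (1 + c) = 2 * (weight_sum (mu M) * (A * (1 + c))) + (1 + c) +
    (I + I)%:R * T * (1 + c).
  by rewrite /robust_const -/ds /A; ring.
have IT : 0 <= (I + I)%:R * T * (1 + c) by rewrite !mulr_ge0// ?addr_ge0// ltW.
have WA : 0 <= weight_sum (mu M) * (A * (1 + c)).
  by rewrite mulr_ge0// mulr_ge0 ?addr_ge0//; lra.
have [q qn WE] := HW t t0T; have /andP[t0 tT] := t0T; rewrite KE WE.
have {}qn := le_trans (ler_norm q) qn.
have [rw|nr] := pselect (running w).
  have [L1|[u [u0 ut Wu Lu]]] := policy_work_conserving rw t0T ltr01.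
    by move: qn L1 WnA IT WA; lra.
  have u0T : 0 <= u <= T by rewrite u0 (le_trans ut).
  have [q' qn' WE'] := HW u u0T; rewrite Wu in WE'.
  have := ler_norm (- q'); rewrite normrN => h; move: qn qn' WE' h Lu WnA IT; lra.
have := stopped_bound nr Hc => rn.
have idl : idleness (speedup M n) Tt t <= (I + I)%:R * c * T.
  have r0 : 0 <= speedup M n by rewrite divr_ge0// ltW.
  apply: (@le_trans _ _ (speedup M n * T)); last by rewrite ler_wpM2r// ltW.
  rewrite /idleness ler_wpM2l//; apply: (le_trans _ tT); rewrite gerBl; apply: sumr_ge0 => i _.
  by have [b0 nd _] := busy_facts mht w padm; have := nd i 0 t (lexx 0) t0 tT; rewrite b0.
have IT0 : 0 <= (I + I)%:R * T by rewrite mulr_ge0// ltW.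
by move: qn idl WnA WA IT0; lra.
Qed.

End one_path.

End policy_paths.

(** * Upper bound *)

Section policy_cost.
Context {R : realType} {d : measure_display} {Omega : measurableType d}
  {P : probability Omega R} {I : nat}.
Variable M : queue_model P I.
Hypothesis prim : renewal_primitives M.
Hypothesis mht : moderate_heavy_traffic M.
Hypothesis costs : cost_functions M.
Variable f : R -> 'rV[R]_I.
Hypothesis cf : {within `[0, +oo[, continuous f}.
Hypothesis fmin : forall w : R, 0 <= w ->
  let level := [set q | orthant I q /\ dotp (theta M) q = w] in
  [/\ orthant I (f w), dotp (theta M) (f w) = w,
      cost_h M (f w) = inf [set cost_h M q | q in level] &
      cost_g M (f w) = inf [set cost_g M q | q in level]].
Variable i0 : 'I_I.
Notation T := (horizon M).
Notation leb := (@lebesgue_measure R).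
Implicit Types (psi : R -> 'rV[R]_(I + I)) (n : nat) (w : Omega) (i : 'I_I).

Let T0 : 0 < T := horizon_gt0 mht.
Let fo := f_orth fmin.
Let fl := f_lev fmin.
Notation policy n := (policy M f n i0).
Notation policy_cost n w := (path_cost M n (policy n) w).

Let policy_ok n : (0 < n)%N -> admissible M n (policy n).
Proof. by move=> n0; exact: policy_admissible. Qed.

Lemma orthant_coord_le q i : orthant I q -> q ord0 i <= mu M i * dotp (theta M) q.
Proof.
move=> oq; rewrite dotp_thetaE -ler_pdivrMl ?mu_gt0//.
by apply: (weighted_ge (mu_gt0 mht) (v := fun i => q ord0 i)).
Qed.

Lemma path_cost_le_cst n B w (c : R) : 0 <= c ->
  (forall t, 0 <= t <= T -> orthant I (X_tilde M n B t w)) ->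
  (forall t, 0 <= t <= T -> cost_h M (X_tilde M n B t w) <= c) ->
  cost_g M (X_tilde M n B T w) <= c -> (path_cost M n B w <= ((T + 1) * c)%:E)%E.
Proof.
move=> c0 oX hc gc; rewrite /path_cost mulrDl mul1r EFinD; apply: leeD; last by rewrite lee_fin.
have -> : ((T * c)%:E = \int[leb]_(t in `[0%R, T]) (cst c%:E) t)%E.
  by rewrite integral_cst//= lebesgue_measure_itv /= lte_fin T0 sube0 -EFinM mulrC.
apply: ge0_integral_le => t tT; last by rewrite /= lee_fin.
have t0T : 0 <= t <= T by move: tT; rewrite /= in_itv.
split => //; rewrite lee_fin; last exact: hc.
by apply: (h_ge0 costs); exact: oX.
Qed.

Lemma indicator_integral (c s : R) : 0 <= c -> 0 <= s ->
  (\int[leb]_(t in `[0%R, T]) (c * \1_(`[0%R, s[%classic) t)%:E <= (c * s)%:E)%E.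
Proof.
move=> c0 s0; have mA : measurable (`[0%R, s[%classic : set (measurableTypeR R)).
  exact: measurable_itv.
have -> : (\int[leb]_(t in `[0%R, T]) (c * \1_(`[0%R, s[%classic) t)%:E =
    c%:E * \int[leb]_(t in `[0%R, T]) (\1_(`[0%R, s[%classic) t)%:E)%E.
  rewrite -ge0_integralZl_EFin//.
  by apply/measurable_EFinP; exact: measurable_indic.
rewrite integral_indic// EFinM lee_wpmul2l ?lee_fin//.
apply: (@le_trans _ _ (leb `[0, s]%classic)).
  apply: le_measure; rewrite ?inE; [|exact: measurable_itv|].
    by apply: measurableI => //; exact: measurable_itv.
  by move=> t [/=]; rewrite !in_itv /= => /andP[-> /ltW ->].
by rewrite lebesgue_measure_itv /=; case: ifP => // _; rewrite sube0.
Qed.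

(** The initial queues may be away from the curve, so tracking is available only after a short time
    [s]. The cost over [0, s[ is bounded by monotonicity, the rest by continuity of the costs along
    the curve. *)
Lemma policy_cost_le psi (e : R) : game_P M psi -> 0 < e -> exists2 delta : R, 0 < delta &
  \forall n \near \oo, forall w, no_explosion M n w ->
    cball T psi delta (AS_tilde M n w) -> (policy_cost n w <= min_cost M f psi + e%:E)%E.
Proof.
move=> Pp e0; have [C [u1 u2 b1 b2]] := game_path mht Pp.
have [D D0 HD] := min_workload_itv mht Pp.
have T1 : 0 < T + 1 by rewrite ltr_wpDl// ltW.
have e40 : 0 < e / 4 / (T + 1) by rewrite !divr_gt0.
case: (costs) => ch cg _.
have [kh kh0 Hh] := curve_cost_cont cf fo ch D e40.
have [kg kg0 Hg] := curve_cost_cont cf fo cg D e40.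
(* Dominates the queues whenever the workload is at most [D + 1], so [Hm] bounds the running cost
   before tracking sets in. *)
pose top : 'rV[R]_I := \row_i (mu M i * (D + 1)).
have otop : orthant I top by move=> i; rewrite mxE mulr_ge0 ?addr_ge0// ltW// mu_gt0.
pose Hm := cost_h M top; have Hm0 : 0 <= Hm by exact: (h_ge0 costs).
(* [s] is both the length of the initial layer and the tracking accuracy; its last term ensures
   [Hm * s <= e / 4]. *)
pose s := Num.min (Num.min kh kg) (Num.min T (e / 4 / (Hm + 1))).
have Hm1 : 0 < Hm + 1 by rewrite ltr_wpDl.
have s0 : 0 < s by rewrite !lt_min kh0 kg0 T0 !divr_gt0.
have : s <= s by []; rewrite {2}/s !le_min => /andP[/andP[skh skg] /andP[sT sH]].
have [dA [rA [dA0 rA0 HA]]] := fluid_workload_upper (dlam M) (dmu M) (fun i => x0 M ord0 i)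
  T0 (lam_gt0 mht) (mu_gt0 mht) (critical_load mht) u2 b1 b2 (@ltr01 R).
have f0' v i : 0 <= v -> 0 <= f v ord0 i by move=> /fo; exact.
have fl' v : 0 <= v -> weighted (mu M) (fun i => f v ord0 i) = v.
  by move=> /fl; rewrite dotp_thetaE.
have [dB [rB [dB0 rB0 HB]]] := fluid_tracking (dlam M) (dmu M) (fun i => x0 M ord0 i)
  T0 (lam_gt0 mht) (mu_gt0 mht) (critical_load mht) u1 u2 b1 b2 f0' fl'
  (fun D i => curve_unif_cont cf D i) s0.
pose delta := Num.min 1 (Num.min dA dB).
have delta0 : 0 < delta by rewrite !lt_min ltr01 dA0.
have : delta <= delta by []; rewrite {2}/delta !le_min => /and3P[d1 ddA ddB].
exists delta => //; near=> n => w ne bw.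
have n0 : (0 < n)%N by near: n; exact: nbhs_infty_gt.
have aB := policy_ok n0.
have bw' t i : 0 <= t <= T -> `|AS_tilde M n w t ord0 (lshift I i) - path1 psi i t| <= delta /\
     `|AS_tilde M n w t ord0 (rshift I i) - path2 psi i t| <= delta.
  by move=> t0T; rewrite path1E path2E; split; exact: bw.
have pre := prelimit_path prim mht n0 aB ne (delta := delta).
have {}pre := pre _ _ _ (fun i t => bw' t i).
have {}pre : prelimit T (lam M) (mu M) (dlam M) (dmu M) (fun i => x0 M ord0 i)
    (path1 psi) (path2 psi) delta (speedup M n) (fun i => (X0 M n i)%:R / scale M n)
    (fun i => (lamn M n i - n%:R * lam M i) / scale M n)
    (fun i => (mun M n i - n%:R * mu M i) / scale M n)
    (fun i t => AS_tilde M n w t ord0 (lshift I i))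
    (fun i t => AS_tilde M n w t ord0 (rshift I i))
    (fun i t => busy (policy n) i t w) (fun i t => X_tilde M n (policy n) t w ord0 i).
  by apply: pre; near: n; exact: parameters_close.
(* Noise near [psi] is bounded by [C + 1], too little to reach the cap once the speed is large. *)
have rw : running M f n i0 w.
  apply: contrapT => nr; have Hc t (j : 'I_(I + I)) : 0 <= t <= T ->
      `|AS_tilde M n w t ord0 j| <= C + 1.
    move=> t0T; have h1 := bw t t0T j.
    have h2 : `|psi t ord0 j| <= C.
      rewrite -(splitK j); case: (fintype.split j) => i /=.
        by rewrite -path1E; exact: b1.
      by rewrite -path2E; exact: b2.
    have := ler_normD (AS_tilde M n w t ord0 j - psi t ord0 j) (psi t ord0 j).
    by rewrite subrK; move: h1 h2 d1; lra.
  have := stopped_bound prim mht n0 nr Hc; rewrite leNgt => /negP; apply.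
  apply: (@lt_le_trans _ _ ((I + I)%:R * (C + 1) + 1)); first by rewrite ltrDl.
  by near: n; exact: speedup_large.
have wc := policy_work_conserving prim mht fo fl n0 ne rw.
have ct := policy_curve_tracking prim mht n0 rw.
have r1 : rA <= speedup M n by near: n; exact: speedup_large.
have r2 : rB <= speedup M n by near: n; exact: speedup_large.
have {}HA := HA _ _ _ _ _ _ _ _ _ ddA r1 pre wc.
have {}HB := HB _ _ _ _ _ _ _ _ _ ddB r2 pre wc ct.
have oX t : 0 <= t <= T -> orthant I (X_tilde M n (policy n) t w).
  exact: (X_tilde_ge0 prim mht n0 aB ne).
have htop t : 0 <= t <= T -> cost_h M (X_tilde M n (policy n) t w) <= Hm.
  move=> t0T; case: ch => _ _; apply => //; first exact: oX.
  move=> i; rewrite [leRHS]mxE; apply: le_trans (orthant_coord_le i (oX t t0T)) _.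
  rewrite ler_pM2l ?mu_gt0// -workload_X_tilde; apply: le_trans (HA t t0T) _.
  by rewrite lerD2r; have /andP[] := HD t t0T.
have htr t : s <= t -> t <= T ->
    cost_h M (X_tilde M n (policy n) t w) <= cost_h M (f (min_workload M psi t)) + e / 4 / (T + 1).
  move=> st tT; have t0T : 0 <= t <= T by rewrite (le_trans (ltW s0)).
  have := Hh (min_workload M psi t) (X_tilde M n (policy n) t w) (HD t t0T) (oX t t0T).
  rewrite ler_norml => /(_ (fun i => le_trans (HB t i st tT) skh))/andP[_].
  by lra.
have gtr : cost_g M (X_tilde M n (policy n) T w) <=
    cost_g M (f (min_workload M psi T)) + e / 4 / (T + 1).
  have TT := terminal_time mht.
  have := Hg (min_workload M psi T) (X_tilde M n (policy n) T w) (HD T TT) (oX T TT).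
  rewrite ler_norml => /(_ (fun i => le_trans (HB T i sT (lexx T)) skg))/andP[_].
  by lra.
have HG0 t : 0 <= t <= T -> 0 <= cost_h M (f (min_workload M psi t)).
  by move=> t0T; exact: (running_cost_ge0 mht costs fmin).
have mG := running_cost_measurable mht costs cf fmin Pp.
have mI : measurable_fun `[0, T] (fun t : R => Hm * \1_(`[0%R, s[%classic) t).
  apply: measurable_funM => //; apply: measurable_indic; exact: measurable_itv.
rewrite /path_cost /min_cost.
have key : (\int[leb]_(t in `[0%R, T]) (cost_h M (X_tilde M n (policy n) t w))%:E <=
    \int[leb]_(t in `[0%R, T]) (cost_h M (f (min_workload M psi t)))%:E +
    (Hm * s + T * (e / 4 / (T + 1)))%:E)%E.
  pose v t := cost_h M (f (min_workload M psi t)) + Hm * \1_(`[0%R, s[%classic) t.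
  apply: (@le_trans _ _ (\int[leb]_(t in `[0%R, T]) (v t)%:E + (T * (e / 4 / (T + 1)))%:E)%E).
    apply: integral_le_addl => //; first exact: ltW.
      exact: measurable_funD.
    move=> t t0T; split; first by apply: (h_ge0 costs); exact: oX.
      by rewrite addr_ge0// ?HG0// mulr_ge0.
    rewrite /v; have /andP[t0 tT] := t0T; have [ts|st] := ltP t s.
      rewrite indicE mem_set ?mulr1; last by rewrite /= in_itv /= t0.
      by have := htop t t0T; have := HG0 t t0T; move: e40; lra.
    rewrite indicE memNset ?mulr0 ?addr0; last by rewrite /= in_itv /= t0 ltNge st.
    exact: htr.
  rewrite EFinD addeA leeD2r//.
  have -> : (\int[leb]_(t in `[0%R, T]) (v t)%:E =
     \int[leb]_(t in `[0%R, T]) (cost_h M (f (min_workload M psi t)))%:E +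
     \int[leb]_(t in `[0%R, T]) (Hm * \1_(`[0%R, s[%classic) t)%:E)%E.
    rewrite -ge0_integralD//.
    - exact/measurable_EFinP.
    - by move=> t _; rewrite lee_fin mulr_ge0.
    - exact/measurable_EFinP.
  by rewrite leeD2l//; apply: indicator_integral => //; exact: ltW.
apply: (@le_trans _ _ (\int[leb]_(t in `[0%R, T]) (cost_h M (f (min_workload M psi t)))%:E +
    (Hm * s + T * (e / 4 / (T + 1)))%:E +
    (cost_g M (f (min_workload M psi T)) + e / 4 / (T + 1))%:E)%E).
  by apply: leeD => //; rewrite lee_fin.
set J := integral _ _ _; rewrite -[leLHS]addeA -[leRHS]addeA -!EFinD; apply: leeD2l.
move: key => _; rewrite lee_fin.
have : Hm * s <= e / 4.
  apply: (@le_trans _ _ ((Hm + 1) * s)); first by rewrite ler_wpM2r ?lerDl// ltW.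
  by rewrite mulrC -ler_pdivlMr.
have : T * (e / 4 / (T + 1)) + e / 4 / (T + 1) = e / 4 by field; rewrite lt0r_neq0.
by move: e0; lra.
Unshelve. all: by end_near. Qed.

(** Linear growth of the costs turns the workload bound of [policy_robust] into a cost bound linear
    in the noise, the form that exponential moments can absorb. *)
Lemma policy_cost_robust : exists2 C : R, 0 < C & \forall n \near \oo, forall w (c : R),
  no_explosion M n w -> 0 <= c ->
  (forall t j, 0 <= t <= T -> `|AS_tilde M n w t ord0 j| <= c) ->
  (policy_cost n w <= (C * (1 + c))%:E)%E.
Proof.
case: (costs) => ch cg [c1 [c2 c12]].
pose S := \sum_i mu M i; have S0 : 0 <= S by apply: sumr_ge0 => i _; rewrite ltW// mu_gt0.
have iS i : mu M i <= S.
  by rewrite /S (bigD1 i)//= lerDl sumr_ge0// => l _; rewrite ltW// mu_gt0.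
pose K := `|robust_const M|; have K0 : 0 <= K by exact: normr_ge0.
have T1 : 0 < T + 1 by rewrite ltr_wpDl// ltW.
pose A := `|c1| * (I%:R * (S * K)) + `|c2|.
have A0 : 0 <= A by rewrite addr_ge0// !mulr_ge0.
exists ((T + 1) * A + 1); first by rewrite ltr_wpDl// mulr_ge0// ltW.
near=> n => w c ne c0 Hc.
have n0 : (0 < n)%N by near: n; exact: nbhs_infty_gt.
have c10 : 0 <= 1 + c by rewrite addr_ge0.
have oX t : 0 <= t <= T -> orthant I (X_tilde M n (policy n) t w).
  exact: (X_tilde_ge0 prim mht n0 (policy_ok n0) ne).
have W t : 0 <= t <= T -> dotp (theta M) (X_tilde M n (policy n) t w) <= K * (1 + c).
  move=> t0T; apply: (@le_trans _ _ (robust_const M * (1 + c))).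
    apply: (policy_robust prim mht fo fl i0 n0 ne c0) => //.
    by near: n; exact: parameters_close.
  by rewrite ler_wpM2r// ler_norm.
have hg t : 0 <= t <= T -> cost_g M (X_tilde M n (policy n) t w) +
    cost_h M (X_tilde M n (policy n) t w) <= A * (1 + c).
  move=> t0T; apply: le_trans (c12 _ (oX t t0T)) _.
  have en : enorm (X_tilde M n (policy n) t w) <= I%:R * (S * (K * (1 + c))).
    apply: enorm_le_coord; first by rewrite !mulr_ge0.
    move=> i; rewrite ger0_norm; last exact: oX.
    apply: le_trans (orthant_coord_le i (oX t t0T)) _.
    apply: ler_pM => //; first by rewrite ltW// mu_gt0.
      by apply: sumr_ge0 => l _; rewrite mulr_ge0 ?oX// ltW// theta_gt0.
    exact: W.
  have -> : A * (1 + c) = `|c1| * (I%:R * (S * (K * (1 + c)))) + `|c2| * (1 + c).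
    by rewrite /A; ring.
  apply: lerD.
    apply: (@le_trans _ _ (`|c1| * enorm (X_tilde M n (policy n) t w))).
      by rewrite ler_wpM2r ?ler_norm// sqrtr_ge0.
    by rewrite ler_wpM2l.
  by apply: le_trans (ler_norm c2) _; rewrite ler_peMr// lerDl.
apply: (@le_trans _ _ ((T + 1) * (A * (1 + c)))%:E).
  apply: path_cost_le_cst => //; first by rewrite mulr_ge0.
    move=> t t0T; apply: le_trans (hg t t0T); rewrite lerDr; apply: (g_ge0 costs).
    exact: oX.
  apply: le_trans (hg T (terminal_time mht)); rewrite lerDl; apply: (h_ge0 costs).
  exact: oX (terminal_time mht).
by rewrite lee_fin mulrA ler_wpM2r// lerDl.
Unshelve. all: by end_near. Qed.

End policy_cost.

Section upper_bound.
Context {R : realType} {d : measure_display} {Omega : measurableType d}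
  {P : probability Omega R} {I : nat}.
Variable M : queue_model P I.
Hypothesis prim : renewal_primitives M.
Hypothesis mht : moderate_heavy_traffic M.
Hypothesis costs : cost_functions M.
Variable f : R -> 'rV[R]_I.
Hypothesis cf : {within `[0, +oo[, continuous f}.
Hypothesis fmin : forall w : R, 0 <= w ->
  let level := [set q | orthant I q /\ dotp (theta M) q = w] in
  [/\ orthant I (f w), dotp (theta M) (f w) = w,
      cost_h M (f w) = inf [set cost_h M q | q in level] &
      cost_g M (f w) = inf [set cost_g M q | q in level]].
Notation T := (horizon M).
Implicit Types (psi phi : R -> 'rV[R]_(I + I)) (n : nat) (w : Omega) (i : 'I_I).

Let T0 : 0 < T := horizon_gt0 mht.
Let T_ge0 : 0 <= T := ltW T0.

Let va i : 0 < lam M i * sigma_ia M i ^+ 2.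
Proof. by case: prim => _ _ _ _ /(_ i 0%N)[a _ _ _]; rewrite mulr_gt0 ?lam_gt0// exprn_gt0. Qed.

Let vs i : 0 < mu M i * sigma_st M i ^+ 2.
Proof. by case: prim => _ _ _ _ /(_ i 0%N)[_ a _ _]; rewrite mulr_gt0 ?mu_gt0// exprn_gt0. Qed.

Lemma rate_holder (K : R) : 0 <= K -> exists2 L : R, 0 <= L & forall phi,
  (rate M phi <= K%:E)%E -> holder T L (phi \o clamp T).
Proof.
move=> K0.
exists (\sum_i lam M i * sigma_ia M i ^+ 2 * K + \sum_i mu M i * sigma_st M i ^+ 2 * K).
  by rewrite addr_ge0// sumr_ge0// => i _; rewrite mulr_ge0 ?(ltW (va i)) ?(ltW (vs i)).
set L := _ + _; move=> phi phiK.
have aK : (action T (fun i => lam M i * sigma_ia M i ^+ 2)%R (lsubmx \o phi) <= K%:E)%E.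
  by apply: le_trans phiK; rewrite /rate leeDl// action_ge0.
have sK : (action T (fun i => mu M i * sigma_st M i ^+ 2)%R (rsubmx \o phi) <= K%:E)%E.
  by apply: le_trans phiK; rewrite /rate leeDr// action_ge0.
have aL i : lam M i * sigma_ia M i ^+ 2 * K <= L.
  rewrite /L (bigD1 i)//= -addrA lerDl addr_ge0// sumr_ge0// => l _.
    by rewrite mulr_ge0// ltW.
  by rewrite mulr_ge0// ltW.
have sL i : mu M i * sigma_st M i ^+ 2 * K <= L.
  rewrite /L [X in _ + X](bigD1 i)//= addrCA lerDl addr_ge0// sumr_ge0// => l _.
    by rewrite mulr_ge0// ltW.
  by rewrite mulr_ge0// ltW.
have inc s t c j : 0 <= s -> s <= t -> t <= T -> 0 < c ->
    `|phi t ord0 j - phi s ord0 j| <= c * (t - s) + L / c.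
  move=> s0 st tT c0; rewrite -(splitK j); case: (fintype.split j) => i /=.
    have := action_increment T0 i va aK s0 st tT c0; rewrite /= !mxE => /le_trans; apply.
    by rewrite lerD2l ler_pM2r// invr_gt0.
  have := action_increment T0 i vs sK s0 st tT c0; rewrite /= !mxE => /le_trans; apply.
  by rewrite lerD2l ler_pM2r// invr_gt0.
split=> [j|s t j c c0] /=.
  rewrite clamp_id ?lexx// -(splitK j); case: (fintype.split j) => i /=.
    by have := action_phi0 i aK; rewrite /= mxE.
  by have := action_phi0 i sK; rewrite /= mxE.
have /andP[s0 sT] := clamp_itv s T_ge0; have /andP[t0 tT] := clamp_itv t T_ge0.
have [st|/ltW ts] := leP (clamp T s) (clamp T t).
  by rewrite (@ger0_norm _ (clamp T t - _)) ?subr_ge0//; exact: inc.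
rewrite distrC [X in c * X]distrC (@ger0_norm _ (clamp T s - _)) ?subr_ge0//; exact: inc.
Qed.

Lemma holder_game_P (L : R) psi : 0 <= L -> holder T L (psi \o clamp T) -> game_P M psi.
Proof.
move=> L0 H; split.
  apply: unif_cont_cpath => j e e0; have [delta d0 Hd] := @holder_unif_cont _ T (I + I) _ _ L0 e0.
  exists delta => // s t s0 t0 st; have := Hd _ s t j H s0 t0 st.
  by rewrite /= !clamp_id.
apply/rowP => j; have [+ _] := H; move=> /(_ j) /=; rewrite clamp_id ?lexx//.
by move=> ->; rewrite mxE.
Qed.

Lemma holder_clamp_game_P (L : R) psi : 0 <= L -> holder T L psi -> game_P M psi.
Proof.
move=> L0 [H0 H]; apply: (holder_game_P L0); split=> [j|s t j c c0] /=.
  by rewrite clamp_id ?lexx.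
have := H (clamp T s) (clamp T t) j c c0.
by rewrite !(@clamp_id _ T (clamp T _)) ?clamp_itv.
Qed.

Lemma rate_game_P phi : (rate M phi < +oo)%E -> game_P M phi.
Proof.
have := rate_ge0 prim mht phi; case rE : (rate M phi) => [K||]//; rewrite lee_fin => K0 _.
have [L L0 H] := rate_holder K0; apply: (holder_game_P L0); apply: H.
by rewrite rE.
Qed.

Lemma rcll_event_measurable n (A : set (R -> 'rV[R]_(I + I))) : (0 < n)%N ->
  measurable [set w | A (AS_tilde M n w)] ->
  measurable [set w | (rcll T (I + I) `&` A) (AS_tilde M n w)].
Proof.
move=> n0 mA; have -> : [set w | (rcll T (I + I) `&` A) (AS_tilde M n w)] =
    [set w | no_explosion M n w] `&` [set w | A (AS_tilde M n w)].
  by apply/seteqP; split => w [/(rcll_AS_tilde prim mht w n0) r o].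
by apply: measurableI => //; have [] := no_explosion_ae prim mht n0.
Qed.

Variable i0 : 'I_I.
Notation policy n := (policy M f n i0).
Notation policy_cost n w := (path_cost M n (policy n) w).

(** Bounded costs allow [G = 0]. Otherwise the cost is at most [C * (1 + r)] for noise of norm [r]:
    a constant when [r <= L], and at most [C - C * L + 2 * C * r] when [r >= L]. The doubled
    exponent leaves a factor that brings the mean of [G] below 1. *)
Lemma tail_control :
  (~ bounded_cost (cost_g M) \/ ~ bounded_cost (cost_h M) -> exponential_moments M) ->
  exists (A : R) (G : nat -> Omega -> \bar R), \forall n \near \oo,
  [/\ measurable_fun setT (G n), forall w, (0 <= G n w)%E, (\int[P]_w G n w <= 1)%E &
    forall w, no_explosion M n w -> (expeR ((bn M n ^+ 2)%:E * policy_cost n w) <=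
      (expR (bn M n ^+ 2 * A))%:E + G n w)%E].
Proof.
move=> em; have [[bg bh]|nb] := pselect (bounded_cost (cost_g M) /\ bounded_cost (cost_h M)).
  have [Cg [_ /(_ (Cg + 1))]] := bg; rewrite ltrDl ltr01 => /(_ isT) Hg.
  have [Ch [_ /(_ (Ch + 1))]] := bh; rewrite ltrDl ltr01 => /(_ isT) Hh.
  pose C := `|Cg + 1| + `|Ch + 1|.
  exists ((T + 1) * C), (fun _ _ => 0%E); near=> n; split => //.
    by rewrite integral0.
  move=> w ne; have n0 : (0 < n)%N by near: n; exact: nbhs_infty_gt.
  have b0 : 0 < bn M n ^+ 2 by case: mht => _ [bpos _ _] _ _ _; rewrite exprn_gt0// bpos.
  rewrite adde0 -[(expR _)%:E]/(expeR (_%:E)) lee_expeR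
    (EFinM (bn M n ^+ 2) ((T + 1) * C)) lee_pmul2l ?lte_fin//.
  have oX t : 0 <= t <= T -> orthant I (X_tilde M n (policy n) t w).
    exact: (X_tilde_ge0 prim mht n0 (policy_admissible prim mht f i0 n0) ne).
  have TT := terminal_time mht.
  apply: path_cost_le_cst => //; first by rewrite addr_ge0.
    move=> t t0T; apply: le_trans (ler_norm _) _; apply: le_trans (Hh _ (oX t t0T)) _.
    by apply: le_trans (ler_norm _) _; rewrite lerDr.
  apply: le_trans (ler_norm _) _; apply: le_trans (Hg _ (oX T TT)) _.
  by apply: le_trans (ler_norm _) _; rewrite lerDl.
have {}em : exponential_moments M.
  apply: em; apply: contrapT => /not_orP[/contrapT a /contrapT b]; apply: nb; by split.
have [C C0 HC] := policy_cost_robust prim mht costs fmin i0.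
have C20 : 0 <= 2 * C by rewrite mulr_ge0// ltW.
have [c Hc] := path_norm_moments mht em C20.
(* Makes [C - C * L + c <= 0], where [c] bounds the exponential growth of the moment with exponent
   [2 * C]. *)
pose L := Num.max 0 ((C + c) / C).
have L0 : 0 <= L by rewrite le_max lexx.
have LC : C - C * L + c <= 0.
  have : (C + c) / C <= L by rewrite le_max lexx orbT.
  by rewrite ler_pdivrMr// mulrC; lra.
exists (C * (1 + L)), (fun n w => (expR (bn M n ^+ 2 * (C - C * L)))%:E *
  expeR ((bn M n ^+ 2)%:E * ((2 * C)%:E * path_norm M n w)))%E.
near=> n; have n0 : (0 < n)%N by near: n; exact: nbhs_infty_gt.
have b0 : 0 < bn M n ^+ 2 by case: mht => _ [bpos _ _] _ _ _; rewrite exprn_gt0// bpos.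
have mE : measurable_fun setT (fun w => expeR ((bn M n ^+ 2)%:E * ((2 * C)%:E * path_norm M n w))).
  have -> : (fun w => expeR ((bn M n ^+ 2)%:E * ((2 * C)%:E * path_norm M n w))) =
      er_map expR \o (fun w => (bn M n ^+ 2)%:E * ((2 * C)%:E * path_norm M n w))%E.
    apply/funext => w /=.
    have : (0 <= (bn M n ^+ 2)%:E * ((2 * C)%:E * path_norm M n w))%E.
      by rewrite !mule_ge0// ?lee_fin ?(ltW b0)// path_norm_ge0.
    by case: (_ * _)%E.
  apply: measurableT_comp; first exact: (@measurable_er_map _ Omega R expR (@measurable_expR R)).
  by do 2 apply: measurable_funeM; exact: measurable_path_norm.
split.
- exact: measurable_funeM.
- by move=> w; rewrite mule_ge0// ?lee_fin ?expR_ge0// expeR_ge0.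
- rewrite ge0_integralZl_EFin ?expR_ge0//; last by move=> w _; exact: expeR_ge0.
  apply: (@le_trans _ _ ((expR (bn M n ^+ 2 * (C - C * L)))%:E * expeR (bn M n ^+ 2 * c)%:E)%E).
    by rewrite lee_wpmul2l ?lee_fin ?expR_ge0//; near: n.
  rewrite /= -EFinM -expRD -mulrDr lee_fin -[leRHS]expR0 ler_expR.
  by rewrite mulr_ge0_le0// ltW.
move=> w ne; have := path_norm_ge0 M n w.
(* An infinite norm makes the right-hand side [+oo]. *)
case RE : (path_norm M n w) => [r| |]//; last first.
  move=> _; rewrite gt0_muley ?lte_fin ?mulr_gt0// gt0_muley ?lte_fin//=.
  by rewrite gt0_muley ?lte_fin ?expR_gt0// addey// leey.
rewrite lee_fin => r0.
have cost : (policy_cost n w <= (C * (1 + r))%:E)%E.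
  have : forall w (c : R), no_explosion M n w -> 0 <= c ->
    (forall t j, 0 <= t <= T -> `|AS_tilde M n w t ord0 j| <= c) ->
    (policy_cost n w <= (C * (1 + c))%:E)%E by near: n.
  apply => // t j t0T; apply: (path_norm_bound prim mht) => //.
  by rewrite RE.
apply: (@le_trans _ _ (expeR ((bn M n ^+ 2)%:E * (C * (1 + r))%:E))).
  by rewrite lee_expeR lee_pmul2l// lte_fin.
rewrite -!EFinM /= -?EFinM -?EFinD lee_fin -expRD -mulrDr.
have [rL|/ltW Lr] := leP r L.
  apply: ler_wpDr; first exact: expR_ge0.
  by rewrite ler_expR ler_wpM2l ?(ltW b0)// ler_wpM2l ?(ltW C0)// lerD2l.
apply: ler_wpDl; first exact: expR_ge0.
rewrite ler_expR ler_wpM2l ?(ltW b0)//.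
by have := ler_wpM2l (ltW C0) Lr; lra.
Unshelve. all: by end_near. Qed.

End upper_bound.

(** * Finite covering of the noise space and convergence of the values *)

Section convergence.
Context {R : realType} {d : measure_display} {Omega : measurableType d}
  {P : probability Omega R} {I : nat}.
Variable M : queue_model P I.
Hypothesis prim : renewal_primitives M.
Hypothesis mht : moderate_heavy_traffic M.
Hypothesis costs : cost_functions M.
Hypothesis mdp : moderate_deviation_principle M.
Variable f : R -> 'rV[R]_I.
Hypothesis cf : {within `[0, +oo[, continuous f}.
Hypothesis fmin : forall w : R, 0 <= w ->
  let level := [set q | orthant I q /\ dotp (theta M) q = w] in
  [/\ orthant I (f w), dotp (theta M) (f w) = w,
      cost_h M (f w) = inf [set cost_h M q | q in level] &
      cost_g M (f w) = inf [set cost_g M q | q in level]].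
Hypothesis moments :
  ~ bounded_cost (cost_g M) \/ ~ bounded_cost (cost_h M) -> exponential_moments M.
Notation T := (horizon M).
Notation AS n w := (AS_tilde M n w).
Implicit Types (psi phi : R -> 'rV[R]_(I + I)) (n : nat) (w : Omega) (i : 'I_I).

Let T0 : 0 < T := horizon_gt0 mht.
Let T_ge0 : 0 <= T := ltW T0.

Let b0 n : (0 < n)%N -> 0 < bn M n ^+ 2.
Proof. by move=> n0; case: mht => _ [bpos _ _] _ _ _; rewrite exprn_gt0// bpos. Qed.

(** Prefactors such as the number of covering balls are absorbed by an arbitrarily small loss in the
    exponent. *)
Lemma speed_large (c e : R) : 0 < e -> \forall n \near \oo, c <= expR (bn M n ^+ 2 * e).
Proof.
move=> e0; case: mht => _ [_ /cvgryPge blarge _] _ _ _; near=> n.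
have b1 : 1 <= bn M n by near: n; exact: blarge.
have b2 : `|c| / e <= bn M n by near: n; exact: blarge.
have bb : bn M n <= bn M n ^+ 2 by rewrite expr2 ler_peMr// (le_trans ler01).
apply: le_trans (ler_norm c) _; apply: le_trans (expR_ge1Dx _).
rewrite ler_pdivrMr// in b2; apply: (le_trans b2); rewrite -[leLHS]add0r lerD//.
by rewrite ler_wpM2r// ltW.
Unshelve. all: by end_near. Qed.

Lemma probability_upper (F : set (R -> 'rV[R]_(I + I))) (x e : R) : 0 < e ->
  j1_closed T F -> (forall phi, F phi -> (x%:E <= rate M phi)%E) ->
  \forall n \near \oo,
    (P [set w | F (AS n w)] <= (expR (bn M n ^+ 2 * (- x + e)))%:E)%E.
Proof.
move=> e0 cF HF; have [/(_ _ cF) up _] := mdp.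
have : (limn_esup (fun n => ((bn M n ^+ 2)^-1)%:E * lne (P [set w | F (AS n w)])) <
    (- x + e)%:E)%E.
  apply: le_lt_trans up _; apply: (@le_lt_trans _ _ (- x)%:E); last by rewrite lte_fin ltrDl.
  by rewrite EFinN leeN2; apply: le_ereal_inf_tmp => _ [phi Fphi <-]; exact: HF.
move=> /limn_esup_lt H; near=> n; have n0 : (0 < n)%N by near: n; exact: nbhs_infty_gt.
have : (((bn M n ^+ 2)^-1)%:E * lne (P [set w | F (AS n w)]) < (- x + e)%:E)%E by near: n.
by move=> /ltW; rewrite lee_pdivrMl ?b0// -EFinM lne_leP.
Unshelve. all: by end_near. Qed.

(** Under critical load the ratios sum to 1, so the sum is not empty; the policy takes its arrival
    clock from this class. *)
Lemma some_class : exists i : 'I_I, true.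
Proof.
apply: contrapT => no; have := critical_load mht; rewrite big1 => [|i _].
  by move/esym/eqP; rewrite oner_eq0.
by exfalso; apply: no; exists i.
Qed.

(** The radius precedes the premise [game_P M psi], so that choice yields a radius function on all
    paths, with the dummy value 0 outside [game_P]. *)
Lemma local_bounds psi (e : R) (i0 : 'I_I) : 0 < e -> exists delta : R, game_P M psi ->
  [/\ 0 < delta,
    forall phi, game_P M phi -> cball T psi delta phi ->
      (min_cost M f psi <= min_cost M f phi + e%:E)%E &
    \forall n \near \oo, forall w, no_explosion M n w -> cball T psi delta (AS n w) ->
      (path_cost M n (policy M f n i0) w <= min_cost M f psi + e%:E)%E].
Proof.
move=> e0; have [Pp|nP] := pselect (game_P M psi); last by exists 0.
have [d1 d10 H1] := min_cost_usc mht costs cf fmin Pp e0.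
have [d2 d20 H2] := policy_cost_le prim mht costs cf fmin i0 Pp e0.
exists (Num.min d1 d2) => _; split; first by rewrite lt_min d10.
  move=> phi Pphi b; apply: H1 => // t t0T i; apply: le_trans (b t t0T i) _.
  by rewrite ge_min lexx.
apply: filterS H2 => n H w ne b; apply: H => // t t0T i; apply: le_trans (b t t0T i) _.
by rewrite ge_min lexx orbT.
Qed.

Lemma Vn_le (v e : R) : 0 <= v -> 0 < e ->
  (forall psi, game_P M psi -> (min_cost M f psi - rate M psi <= v%:E)%E) ->
  \forall n \near \oo, (Vn M n <= (v + 4 * e)%:E)%E.
Proof.
move=> v0 e0 Hv; have [i0 _] := some_class.
have [A [G tail]] := tail_control prim mht costs fmin i0 moments.
(* Off all balls the probability is at most [expR (bn M n ^+ 2 * (- K + 1))]; this [K] offsets the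
   constant [expR (bn M n ^+ 2 * A)] of [tail_control]. *)
pose K := `|A| + 1; have K0 : 0 <= K by rewrite addr_ge0.
have [L L0 HL] := rate_holder prim mht K0.
have /choice[delta Hdelta] := fun psi => local_bounds psi i0 e0.
have hP psi : holder T L psi -> game_P M psi by exact: holder_clamp_game_P.
have [m [psi [Hpsi cov]]] := holder_cover T0 L0 (fun psi Hp =>
  let: And3 a _ _ := Hdelta psi (hP psi Hp) in a).
have Ppsi j := hP _ (Hpsi j).
have cpsi j : cpath T (I + I) (psi j) by have [] := Ppsi j.
pose O j := rcll T (I + I) `&` oball T (psi j) (delta (psi j)).
pose Oc j := rcll T (I + I) `&` cball T (psi j) (delta (psi j)).
pose F := rcll T (I + I) `\` \bigcup_(j in [set: 'I_m]) oball T (psi j) (delta (psi j)).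
pose mc j := fine (min_cost M f (psi j)).
have mcE j : min_cost M f (psi j) = (mc j)%:E.
  by rewrite fineK//; exact: (min_cost_fin mht costs cf fmin).
(* For [phi] in the ball, the hypothesis on [v] and the semicontinuity of the cost give
   [rate phi >= mc j - e - v]. *)
have POc : \forall n \near \oo, forall j,
    (P [set w | Oc j (AS n w)] <= (expR (bn M n ^+ 2 * (- (mc j - e - v) + e)))%:E)%E.
  apply: filter_forall => j; apply: probability_upper => //; first exact: j1_closed_cball.
  move=> phi [_ bphi]; have [rfin|] := ltP (rate M phi) +oo%E; last first.
    by rewrite leye_eq => /eqP ->; rewrite leey.
  have Pphi := rate_game_P prim mht rfin.
  have [_ usc _] := Hdelta _ (Ppsi j); have := usc _ Pphi bphi; have := Hv _ Pphi.
  have mcf := min_cost_fin mht costs cf fmin Pphi; rewrite mcE -(fineK mcf).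
  have := rate_ge0 prim mht phi; case: (rate M phi) rfin => [r||]// _ _.
  by rewrite -EFinB -EFinD !lee_fin; lra.
have PF : \forall n \near \oo, (P [set w | F (AS n w)] <= (expR (bn M n ^+ 2 * (- K + 1)))%:E)%E.
  apply: probability_upper => //; first by apply: j1_closed_oballC => // j _.
  move=> phi [_ nob]; rewrite leNgt; apply/negP => /ltW rK; apply: nob.
  have [j [eta etad ob]] := cov _ (HL _ rK); exists j => //; exists eta => // t t0T i.
  by have := ob t t0T i; rewrite /= clamp_id.
near=> n; have n0 : (0 < n)%N by near: n; exact: nbhs_infty_gt.
have bp := b0 n0.
have [mG G0 IG tl] : [/\ measurable_fun setT (G n), forall w, (0 <= G n w)%E,
    (\int[P]_w G n w <= 1)%E &
    forall w, no_explosion M n w ->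
      (expeR ((bn M n ^+ 2)%:E * path_cost M n (policy M f n i0) w) <=
        (expR (bn M n ^+ 2 * A))%:E + G n w)%E].
  by near: n.
have POn : forall j,
    (P [set w | Oc j (AS n w)] <= (expR (bn M n ^+ 2 * (- (mc j - e - v) + e)))%:E)%E.
  by near: n.
have PFn : (P [set w | F (AS n w)] <= (expR (bn M n ^+ 2 * (- K + 1)))%:E)%E by near: n.
have costn : forall j w, no_explosion M n w -> cball T (psi j) (delta (psi j)) (AS n w) ->
    (path_cost M n (policy M f n i0) w <= min_cost M f (psi j) + e%:E)%E.
  by near: n; apply: filter_forall => l; have [] := Hdelta _ (Ppsi l).
have big : m%:R + 2 <= expR (bn M n ^+ 2 * e) by near: n; exact: speed_large.
set b := bn M n ^+ 2 in bp tl POn PFn big *.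
have adm := policy_admissible prim mht f i0 n0.
have mO j : measurable [set w | O j (AS n w)].
  by apply: rcll_event_measurable => //; exact: measurable_oball.
have mF : measurable [set w | F (AS n w)].
  apply: (rcll_event_measurable prim mht (A := ~` _)) => //.
  rewrite (_ : [set w | _] = ~` \bigcup_(j in [set: 'I_m])
    [set w | oball T (psi j) (delta (psi j)) (AS n w)]); last by [].
  by apply: measurableC; apply: fin_bigcup_measurable => // j _; exact: measurable_oball.
pose N := ~` [set w | no_explosion M n w].
have [mNE PN] := no_explosion_ae prim mht n0; have mN : measurable N := measurableC mNE.
(* Besides the tail [G], the integrand is dominated over three events: near a center, far from all
   centers, and explosion. The last receives the value [+oo], harmless on a null set. *)
pose g1 w := (\sum_(j < m) (expR (b * (mc j + e)))%:E * (\1_[set w | O j (AS n w)] w)%:E)%E.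
pose g2 w := ((expR (b * A))%:E * (\1_[set w | F (AS n w)] w)%:E)%E.
pose g3 w := (+oo * (\1_N w)%:E : \bar R)%E.
have mind (S : set Omega) : measurable S -> measurable_fun setT (fun w => (\1_S w : R)%:E).
  by move=> mS; apply/measurable_EFinP; exact: measurable_indic.
have ind0 (S : set Omega) w : (0 <= (\1_S w : R)%:E)%E by rewrite lee_fin.
have t10 j w : (0 <= (expR (b * (mc j + e)))%:E * (\1_[set w | O j (AS n w)] w)%:E)%E.
  by rewrite mule_ge0// lee_fin expR_ge0.
have mt1 j : measurable_fun setT
    (fun w => (expR (b * (mc j + e)))%:E * (\1_[set w | O j (AS n w)] w)%:E)%E.
  by apply: measurable_funeM; exact: mind.
have g10 w : (0 <= g1 w)%E by apply: sume_ge0 => j _.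
have g20 w : (0 <= g2 w)%E by rewrite mule_ge0// lee_fin expR_ge0.
have g30 w : (0 <= g3 w)%E by rewrite mule_ge0.
have mg1 : measurable_fun setT g1 by exact: emeasurable_sum.
have mg2 : measurable_fun setT g2 by apply: measurable_funeM; exact: mind.
have mg3 : measurable_fun setT g3 by apply: measurable_funeM; exact: mind.
have pw w : (expeR (b%:E * path_cost M n (policy M f n i0) w) <= g1 w + g2 w + G n w + g3 w)%E.
  have [Nw|/contrapT ne] := pselect (N w).
    rewrite [g3 w](_ : _ = +oo%E) ?addey ?leey//; last by rewrite /g3 indicE mem_set//= mule1.
    by rewrite gt_eqF// (lt_le_trans (ltNyr 0))// !adde_ge0.
  have rc : rcll T (I + I) (AS n w) by exact/(rcll_AS_tilde prim mht w n0).
  apply: (le_trans _ (leeDl _ (g30 w))).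
  have [[j ob]|nob] := pselect (exists j, oball T (psi j) (delta (psi j)) (AS n w)).
    apply: (le_trans _ (leeDl _ (G0 w))); apply: (le_trans _ (leeDl _ (g20 w))).
    apply: (@le_trans _ _ (expR (b * (mc j + e)))%:E); last first.
      rewrite /g1 (bigD1 j)//= indicE mem_set ?mule1; last by split.
      by rewrite leeDl// sume_ge0.
    rewrite -[(expR _)%:E]/(expeR (_%:E)) lee_expeR (EFinM b (mc j + e)) lee_pmul2l ?lte_fin//.
    rewrite EFinD -mcE.
    apply: costn => //; have [eta etad ob'] := ob.
    by move=> t t0T i; exact: le_trans (ob' t t0T i) (ltW etad).
  apply: le_trans (tl w ne) _; rewrite leeD2r//.
  apply: (le_trans _ (leeDr _ (g10 w))); rewrite /g2 indicE mem_set ?mule1//.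
  by split => // -[j _ ob]; apply: nob; exists j.
have Ig3 : (\int[P]_w g3 w = 0)%E.
  have IN0 : (\int[P]_w (\1_N w : R)%:E = 0)%E by rewrite integral_indic// setIT.
  by rewrite /g3 ge0_integralZl// ?IN0 ?mule0//; exact: mind.
have Ig2 : (\int[P]_w g2 w <= 1)%E.
  rewrite ge0_integralZl_EFin ?expR_ge0//; last exact: mind.
  rewrite integral_indic// setIT.
  apply: (@le_trans _ _ ((expR (b * A))%:E * (expR (b * (- K + 1)))%:E)%E).
    by rewrite lee_wpmul2l ?lee_fin ?expR_ge0.
  rewrite -EFinM lee_fin -expRD -mulrDr -[leRHS]expR0 ler_expR.
  by rewrite mulr_ge0_le0 ?(ltW bp)// /K; have := ler_norm A; lra.
(* [(mc j + e) + (- (mc j - e - v) + e) = v + 3 * e]: the cost at each center cancels against the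
   rate, which leaves the same exponent for all balls. *)
have Ig1 : (\int[P]_w g1 w <= (m%:R * expR (b * (v + 3 * e)))%:E)%E.
  rewrite /g1 ge0_integral_sum//.
  apply: (@le_trans _ _ (\sum_(j < m) (expR (b * (v + 3 * e)))%:E)%E); last first.
    by rewrite sumEFin sumr_const card_ord -[_ *+ m]mulr_natl.
  apply: lee_sum => j _; rewrite ge0_integralZl_EFin ?expR_ge0//; last exact: mind.
  rewrite integral_indic// setIT.
  apply: (@le_trans _ _ ((expR (b * (mc j + e)))%:E *
      (expR (b * (- (mc j - e - v) + e)))%:E)%E); last first.
    by rewrite -EFinM lee_fin -expRD -mulrDr ler_expR ler_wpM2l ?(ltW bp)//; lra.
  rewrite lee_wpmul2l ?lee_fin ?expR_ge0//.
  apply: (le_trans _ (POn j)); apply: le_measure; rewrite ?inE//.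
    by apply: rcll_event_measurable => //; exact: measurable_cball.
  move=> w [r [eta etad ob]]; split => // t t0T i; exact: le_trans (ob t t0T i) (ltW etad).
have I0 : (0 <= \int[P]_w expeR (b%:E * path_cost M n (policy M f n i0) w))%E.
  by apply: integral_ge0 => w _; exact: expeR_ge0.
apply: (@le_trans _ _ (Jn M n (policy M f n i0))).
  by apply: ereal_inf_lbound; exists (policy M f n i0).
rewrite JnE lee_pdivrMl// -EFinM lne_leP//.
have intE : (\int[P]_w (g1 w + g2 w + G n w + g3 w) =
    \int[P]_w g1 w + \int[P]_w g2 w + \int[P]_w G n w + \int[P]_w g3 w)%E.
  have m12 : measurable_fun setT (fun w => g1 w + g2 w)%E by exact: emeasurable_funD.
  have m123 : measurable_fun setT (fun w => g1 w + g2 w + G n w)%E by exact: emeasurable_funD.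
  rewrite ge0_integralD// => [|w _]; last by rewrite !adde_ge0.
  rewrite ge0_integralD// => [|w _]; last by rewrite adde_ge0.
  by rewrite ge0_integralD.
apply: (@le_trans _ _ (\int[P]_w (g1 w + g2 w + G n w + g3 w))%E).
  apply: ge0_integral_le => w _; last by rewrite !adde_ge0.
  by split => //; exact: expeR_ge0.
rewrite intE Ig3 adde0.
(* Balls, far event and tail add up to at most [(m + 2) * expR (b * (v + 3 * e))], and [big] turns
   the prefactor into the fourth [e]. *)
apply: (@le_trans _ _ ((m%:R * expR (b * (v + 3 * e)))%:E + 1 + 1)%E).
  by apply: leeD => //; exact: leeD.
have x1 : 1 <= expR (b * (v + 3 * e)).
  by rewrite -[leLHS]expR0 ler_expR mulr_ge0 ?(ltW bp)// addr_ge0// mulr_ge0// ltW.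
rewrite /= -!EFinD lee_fin.
have -> : b * (v + 4 * e) = b * (v + 3 * e) + b * e by ring.
rewrite expRD; have := ler_wpM2l (expR_ge0 (b * (v + 3 * e))) big.
by rewrite mulrDr [m%:R * _]mulrC; move: x1; lra.
Unshelve. all: by end_near. Qed.

(** The zero path has zero rate and nonnegative cost. *)
Lemma game_value_ge0 : (0 <= game_value M)%E.
Proof.
rewrite (game_valueE mht costs cf fmin).
pose z : R -> 'rV[R]_(I + I) := fun=> 0.
have Pz : game_P M z.
  split => //; apply: unif_cont_cpath => i e e0; exists 1 => // s t _ _ _.
  by rewrite subrr normr0 ltW.
have a0 (k : nat) (c : 'I_k -> R) (phi : R -> 'rV[R]_k) :
    (forall t, phi t = 0) -> action T c phi = 0%E.
  move=> phi0; have pc (i : 'I_k) : (fun s => phi s ord0 i) = cst 0.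
    by apply/funext => t; rewrite phi0 mxE.
  rewrite /action asboolT; last first.
    split; last exact: phi0.
    move=> i e e0; exists 1 => // q a b _ _ _; rewrite big1// => j _.
    by rewrite !phi0 !mxE subrr normr0.
  rewrite big1 ?mule0// => i _; rewrite integral0_eq ?mule0// => t _.
  by rewrite pc derive1_cst expr0n.
have rz : rate M z = 0%E.
  by rewrite /rate !a0 ?adde0// => t; apply/rowP => i; rewrite /= !mxE.
apply: (@le_trans _ _ (min_cost M f z - rate M z)%E).
  by rewrite rz sube0; exact: (min_cost_ge0 mht costs fmin).
by apply: ereal_sup_ubound; exists z.
Qed.

Lemma Vn_cvg : (Vn M n @[n --> \oo] --> game_value M).
Proof.
have gv := game_valueE mht costs cf fmin.
apply: cvge_sandwich; first exact: game_value_ge0.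
  by move=> a; rewrite gv; exact: (Vn_ge prim mht costs cf fmin mdp).
move=> a; have := game_value_ge0; case gE : (game_value M) => [v||]//.
rewrite lee_fin lte_fin => v0 va; have e0 : 0 < (a - v) / 4 by rewrite divr_gt0// subr_gt0.
have := @Vn_le v _ v0 e0; rewrite (_ : v + 4 * _ = a); last by field.
apply => psi Pp; rewrite -gE gv; apply: ereal_sup_ubound; by exists psi.
Qed.

End convergence.

Theorem theorem2p1 (R : realType) (d : measure_display)
    (Omega : measurableType d) (P : probability Omega R) (I : nat)
    (M : queue_model P I) :
  renewal_primitives M ->
  moderate_heavy_traffic M ->
  cost_functions M ->
  moderate_deviation_principle M ->
  minimizing_curve M ->
  (~ bounded_cost (cost_g M) \/ ~ bounded_cost (cost_h M) -> exponential_moments M) ->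
  (Vn M n @[n --> \oo] --> game_value M)%classic.
Proof.
move=> prim mht costs mdp [f cf fmin] moments.
exact: (Vn_cvg prim mht costs mdp cf fmin moments).
Qed.
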